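(* Let $m\ge3$ and let $j(t):\mathfrak z\to\mathfrak{su}(m)$ be a family of linear maps which are pairwise isospectral, pairwise non equivalent, and each generic. Let $\lambda(t)$ be the associated $\mathfrak z$-valued 1-forms on $S^{2m+1}\subset\mathbb C^m\oplus\mathbb C$ and $g_{\lambda(t)}$ the associated metrics on $S^{2m+1}$ (defined in the context). Then the isospectral metrics $g_{\lambda(t)}$ on the sphere induce isospectral metrics on $\mathbb{RP}^{2m+1}$ in a canonical way. Precisely: for each $\lambda=\lambda(t)$, $$\lambda^k_{(p,q)}(X,U)=\lambda^k_{(-p,-q)}(-X,-U),\quad k=1,2,$$ so $\lambda$ is invariant under the antipodal map and hence induces a $\mathfrak z$-valued 1-form $\bar\lambda$ on $\mathbb{RP}^{2m+1}$; with respect to the accordingly defined metric $g_{\bar\lambda}$ on $\mathbb{RP}^{2m+1}$, the projection $(S^{2m+1},g_\lambda)\to(\mathbb{RP}^{2m+1},g_{\bar\lambda})$ is a Riemannian covering; and the metrics $g_{\bar\lambda(t)}$ on $\mathbb{RP}^{2m+1}$ are pairwise isospectral.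
   Context: Two compact Riemannian manifolds are isospectral if their Laplace operators on functions have the same eigenvalues with multiplicities. $T=(\mathbb R/2\pi\mathbb Z)^2$ has Lie algebra $\mathfrak z\cong\mathbb R^2$ with standard basis $Z_1,Z_2$; $j_Z:=j(Z)$; $\mathfrak{su}(m)$ is the Lie algebra of skew-Hermitian trace-free complex $m\times m$ matrices. For linear maps $j,j':\mathfrak z\to\mathfrak{su}(m)$: they are isospectral if for every $Z\in\mathfrak z$ there is $A_Z\in SU(m)$ with $j'_Z=A_Zj_ZA_Z^{-1}$; they are equivalent if there exist $A\in SU(m)\cup SU(m)\circ Q$ ($Q$ = complex conjugation on $\mathbb C^m$) and a linear automorphism $\Psi$ of $\mathfrak z$ preserving $\{\pm Z_1,\pm Z_2\}$ with $j'_Z=Aj_{\Psi(Z)}A^{-1}$ for all $Z$; $j$ is generic if no nonzero element of $\mathfrak{su}(m)$ commutes with both $j_{Z_1}$ and $j_{Z_2}$. Points of $S^{2m+1}\subset\mathbb C^{m+1}=\mathbb C^m\oplus\mathbb C$ are written $(p,q)$, and tangent vectors $(X,U)$. $T$ acts on the sphere by $\exp(aZ_1+bZ_2)(p,q)=(e^{ia}p,e^{ib}q)$. With $\langle X,Y\rangle=\sum_i\mathrm{Re}(X_i\overline{Y_i})$, the $\mathfrak z$-valued 1-form $\lambda=\lambda^1Z_1+\lambda^2Z_2$ associated with $j$ is the restriction to the sphere of $$\lambda^k_{(p,q)}(X,U)=|p|^2\langle j_{Z_k}p,X\rangle-\langle X,ip\rangle\langle j_{Z_k}p,ip\rangle,\quad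 k=1,2.$$ For $Z\in\mathfrak z$, $Z^*$ is the vector field $x\mapsto\frac{d}{dt}|_{t=0}\exp(tZ)x$. With $g_0$ the round metric on $S^{2m+1}$, $g_\lambda(V,W)=g_0(V+\lambda(V)^*,W+\lambda(W)^* )$, where $\lambda(V)^*$ is evaluated at the foot point of $V$. The metrics $g_{\lambda(t)}$ on the sphere are known to be isospectral. The $T$-action commutes with the antipodal map and so descends to $\mathbb{RP}^{2m+1}=S^{2m+1}/\{\pm1\}$; $g_{\bar\lambda}$ is defined by the same formula from $\bar\lambda$, the round metric on $\mathbb{RP}^{2m+1}$ and the induced vector fields $Z^*$ there. *)

(* Defs.v *)
From HB Require Import structures.
From mathcomp Require Import all_boot all_order all_algebra.
From mathcomp Require Import all_classical all_reals all_analysis.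
From mathcomp Require Import complex ring.

Set Implicit Arguments.
Unset Strict Implicit.
Unset Printing Implicit Defensive.
Import Order.TTheory GRing.Theory Num.Theory numFieldNormedType.Exports.
Local Open Scope classical_set_scope.
Local Open Scope ring_scope.
Local Open Scope quotient_scope.

Section Smooth.
Variables (R : realType) (n : nat).
Implicit Types (U : set 'rV[R]_n) (f g : 'rV[R]_n -> R).

Fixpoint Ck (k : nat) U f : Prop :=
  (forall u, U u -> {for u, continuous f}) /\
  if k is k'.+1 then
    forall v, (forall u, U u -> derivable f u v) /\ Ck k' U ('D_v f)
  else True.

(* [U] is meant to be open. *)
Definition smooth U f : Prop := forall k, Ck k U f.

Lemma Ck_cont k U f : Ck k U f -> forall u, U u -> {for u, continuous f}.
Proof. by case: k => [|k] []. Qed.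

Lemma CkS k U f : Ck k.+1 U f -> Ck k U f.
Proof.
elim: k f => [|k IH] f; first by case.
move=> [cf df]; split=> // v; have [dv Dv] := df v; split => //.
exact: IH.
Qed.

Lemma Ck_intro k U f : (forall u, U u -> {for u, continuous f}) ->
  (forall k' v, k = k'.+1 -> (forall u, U u -> derivable f u v) /\
     Ck k' U ('D_v f)) -> Ck k U f.
Proof. by case: k => [|k] cf df; split=> // v; exact: df. Qed.

Lemma eq_Ck k U f g : open U -> (forall u, U u -> f u = g u) ->
  Ck k U f -> Ck k U g.
Proof.
move=> oU; elim: k f g => [|k IH] f g fg fk.
all: have fgn u : U u -> \near u, f u = g u
  by move=> Uu; near=> w; apply: fg; near: w; exact: open_nbhs_nbhs.
all: apply: Ck_intro => [u Uu|k' v // [<-]];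
  first by rewrite /prop_for /continuous_at -(fg u Uu);
     apply: (cvg_trans (near_eq_cvg (fgn u Uu))); exact: Ck_cont fk _ Uu.
have [dv Dv] := fk.2 v.
split=> [u Uu|]; first exact: near_eq_derivable (fgn _ Uu) (dv _ Uu).
by apply: IH Dv => u Uu; apply: near_eq_derive; exact: fgn.
Unshelve. all: by end_near.
Qed.

Lemma Ck_cst k U (c : R) : Ck k U (cst c).
Proof.
elim: k c => [|k IH] c; apply: Ck_intro => [u _|k' v // [<-]];
  try exact: cst_continuous.
split=> [u _|]; first exact: derivable_cst.
rewrite (_ : 'D_v _ = cst 0) //; apply/funext => u; exact: derive_cst.
Qed.

Lemma CkD k U f g : open U -> Ck k U f -> Ck k U g ->
  Ck k U (fun u => f u + g u).
Proof.
move=> oU; elim: k f g => [|k IH] f g fk gk.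
all: apply: Ck_intro => [u Uu|k' v // [<-]];
  first by apply: continuousD; [exact: Ck_cont fk _ Uu|exact: Ck_cont gk _ Uu].
have [dfv Dfv] := fk.2 v; have [dgv Dgv] := gk.2 v.
split=> [u Uu|]; first by apply: derivableD; [exact: dfv|exact: dgv].
apply: eq_Ck (IH _ _ Dfv Dgv) => // u Uu.
by rewrite deriveD //; [exact: dfv|exact: dgv].
Qed.

Lemma CkM k U f g : open U -> Ck k U f -> Ck k U g ->
  Ck k U (fun u => f u * g u).
Proof.
move=> oU; elim: k f g => [|k IH] f g fk gk.
all: apply: Ck_intro => [u Uu|k' v // [<-]];
  first by apply: continuousM; [exact: Ck_cont fk _ Uu|exact: Ck_cont gk _ Uu].
have [dfv Dfv] := fk.2 v; have [dgv Dgv] := gk.2 v.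
split=> [u Uu|]; first by apply: derivableM; [exact: dfv|exact: dgv].
apply: eq_Ck (CkD oU (IH _ _ (CkS fk) Dgv) (IH _ _ (CkS gk) Dfv)) => // u Uu.
by rewrite deriveM //; [exact: dfv|exact: dgv].
Qed.

Lemma CkV k U f : open U -> (forall u, U u -> f u != 0) -> Ck k U f ->
  Ck k U (fun u => (f u)^-1).
Proof.
move=> oU f0; elim: k => [|k IH] fk.
all: apply: Ck_intro => [u Uu|k' v // [<-]];
  first exact: (continuousV (f0 u Uu) (Ck_cont fk Uu)).
have [dfv Dfv] := fk.2 v.
split=> [u Uu|]; first exact: (derivableV (f0 u Uu) (dfv u Uu)).
have fV := IH (CkS fk).
apply: eq_Ck (CkM oU (CkM oU (Ck_cst k U (-1)) (CkM oU fV fV)) Dfv) => // u Uu.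
rewrite (deriveV (f0 u Uu) (dfv u Uu)) /= mulN1r /GRing.scale/= expr2.
by rewrite invfM.
Qed.

Lemma Ck_coord k U i : Ck k U (fun u => u ord0 i).
Proof.
have did v u : derivable (@id 'rV[R]_n) u v by exact: derivable_id.
have dc v u : derivable (fun u : 'rV[R]_n => u ord0 i) u v.
  by move/derivable_mxP: (did v u) => /(_ ord0 i).
apply: Ck_intro => [u _|k' v _]; first exact: coord_continuous.
split=> [u _|]; first exact: dc.
rewrite (_ : 'D_v _ = cst (v ord0 i)); first exact: Ck_cst.
apply/funext => u; have e : 'D_v (@id 'rV[R]_n) u = v by exact: derive_id.
by rewrite /= -[in RHS]e (derive_mx (did v u)) mxE.
Qed.

End Smooth.

(* A smooth [n]-manifold, given by an atlas of charts that map onto R^n.  There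
   is one preferred chart [coord x] around each point [x]; its inverse is
   [param x] and its domain is [range (param x)].  Outside the domain [coord x]
   is a junk value.  The topology is the one defined by the charts;
   separation and countability are not part of the structure. *)
Record manifold (R : realType) (n : nat) := Manifold {
  point :> Type;
  param : point -> 'rV[R]_n -> point;
  coord : point -> point -> 'rV[R]_n;
  paramK : forall x, cancel (param x) (coord x);
  param_center : forall x, param x (coord x x) = x;
  overlap_open : forall x y, open (param x @^-1` range (param y));
  transition_smooth : forall x y i,
    smooth (param x @^-1` range (param y)) (fun u => coord y (param x u) 0 i)
}.

Section Maps.
Variables (R : realType) (n p : nat) (M : manifold R n) (N : manifold R p).

Definition mopen (A : set M) := forall x, open (param x @^-1` A).

(* [A] is meant to be open; the first clause is continuity on [A]. *)
Definition msmooth_on (A : set M) (f : M -> N) :=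
  forall x y, let D := param x @^-1` (A `&` f @^-1` range (param y)) in
    open D /\ forall i, smooth D (fun u => coord y (f (param x u)) 0 i).

Definition msmooth_fun (f : M -> R) := forall x, smooth setT (f \o param x).

(* The tangent space at [x] is R^n, by means of the basis of coordinate fields
   of the preferred chart at [x]. *)
Definition mdiff (f : M -> N) (x : M) (V : 'rV[R]_n) : 'rV[R]_p :=
  'D_V (coord (f x) \o f \o param x) (coord x x).

Definition velocity (c : R -> M) : 'rV[R]_n := (coord (c 0) \o c)^`()%classic 0.

End Maps.

Section Covering.
Variables (R : realType) (n : nat) (M N : manifold R n).

Definition diffeo_on (U : set M) (V : set N) (f : M -> N) :=
  exists s : N -> M,
    [/\ msmooth_on U f, msmooth_on V s,
        forall x, U x -> V (f x) /\ s (f x) = x &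
        forall y, V y -> U (s y) /\ f (s y) = y].

Definition smooth_covering (f : M -> N) :=
  msmooth_on setT f /\ (forall y, exists x, f x = y) /\
  forall y, exists V : set N, exists F : set (set M),
    [/\ mopen V, V y, trivIset F id, f @^-1` V = \bigcup_(U in F) U &
        forall U, F U -> mopen U /\ diffeo_on U V f].

End Covering.

Section Riemannian.
Variables (R : realType) (n : nat) (M : manifold R n).

(* The vector [v] of R^n in the chart [param x] at [u], as a tangent vector at
   [param x u]. *)
Definition coord_vector (x : M) (u v : 'rV[R]_n) : 'rV[R]_n :=
  'D_v (coord (param x u) \o param x) u.

Definition metric := M -> 'rV[R]_n -> 'rV[R]_n -> R.

Definition gram (g : metric) (x : M) (u : 'rV[R]_n) : 'M[R]_n :=
  \matrix_(i, j) g (param x u) (coord_vector x u (delta_mx 0 i))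
                               (coord_vector x u (delta_mx 0 j)).

Definition riemannian (g : metric) :=
  [/\ forall x W, linear ((g x)^~ W : 'rV[R]_n -> R^o),
      forall x V W, g x V W = g x W V,
      forall x V, V != 0 -> 0 < g x V V &
      forall x i j, smooth setT (fun u => gram g x u i j)].

(* - (det G)^(-1/2) \sum_ij d_i ((det G)^(1/2) G^ij d_j f) *)
Definition laplace (g : metric) (f : M -> R) (x : M) : R :=
  let G := gram g x in
  let flux i u := Num.sqrt (\det (G u)) *
    \sum_j invmx (G u) i j * 'D_(delta_mx 0 j) (f \o param x) u in
  - (Num.sqrt (\det (G (coord x x))))^-1 *
    \sum_i 'D_(delta_mx 0 i) (flux i) (coord x x).

Definition eigenfunction (g : metric) (a : R) (f : M -> R) :=
  msmooth_fun f /\ forall x, laplace g f x = a * f x.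

Definition fun_free (k : nat) (f : 'I_k -> M -> R) :=
  forall c : 'I_k -> R, (forall x, \sum_i c i * f i x = 0) -> forall i, c i = 0.

(* The dimension of the eigenspace; it is 0 if [a] is not an eigenvalue. *)
Definition multiplicity (g : metric) (a : R) : \bar R :=
  ereal_sup [set (k%:R)%:E | k in [set k | exists f : 'I_k -> M -> R,
    fun_free f /\ forall i, eigenfunction g a (f i)]].

Definition form (d : nat) := M -> 'rV[R]_n -> 'rV[R]_d.

(* R^d-valued 1-forms *)
Definition one_form d (w : form d) :=
  (forall x, linear (w x)) /\
  forall x i k,
    smooth setT (fun u => w (param x u) (coord_vector x u (delta_mx 0 i)) 0 k).

Variable act : 'rV[R]_2 -> M -> M.

Definition fundamental (Z : 'rV[R]_2) (x : M) : 'rV[R]_n :=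
  velocity (fun t => act (t *: Z) x).

Definition twist (g : metric) (w : form 2) : metric := fun x V W =>
  g x (V + fundamental (w x V) x) (W + fundamental (w x W) x).

End Riemannian.

Definition isospectral (R : realType) (n p : nat) (M : manifold R n)
    (N : manifold R p) (g : metric M) (h : metric N) :=
  forall a, multiplicity g a = multiplicity h a.

Definition riemannian_covering (R : realType) (n : nat) (M N : manifold R n)
    (g : metric M) (h : metric N) (f : M -> N) :=
  [/\ riemannian g, riemannian h, smooth_covering f &
      forall x V W, h (f x) (mdiff f x V) (mdiff f x W) = g x V W].

Section SphereCharts.
Variables (R : realType) (n : nat).
Implicit Types (v : 'rV[R]_n.+1) (u : 'rV[R]_n) (k l : 'I_n.+1).

Definition sqnorm (y : 'rV[R]_n.+1) : R := \sum_i y 0 i ^+ 2.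

Definition sphere := {x : 'rV[R]_n.+1 | sqnorm x == 1}.

Lemma sphereP (x : sphere) : sqnorm (val x) = 1.
Proof. exact/eqP/(valP x). Qed.

Definition pivot (x : 'rV[R]_n.+1) : 'I_n.+1 :=
  odflt ord0 [pick k | x 0 k != 0].

Definition homog (k : 'I_n.+1) (u : 'rV[R]_n) : 'rV[R]_n.+1 :=
  \row_i oapp (u 0) 1 (unlift k i).

Definition affine (k : 'I_n.+1) (x : 'rV[R]_n.+1) : 'rV[R]_n :=
  \row_j (x 0 (lift k j) / x 0 k).

Lemma sqnormZ c v : sqnorm (c *: v) = c ^+ 2 * sqnorm v.
Proof. by rewrite /sqnorm mulr_sumr; apply: eq_bigr => i _; rewrite mxE exprMn. Qed.

Lemma pivotP (x : sphere) : val x 0 (pivot (val x)) != 0.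
Proof.
rewrite /pivot; case: pickP => [k //|x0].
suff s0 : sqnorm (val x) = 0.
  by have := sphereP x; rewrite s0 => /esym/eqP; rewrite oner_eq0.
apply: big1 => i _; have /negbFE/eqP-> := x0 i.
by rewrite expr0n.
Qed.

Lemma homog_pivot k u : homog k u 0 k = 1.
Proof. by rewrite mxE unlift_none. Qed.

Lemma homog_lift k u j : homog k u 0 (lift k j) = u 0 j.
Proof. by rewrite mxE liftK. Qed.

Lemma sqnorm_homog k u : 0 < sqnorm (homog k u).
Proof.
rewrite /sqnorm (bigD1 k) //= homog_pivot expr1n ltr_pwDl //.
by apply: sumr_ge0 => i _; exact: sqr_ge0.
Qed.

Lemma affineZ k c v : c != 0 -> affine k (c *: v) = affine k v.
Proof.
by move=> c0; apply/rowP => j; rewrite !mxE invfM mulrACA divff // mul1r.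
Qed.

Lemma affineN k v : affine k (- v) = affine k v.
Proof. by rewrite -scaleN1r affineZ // oppr_eq0 oner_eq0. Qed.

Lemma affine_homog k u : affine k (homog k u) = u.
Proof. by apply/rowP => j; rewrite !mxE liftK unlift_none divr1. Qed.

Lemma homog_affine k v : v 0 k != 0 -> homog k (affine k v) = (v 0 k)^-1 *: v.
Proof.
move=> vk; apply/rowP => i; rewrite !mxE.
by case: unliftP => [j ->|->] /=; rewrite ?mxE mulrC // divff.
Qed.

Definition sphere_scale (s : R) k u : R :=
  Num.sg s / Num.sqrt (sqnorm (homog k u)).

Lemma sphere_paramP (x : sphere) k u : val x 0 k != 0 ->
  sqnorm (sphere_scale (val x 0 k) k u *: homog k u) == 1.
Proof.
move=> xk; rewrite sqnormZ exprMn exprVn sqr_sqrtr ?ltW ?sqnorm_homog //.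
by rewrite sqr_sg xk mul1r mulVf // gt_eqF // sqnorm_homog.
Qed.

(* The chart around [x] is the central projection y |-> (y_j / y_k)_(j != k) of
   the open hemisphere { y | y_k has the sign of x_k }, where [k = pivot x]. *)
Definition sphere_param (x : sphere) (u : 'rV[R]_n) : sphere :=
  exist (fun y => sqnorm y == 1) _ (sphere_paramP u (pivotP x)).

Definition sphere_coord (x y : sphere) : 'rV[R]_n :=
  affine (pivot (val x)) (val y).

Lemma sphere_scale_neq0 (x : sphere) u :
  sphere_scale (val x 0 (pivot (val x))) (pivot (val x)) u != 0.
Proof.
rewrite mulf_neq0 ?sgr_eq0 ?pivotP // invr_eq0 sqrtr_eq0 -ltNge.
exact: sqnorm_homog.
Qed.

Lemma sphere_paramK x : cancel (sphere_param x) (sphere_coord x).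
Proof.
by move=> u; rewrite /sphere_coord /= affineZ ?sphere_scale_neq0 ?affine_homog.
Qed.

Lemma sphere_param_affine (x y : sphere) :
  0 < val x 0 (pivot (val x)) * val y 0 (pivot (val x)) ->
  sphere_param x (sphere_coord x y) = y.
Proof.
set k := pivot _ => xy; apply: val_inj => /=.
have xk : val x 0 k != 0 by exact: pivotP.
have yk : val y 0 k != 0.
  by apply: contraTneq xy => ->; rewrite mulr0 ltxx.
rewrite /sphere_scale -/k /sphere_coord -/k homog_affine // scalerA sqnormZ.
rewrite sphereP mulr1 sqrtr_sqr normfV invrK.
have -> : Num.sg (val x 0 k) = Num.sg (val y 0 k).
  move: xy; case: (ltrgt0P (val x 0 k)) xk => // x0 _.
    by rewrite pmulr_rgt0 // => y0; rewrite !gtr0_sg.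
  by rewrite nmulr_rgt0 // => y0; rewrite !ltr0_sg.
by rewrite -numEsg divff // scale1r.
Qed.

Lemma sphere_param_center x : sphere_param x (sphere_coord x x) = x.
Proof.
by apply: sphere_param_affine; rewrite -expr2 exprn_even_gt0 //= pivotP.
Qed.

Lemma Ck_homog r U k i : Ck r U (fun u => homog k u 0 i).
Proof.
case: (unliftP k i) => [j ->|->].
  have -> : (fun u => homog k u 0 (lift k j)) = (fun u => u 0 j).
    by apply/funext => u; rewrite homog_lift.
  exact: Ck_coord.
have -> : (fun u => homog k u 0 k) = cst 1.
  by apply/funext => u; rewrite homog_pivot.
exact: Ck_cst.
Qed.

Lemma homog_continuous k i : continuous (fun u => homog k u 0 i).
Proof. by move=> u; apply: (Ck_cont (@Ck_homog 0 setT k i)). Qed.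

Lemma Ck_affine r U k l j : open U -> (forall u, U u -> homog k u 0 l != 0) ->
  Ck r U (fun u => affine l (homog k u) 0 j).
Proof.
move=> oU h0; apply: eq_Ck (CkM oU (@Ck_homog r U k (lift l j))
  (CkV oU h0 (@Ck_homog r U k l))) => // u Uu.
by rewrite [RHS]mxE.
Qed.

Lemma sphere_domain (x y : sphere) :
  sphere_param x @^-1` range (sphere_param y) =
  [set u | 0 < Num.sg (val x 0 (pivot (val x))) * val y 0 (pivot (val y)) *
               homog (pivot (val x)) u 0 (pivot (val y))].
Proof.
set k := pivot (val x); set l := pivot (val y).
have xk : val x 0 k != 0 by exact: pivotP.
have yl : val y 0 l != 0 by exact: pivotP.
have e (a b c d : R) : b * (a / c * d) = c^-1 * (a * b * d).
  by rewrite mulrCA -!mulrA mulrCA; congr (_ * _); rewrite mulrCA.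
have pos u : 0 < (Num.sqrt (sqnorm (homog k u)))^-1.
  by rewrite invr_gt0 sqrtr_gt0 sqnorm_homog.
apply/seteqP; split=> u /=.
- move=> [w _ /(congr1 val)/=]; rewrite -/k -/l => /rowP/(_ l).
  rewrite [LHS]mxE [RHS]mxE homog_pivot mulr1 => h.
  rewrite -(pmulr_rgt0 _ (pos u)) -e -h /sphere_scale.
  by rewrite mulrA [_ * Num.sg _]mulrC -normrEsg divr_gt0 ?normr_gt0 ?sqrtr_gt0
    ?sqnorm_homog.
- move=> u0; exists (sphere_coord y (sphere_param x u)) => //.
  apply: sphere_param_affine; rewrite -/l /= -/k mxE /sphere_scale.
  by rewrite e pmulr_rgt0.
Qed.

Lemma sphere_domain_open (x y : sphere) :
  open (sphere_param x @^-1` range (sphere_param y)).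
Proof.
rewrite sphere_domain; set c := Num.sg _ * _; set k := pivot _; set l := pivot _.
apply: (@open_comp _ _ (fun u => c * homog k u 0 l) [set t | 0 < t]) => [u _|].
  exact: (continuousM (@cst_continuous _ _ c u) (@homog_continuous k l u)).
exact: open_gt.
Qed.

Lemma sphere_transition_smooth (x y : sphere) i :
  smooth (sphere_param x @^-1` range (sphere_param y))
         (fun u => sphere_coord y (sphere_param x u) 0 i).
Proof.
move=> r; have oU := @sphere_domain_open x y.
apply: eq_Ck (Ck_affine r i oU _) => // [u _|u].
  by rewrite /sphere_coord /= affineZ // sphere_scale_neq0.
by rewrite sphere_domain /= => h; apply: contraTneq h => ->; rewrite mulr0 ltxx.
Qed.

Definition sphere_manifold : manifold R n :=
  Manifold sphere_paramK sphere_param_center sphere_domain_open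
           sphere_transition_smooth.

Lemma antipodeP (x : sphere) : sqnorm (- val x) == 1.
Proof. by rewrite -scaleN1r sqnormZ sqrrN expr1n mul1r sphereP. Qed.

Definition antipode (x : sphere) : sphere :=
  exist (fun y => sqnorm y == 1) _ (antipodeP x).

Lemma antipodeK : involutive antipode.
Proof. by move=> x; apply: val_inj; rewrite /= opprK. Qed.

Definition antipodal : rel sphere := fun x y => (x == y) || (x == antipode y).

Lemma antipodal_refl : reflexive antipodal.
Proof. by move=> x; rewrite /antipodal eqxx. Qed.

Lemma antipodal_sym : symmetric antipodal.
Proof.
move=> x y; rewrite /antipodal eq_sym; congr (_ || _).
by apply/eqP/eqP => ->; rewrite antipodeK.
Qed.

Lemma antipodal_trans : transitive antipodal.
Proof.
move=> y x z /orP[/eqP->//|/eqP->] /orP[/eqP->|/eqP->].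
  by rewrite /antipodal eqxx orbT.
by rewrite antipodeK antipodal_refl.
Qed.

Canonical antipodal_equiv :=
  EquivRel antipodal antipodal_refl antipodal_sym antipodal_trans.

Definition projective := {eq_quot antipodal_equiv}.

Definition proj (x : sphere) : projective := \pi_projective x.

Lemma projP x y : proj x = proj y <-> x = y \/ x = antipode y.
Proof.
split=> [/eqmodP/orP[/eqP|/eqP]|]; [by left|by right|].
by move=> h; apply/eqmodP/orP; case: h => ->; [left|right].
Qed.

Lemma proj_repr (z : projective) : proj (repr z) = z.
Proof. exact: reprK. Qed.

Lemma repr_proj x : repr (proj x) = x \/ repr (proj x) = antipode x.
Proof. by apply/projP; rewrite proj_repr. Qed.

Lemma affine_repr k x : affine k (val (repr (proj x))) = affine k (val x).
Proof.
by case: (repr_proj x) => -> //=; rewrite affineN.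
Qed.

(* The charts of the sphere are injective modulo the antipodal map; the charts
   of the quotient are those that they induce, the affine charts. *)
Definition projective_param (z : projective) (u : 'rV[R]_n) : projective :=
  proj (sphere_param (repr z) u).

Definition projective_coord (z w : projective) : 'rV[R]_n :=
  sphere_coord (repr z) (repr w).

Lemma projective_coordE z y :
  projective_coord z (proj y) = sphere_coord (repr z) y.
Proof. by rewrite /projective_coord /sphere_coord affine_repr. Qed.

Lemma projective_paramK z : cancel (projective_param z) (projective_coord z).
Proof. by move=> u; rewrite projective_coordE sphere_paramK. Qed.

Lemma projective_param_center z :
  projective_param z (projective_coord z z) = z.
Proof. by rewrite /projective_param sphere_param_center proj_repr. Qed.

Lemma projective_domain z w :
  projective_param z @^-1` range (projective_param w) =
  [set u | homog (pivot (val (repr z))) u 0 (pivot (val (repr w))) != 0].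
Proof.
set x := repr z; set y := repr w; set k := pivot (val x); set l := pivot (val y).
apply/seteqP; split=> u /=.
- move=> [v _ /projP h]; apply/eqP => u0.
  have xu0 : val (sphere_param x u) 0 l = 0 by rewrite mxE -/k u0 mulr0.
  have : val (sphere_param y v) 0 l != 0.
    by rewrite mxE -/l homog_pivot mulr1 sphere_scale_neq0.
  case: h => ->; first by rewrite xu0 eqxx.
  by rewrite mxE xu0 oppr0 eqxx.
- move=> u0; exists (projective_coord w (projective_param z u)) => //.
  rewrite projective_coordE /projective_param -/x -/y.
  have : val (sphere_param x u) 0 l != 0.
    by rewrite mxE -/k mulf_neq0 // sphere_scale_neq0.
  have yl : val y 0 l != 0 by exact: pivotP.
  set a := sphere_param x u => al.
  have [ya|] := ltP 0 (val y 0 l * val a 0 l).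
    by rewrite sphere_param_affine.
  rewrite le_eqVlt mulf_eq0 (negbTE yl) (negbTE al) /= => ya.
  have -> : sphere_coord y a = sphere_coord y (antipode a).
    by rewrite /sphere_coord affineN.
  rewrite sphere_param_affine; first by apply/projP; right.
  by rewrite -/l mxE mulrN oppr_gt0.
Qed.

Lemma projective_domain_open z w :
  open (projective_param z @^-1` range (projective_param w)).
Proof.
rewrite projective_domain; set k := pivot _; set l := pivot _.
apply: (@open_comp _ _ (fun u => homog k u 0 l) [set t | t != 0]) => [u _|].
  exact: homog_continuous.
exact: open_neq.
Qed.

Lemma projective_transition_smooth z w i :
  smooth (projective_param z @^-1` range (projective_param w))
         (fun u => projective_coord w (projective_param z u) 0 i).
Proof.
move=> r; have oU := @projective_domain_open z w.
apply: eq_Ck (Ck_affine r i oU _) => // [u _|u].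
  by rewrite projective_coordE /sphere_coord /= affineZ // sphere_scale_neq0.
by rewrite projective_domain.
Qed.

Definition projective_manifold : manifold R n :=
  Manifold projective_paramK projective_param_center projective_domain_open
           projective_transition_smooth.

End SphereCharts.

Section Torus.
Variables (R : realType) (m : nat).

(* C^(m+1) = C^m (+) C as a real vector space: the real parts of the m+1
   complex coordinates, followed by their imaginary parts.  The coordinates
   of index < m are those of [p], the last one is [q]. *)
Definition ambient := 'rV[R]_(m.+1 + m.+1).

Definition zcoord (x : ambient) (i : 'I_m.+1) : R[i] :=
  (x 0 (lshift m.+1 i) +i* x 0 (rshift m.+1 i))%C.

Definition of_zcoord (z : 'I_m.+1 -> R[i]) : ambient :=
  row_mx (\row_i complex.Re (z i)) (\row_i complex.Im (z i)).

Definition pcoord (x : ambient) : 'cV[R[i]]_m :=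
  \col_i zcoord x (widen_ord (leqnSn m) i).

Definition dotr (x v : ambient) : R := \sum_i x 0 i * v 0 i.

Definition herm (X Y : 'cV[R[i]]_m) : R :=
  \sum_i complex.Re (X i 0 * (Y i 0)^*%C).

Definition expi (a : R) : R[i] := (cos a +i* sin a)%C.

Definition rotate (Z : 'rV[R]_2) (x : ambient) : ambient :=
  of_zcoord (fun i => expi (if (i < m)%N then Z 0 0 else Z 0 1) * zcoord x i).

Definition Sph := sphere_manifold R (m + m.+1).
Definition Proj := projective_manifold R (m + m.+1).

Lemma rotateP Z (x : sphere R (m + m.+1)) :
  sqnorm (rotate Z (val x) : 'rV_(m + m.+1).+1) == 1.
Proof.
have sqE (v : ambient) : sqnorm (v : 'rV_(m + m.+1).+1) =
    \sum_(i < m.+1) (v 0 (lshift _ i) ^+ 2 + v 0 (rshift _ i) ^+ 2).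
  by rewrite big_split; exact: (@big_split_ord _ _ _ m.+1 m.+1).
rewrite -[X in _ == X](sphereP x) !sqE; apply/eqP/eq_bigr => i _.
rewrite row_mxEl row_mxEr !mxE /expi /zcoord /=.
set a := if _ then _ else _.
move: (val x 0 _) (val x 0 _) => b c.
have := cos2Dsin2 a; move: (cos a) (sin a) => ca sa e.
rewrite -[RHS]mul1r -e; ring.
Qed.

Definition torus_sphere (Z : 'rV[R]_2) (x : Sph) : Sph :=
  exist (fun v => sqnorm v == 1) _ (rotateP Z x).

Definition quotient_map : Sph -> Proj := @proj R (m + m.+1).
Definition antipodal_map : Sph -> Sph := @antipode R (m + m.+1).
Definition rep (z : Proj) : Sph := repr (z : projective R (m + m.+1)).

Definition torus_proj (Z : 'rV[R]_2) (z : Proj) : Proj :=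
  quotient_map (torus_sphere Z (rep z)).

Definition embed (x : Sph) : ambient := val (x : sphere R (m + m.+1)).

(* The identification of the tangent space at [x] with the orthogonal
   complement of [x] in [ambient]. *)
Definition embed_vector (x : Sph) (V : 'rV[R]_(m + m.+1)) : ambient :=
  'D_V (embed \o param x) (coord x x).

Definition round_sphere : metric Sph :=
  fun x V W => dotr (embed_vector x V) (embed_vector x W).

(* The inverse of the differential of [quotient_map] at the representative
   [rep z]. *)
Definition lift_vector (z : Proj) (V : 'rV[R]_(m + m.+1)) : 'rV[R]_(m + m.+1) :=
  xget 0 [set W | mdiff quotient_map (rep z) W = V].

Definition round_proj : metric Proj := fun z V W =>
  round_sphere (rep z) (lift_vector z V) (lift_vector z W).

Definition descend d (w : form Sph d) : form Proj d :=
  fun z V => w (rep z) (lift_vector z V).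

End Torus.

Section LinearMaps.
Variables (R : realType) (m : nat).
Implicit Types (A X : 'M[R[i]]_m).

Definition adjmx X : 'M[R[i]]_m := (map_mx (@conjc R) X)^T.

Definition su X := adjmx X = - X /\ \tr X = 0.

Definition SU A := A *m adjmx A = 1%:M /\ \det A = 1.

(* R-linear maps from R^2 to complex m x m matrices; the values are constrained
   to [su] separately. *)
Definition zmap :=
  {linear 'rV[R]_2 -> 'M[R[i]]_m | (real_complex R : R -> R[i]) \; *:%R}.

Definition basis (k : 'I_2) : 'rV[R]_2 := delta_mx 0 k.

Definition isospectral_maps (j j' : zmap) :=
  forall Z, exists A, SU A /\ j' Z = A *m j Z *m invmx A.

Definition signed_basis : set 'rV[R]_2 :=
  [set Z | exists k, Z = basis k \/ Z = - basis k].

(* [phi] is [A] or the composition of [A] with complex conjugation. *)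
Definition equivalent_maps (j j' : zmap) :=
  exists A, exists phi : 'cV[R[i]]_m -> 'cV[R[i]]_m,
  exists Psi : {linear 'rV[R]_2 -> 'rV[R]_2},
    [/\ SU A,
        phi = mulmx A \/ phi = mulmx A \o map_mx (@conjc R),
        bijective Psi, Psi @` signed_basis = signed_basis &
        forall Z p, j' Z *m phi p = phi (j (Psi Z) *m p)].

Definition generic_map (j : zmap) :=
  forall X, su X -> (forall k, X *m j (basis k) = j (basis k) *m X) -> X = 0.

Definition lambda_amb (j : zmap) (k : 'I_2) (x v : ambient R m) : R :=
  let p := pcoord x in let X := pcoord v in
  let ip := ('i%C : R[i]) *: p in let jp := j (basis k) *m p in
  herm p p * herm jp X - herm X ip * herm jp ip.

Definition lambda_sphere (j : zmap) : form (Sph R m) 2 :=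
  fun x V => \row_k lambda_amb j k (embed x) (embed_vector x V).

Definition lambda_proj (j : zmap) : form (Proj R m) 2 :=
  descend (lambda_sphere j).

Definition metric_sphere (j : zmap) : metric (Sph R m) :=
  twist (@torus_sphere R m) (@round_sphere R m) (lambda_sphere j).

Definition metric_proj (j : zmap) : metric (Proj R m) :=
  twist (@torus_proj R m) (@round_proj R m) (lambda_proj j).

End LinearMaps.

(* Main.v *)
Require Import Defs.
From HB Require Import structures.
From mathcomp Require Import all_boot all_order all_algebra.
From mathcomp Require Import all_classical all_reals all_analysis.
From mathcomp Require Import complex ring lra zify.
Import Order.TTheory GRing.Theory Num.Theory numFieldNormedType.Exports.
Import Defs.
Local Open Scope classical_set_scope.
Local Open Scope ring_scope.

Set Implicit Arguments.
Unset Strict Implicit.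
Unset Printing Implicit Defensive.

(** The antipodal invariance of lambda is immediate, lambda^k being a cubic
    form in the foot point paired linearly with the tangent vector, and it lets
    lambda, the twisted metric and the charts descend; the substance is that
    the quotient metrics are isospectral.  The proof transplants eigenfunctions
    weight by weight under the torus T.

    Homogeneous form.  Put N = 2m + 2.  A function on the projective space is a
    function F on R^N minus the origin with F (t v) = F v for all t <> 0.  Write
    lambda^k as the scalar product with a vector field ell_k.  The fields ell_k
    are cubic, orthogonal to the radius and to the orbits of T, and T-invariant
    ([cubic_field], [lambda_ambE]).  The twist X |-> X + lambda(X)^* is therefore
    unipotent; it preserves volume, its inverse is explicit, and the Laplacian
    of the twisted metric becomes F |-> - div (flux F) with the Euclidean
    divergence and a field flux F that is linear in the Euclidean gradient of F
    ([laplace_gproj]).  Eigenfunctions on the projective space thus correspond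
    to homogeneous eigenfunctions of this operator ([eigenfunction_lift],
    [eigenfunction_descend]).

    Weights.  On functions of weight mu under T the derivative along the k-th
    circle is multiplication by i mu_k.  There the operator depends on the two
    fields ell_k only through sum_k mu_k ell_k, the field attached to
    j (sum_k mu_k Z_k) ([Lop_isotypic]).  If j and j' are isospectral, some A in
    SU(m) conjugates j (sum_k mu_k Z_k) into j' (sum_k mu_k Z_k).  The unitary
    map A (+) 1 commutes with T, and composition with it turns eigenfunctions
    of weight mu for j into eigenfunctions of weight mu for j', with the same
    eigenvalue ([eigen_transplant]).

    Multiplicities.  Given finitely many independent eigenfunctions, average
    them over T against the kernels ((1 + cos a) / 2)^n.  The averages are again
    eigenfunctions because T acts by isometries; they converge pointwise, so
    they are still independent for large n ([smoothing_free]); and they are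
    finite sums of weight components because the kernel is a trigonometric
    polynomial ([smoothing2_pieces]).  Transplant every component by the unitary
    map of its weight.  The sums stay independent, since a linear relation
    between them splits into relations between the components of equal weight,
    where one and the same invertible map was applied ([transplant]).  Real
    functions only see a weight up to sign, so the unitary map is chosen to
    depend on mu up to sign ([conjugatorN]).  Hence one multiplicity is at most
    the other ([le_multiplicity]), and the roles of j and j' can be exchanged. *)

(** * Differential calculus on R^n *)

Lemma continuous_sum (R : realType) (T : topologicalType) (I : Type) (r : seq I)
    (P : pred I) (F : I -> T -> R) (x : T) :
  (forall i, P i -> {for x, continuous (F i)}) ->
  {for x, continuous (fun y => \sum_(i <- r | P i) F i y)}.
Proof.
by move=> cF; apply: cvg_big => [|i Pi]; [exact: add_continuous|exact: cF].
Qed.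

Lemma cvg_rV (R : realType) (T : Type) (F : set_system T) n (f : T -> 'rV[R]_n) (l : 'rV[R]_n) :
  Filter F -> (forall i, f y 0 i @[y --> F] --> l 0 i) -> f y @[y --> F] --> l.
Proof.
move=> FF cf; apply/cvgrPdist_lt => e e0.
have := @filter_forall _ _ (fun i y => `|l 0 i - f y 0 i| < e) F FF
  (fun i => (@cvgrPdist_lt _ _ _ F FF _ _).1 (cf i) e e0).
apply: filterS => y H.
rewrite [ltLHS]/Num.Def.normr/= mx_normrE; apply: bigmax_lt => // -[i j] _ /=.
by rewrite !mxE ord1.
Qed.

Section Differentiability.
Variables (R : realType) (n : nat).
Implicit Types (U : set 'rV[R]_n) (f g : 'rV[R]_n -> R).

Local Notation e_ i := (delta_mx 0 i : 'rV[R]_n).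

Lemma derive_alongE (V : normedModType R) (f : V -> R) (x v : V) (s : R) :
  derivable f (x + s *: v) v <-> derivable (fun t : R => f (x + t *: v)) s 1.
Proof.
rewrite /derivable.
by under [X in _ <-> cvg (X @ _)]eq_fun do
  rewrite /= [(_%:A)](mulr1) scalerDl addrCA.
Qed.

Lemma derive_along (V : normedModType R) (f : V -> R) (x v : V) (s : R) :
  'D_v f (x + s *: v) = 'D_1 (fun t : R => f (x + t *: v)) s.
Proof.
rewrite /derive.
by under [X in _ = lim (X @ _)]eq_fun do
  rewrite /= [(_%:A)](mulr1) scalerDl addrCA.
Qed.

(** Both signs of [c] are covered because the increments to which this will be
    applied are the coordinates of an arbitrary vector. *)
Lemma MVT_along (V : normedModType R) (f : V -> R) (x v : V) (c : R) :
  (forall s : R, `|s| <= `|c| -> derivable f (x + s *: v) v) ->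
  exists2 s : R, `|s| <= `|c| & f (x + c *: v) - f x = c * 'D_v f (x + s *: v).
Proof.
move=> df; pose g (t : R) := f (x + t *: v).
have dg (s : R) : `|s| <= `|c| -> is_derive s 1 g ('D_v f (x + s *: v)).
  move=> sc; split; first by apply/derive_alongE; exact: df.
  by rewrite derive_along.
have cg (s : R) : `|s| <= `|c| -> {for s, continuous g}.
  by move=> sc; apply: differentiable_continuous; apply/derivable1_diffP; case: (dg s sc).
have g0 : f x = g 0 by rewrite /g scale0r addr0.
rewrite g0 -/(g c).
have [c0|c0] := leP 0 c.
- have sub (s : R) : s \in `[0, c]%R -> `|s| <= `|c|.
    by rewrite in_itv /= => /andP[s0 sc]; rewrite !ger0_norm.
  have [| |s sI ->] := @MVT_segment R g (fun s => 'D_v f (x + s *: v)) 0 c c0.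
  + by move=> s sI; apply: dg; apply: sub; apply: subset_itv_oo_cc.
  + apply: continuous_in_subspaceT => s; rewrite inE => sI.
    by apply: cg; apply: sub.
  by exists s; [exact: sub|rewrite subr0 mulrC].
- have sub (s : R) : s \in `[c, 0]%R -> `|s| <= `|c|.
    by rewrite in_itv /= => /andP[s0 sc]; rewrite !ler0_norm ?lerN2 // ltW.
  have [| |s sI e] := @MVT_segment R g (fun s => 'D_v f (x + s *: v)) c 0 (ltW c0).
  + by move=> s sI; apply: dg; apply: sub; apply: subset_itv_oo_cc.
  + apply: continuous_in_subspaceT => s; rewrite inE => sI.
    by apply: cg; apply: sub.
  by exists s; [exact: sub|rewrite -opprB e sub0r mulrN opprK mulrC].
Qed.

(** The points [u + trunc h k] are the vertices of the path from [u] to [u + h]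
    that moves along one coordinate axis at a time. *)
Definition trunc (h : 'rV[R]_n) (k : nat) : 'rV[R]_n :=
  \row_i (if (i < k)%N then h 0 i else 0).

Lemma trunc_norm (h z : 'rV[R]_n) :
  (forall i, `|z 0 i| <= `|h 0 i|) -> `|z| <= `|h|.
Proof.
move=> zh; rewrite [leLHS]/Num.Def.normr/= mx_normrE.
apply: bigmax_le => [|[i j] _ /=]; first exact: normr_ge0.
rewrite ord1; apply: le_trans (zh j) _.
by rewrite [leRHS]/Num.Def.normr/= mx_normrE; exact: (le_bigmax _ _ (ord0, j)).
Qed.

Lemma rV_sum (h : 'rV[R]_n) : h = \sum_i h 0 i *: e_ i.
Proof.
by rewrite {1}[h]row_sum_delta.
Qed.

Lemma coord_norm (h : 'rV[R]_n) i : `|h 0 i| <= `|h|.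
Proof.
by rewrite [leRHS]/Num.Def.normr/= mx_normrE; exact: (le_bigmax _ _ (ord0, i)).
Qed.

(** Telescope [f (u + h) - f u] along the path with vertices [u + trunc h k] and
    apply the mean value theorem to each of its segments.  The path stays within
    the sup norm of [h] from [u], so continuity of the partial derivatives bounds
    the difference to the linear part by a small multiple of the norm of [h]. *)
Lemma Ck_differentiable U f u : open U -> Ck 1 U f -> U u -> differentiable f u.
Proof.
move=> oU [_ df] Uu.
pose L (h : 'rV[R]_n) : R := \sum_i h 0 i * 'D_(e_ i) f u.
have Llin : linear (L : 'rV[R]_n -> R^o).
  move=> a x y; rewrite /L scaler_sumr -big_split /=; apply: eq_bigr => i _.
  by rewrite !mxE mulrDl scalerAl.
pose Lm := HB.pack_for {linear 'rV[R]_n -> R^o} (L : 'rV[R]_n -> R^o)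
  (GRing.isLinear.Build _ _ _ _ _ Llin).
have cL : continuous (Lm : 'rV[R]_n -> R^o).
  move=> h; apply: continuous_sum => i _; apply: continuousM; first exact: coord_continuous.
  exact: cst_continuous.
have key : (f : 'rV[R]_n -> R^o) \o shift u = cst (f u : R^o) + (Lm : 'rV[R]_n -> R^o) +o_ (0 : 'rV[R]_n) id.
  apply/eqaddoP => _/posnumP[e].
  have /nbhs_ballP[r /= r0 Br] : \forall y \near u, U y /\
      forall i, `|'D_(e_ i) f y - 'D_(e_ i) f u| < e%:num / n.+1%:R.
    near=> y; split; first by near: y; exact: open_nbhs_nbhs.
    near: y; apply: filter_forall => i.
    have := (df (e_ i)).2.1 u Uu.
    move=> /cvgrPdist_lt /(_ (e%:num / n.+1%:R)) c; near=> y.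
    rewrite distrC; near: y; apply: c.
    by rewrite divr_gt0.
  have inB (z : 'rV[R]_n) : `|z| < r -> ball u r (u + z).
    by move=> zr; rewrite -ball_normE /= opprD addNKr normrN.
  near=> h.
  have hr : `|h| < r.
    near: h; apply/nbhs_ballP; exists r => //= y; rewrite -ball_normE /=.
    by rewrite sub0r normrN.
  rewrite !fctE /=.
  have step (i : 'I_n) : exists2 z : 'rV[R]_n, `|z| <= `|h| &
     f (u + trunc h i.+1) - f (u + trunc h i) = h 0 i * 'D_(e_ i) f (u + z).
    have eT (s : R) : u + trunc h i + s *: e_ i = u + (trunc h i + s *: e_ i).
      by rewrite addrA.
    have nT (s : R) : `|s| <= `|h 0 i| -> `|trunc h i + s *: e_ i| <= `|h|.
      move=> sh; apply: trunc_norm => j; rewrite !mxE eqxx /=.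
      have [<-|nij] := eqVneq i j; first by rewrite ltnn mulr1 add0r.
      by rewrite mulr0 addr0; case: ifP => //; rewrite normr0.
    have tS : trunc h i.+1 = trunc h i + h 0 i *: e_ i.
      apply/rowP => j; rewrite !mxE eqxx /= ltnS leq_eqVlt.
      have [ji|nij] := eqVneq (j : nat) i.
        by rewrite (val_inj ji) eqxx ltnn mulr1 add0r.
      by rewrite (_ : (j == i) = false) ?mulr0 ?addr0 //; apply/eqP => ji; move: nij; rewrite ji eqxx.
    have [|s sh es] := @MVT_along _ f (u + trunc h i) (e_ i) (h 0 i).
      move=> s sh; rewrite eT; apply: (df (e_ i)).1.
      by have [] := Br _ (inB _ (le_lt_trans (nT _ sh) hr)).
    exists (trunc h i + s *: e_ i); first exact: nT.
    by rewrite -eT -es tS addrA.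
  have -> : f (h + u) - (f u + L h) = \sum_(i < n) (f (u + trunc h i.+1) - f (u + trunc h i)
      - h 0 i * 'D_(e_ i) f u).
    rewrite sumrB opprD addrA; congr (_ - _).
    rewrite -(big_mkord xpredT (fun i => f (u + trunc h i.+1) - f (u + trunc h i))) telescope_sumr //.
    congr (_ - _); last by rewrite (_ : trunc h 0 = 0) ?addr0 //; apply/rowP => i; rewrite !mxE.
    by rewrite addrC; congr (f (_ + _)); apply/rowP => i; rewrite !mxE ltn_ord.
  apply: le_trans (ler_norm_sum _ _ _) _.
  apply: (@le_trans _ _ (\sum_(i < n) e%:num / n.+1%:R * `|h|)).
    apply: ler_sum => i _; have [z zh ->] := step i.
    rewrite -mulrBr normrM mulrC ler_pM //; last exact: coord_norm.
    by have [_ /(_ i)/ltW] := Br _ (inB _ (le_lt_trans zh hr)).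
  rewrite sumr_const card_ord -mulrnAl ler_pM //.
  rewrite -mulr_natr -mulrA ler_piMr // mulrC ler_pdivrMr // mul1r ler_nat.
  exact: leqnSn.
have dL := @diff_unique _ _ R^o f Lm u cL key.
by apply/(@diff_locallyP _ _ R^o); rewrite dL.
Unshelve. all: by end_near. Qed.

Lemma derive_rV U f u v : open U -> Ck 1 U f -> U u ->
  'D_v f u = \sum_i v 0 i * 'D_(e_ i) f u.
Proof.
move=> oU fk Uu; have df := Ck_differentiable oU fk Uu.
rewrite deriveE // {1}[v]rV_sum linear_sum /=; apply: eq_bigr => i _.
by rewrite linearZ /= deriveE.
Qed.

Lemma Ck_mono k l U f : (k <= l)%N -> Ck l U f -> Ck k U f.
Proof.
move=> kl; rewrite -(subnK kl); elim: (l - k)%N => // d IH fk.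
by apply: IH; apply: CkS; rewrite -addSn.
Qed.

Lemma CkSE k U f : (forall u, U u -> {for u, continuous f}) ->
  (forall v, (forall u, U u -> derivable f u v) /\ Ck k U ('D_v f)) -> Ck k.+1 U f.
Proof. by move=> cf df; split. Qed.

Lemma sub_Ck k U U' f : U' `<=` U -> Ck k U f -> Ck k U' f.
Proof.
move=> UU; elim: k f => [|k IH] f [cf df]; first by split=> // u /UU/cf.
apply: CkSE => [u /UU/cf //|v]; have [dv Dv] := df v.
by split=> [u /UU/dv //|]; exact: IH.
Qed.

Lemma Ck_local k U f : (forall u, U u -> exists V, [/\ V u & Ck k V f]) -> Ck k U f.
Proof.
elim: k f => [|k IH] f H.
  by split=> // u /H[V [Vu [cf _]]]; exact: cf.
apply: CkSE => [u /H[V [Vu [cf _]]]|v]; first exact: cf.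
split=> [u /H[V [Vu [_ /(_ v)[dv _]]]]|]; first exact: dv.
by apply: IH => u /H[V [Vu [_ /(_ v)[_ Dv]]]]; exists V.
Qed.

Lemma Ck_sum k U (I : Type) (r : seq I) (F : I -> 'rV[R]_n -> R) : open U ->
  (forall i, Ck k U (F i)) -> Ck k U (fun u => \sum_(i <- r) F i u).
Proof.
move=> oU Fk; elim: r => [|i r IH].
  by apply: eq_Ck (Ck_cst k U 0) => // u _; rewrite big_nil.
by apply: eq_Ck (CkD oU (Fk i) IH) => // u _; rewrite big_cons.
Qed.

Lemma CkN k U f : open U -> Ck k U f -> Ck k U (fun u => - f u).
Proof.
move=> oU fk; apply: eq_Ck (CkM oU (Ck_cst k U (-1)) fk) => // u _.
by rewrite /= mulN1r.
Qed.

Lemma CkX k U f p : open U -> Ck k U f -> Ck k U (fun u => f u ^+ p).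
Proof.
move=> oU fk; elim: p => [|p IH].
  by apply: eq_Ck (Ck_cst k U 1) => // u _; rewrite expr0.
by apply: eq_Ck (CkM oU fk IH) => // u _; rewrite exprS.
Qed.

End Differentiability.

Section VectorValued.
Variables (R : realType) (n : nat).

Lemma differentiable_rV (V : normedModType R) (f : V -> 'rV[R]_n) x :
  (forall i, differentiable (fun y => f y 0 i) x) -> differentiable f x.
Proof.
move=> df.
have -> : f = (fun y => \sum_i f y 0 i *: delta_mx 0 i).
  by apply/funext => y; exact: rV_sum.
have -> : (fun y => \sum_i f y 0 i *: (delta_mx 0 i : 'rV[R]_n)) =
  \sum_i (fun y => f y 0 i *: (delta_mx 0 i : 'rV[R]_n)).
  by apply/funext => y; rewrite fct_sumE.
by apply: differentiable_sum => i; exact: differentiableZl.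
Qed.

Lemma differentiable_coord_rV (V : normedModType R) (f : V -> 'rV[R]_n) x i :
  differentiable f x -> differentiable (fun y => f y 0 i) x.
Proof.
move=> df; apply: (@differentiable_comp _ _ _ _ f (fun v : 'rV[R]_n => v 0 i)) => //.
exact: differentiable_coord.
Qed.

Lemma derive_coord (V : normedModType R) (f : V -> 'rV[R]_n) x v i :
  differentiable f x -> 'D_v f x 0 i = 'D_v (fun y => f y 0 i) x.
Proof. by move=> df; rewrite derive_mx ?mxE //; exact: diff_derivable. Qed.

Lemma derive_comp (V W Z : normedModType R) (f : V -> W) (g : W -> Z) x v :
  differentiable f x -> differentiable g (f x) ->
  'D_v (g \o f) x = 'D_('D_v f x) g (f x).
Proof.
move=> df dg; rewrite !deriveE //; last exact: differentiable_comp.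
by rewrite diff_comp.
Qed.

End VectorValued.

(** Induction on [k]: a directional derivative of the composite is a sum of
    products of a derivative of [phi] with a partial derivative of [f] composed
    with [phi], and the induction hypothesis applies to the latter. *)
Lemma Ck_comp (R : realType) (p n k : nat) (V : set 'rV[R]_p) (U : set 'rV[R]_n)
    (phi : 'rV[R]_p -> 'rV[R]_n) (f : 'rV[R]_n -> R) :
  open V -> open U -> (forall x, V x -> U (phi x)) ->
  (forall i, Ck k V (fun x => phi x 0 i)) -> Ck k U f -> Ck k V (f \o phi).
Proof.
move=> oV oU VU; elim: k f => [|k IH] f phik fk.
  have cphi x : V x -> {for x, continuous phi}.
    by move=> Vx; apply: (@cvg_rV _ _ (nbhs x)) => i; exact: (phik i).1.
  split=> // x Vx; apply: continuous_comp; first exact: cphi.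
  exact: fk.1 (VU x Vx).
have phi1 i : Ck 1 V (fun x => phi x 0 i) by exact: Ck_mono (phik i).
have f1 : Ck 1 U f by exact: Ck_mono fk.
have dphi x : V x -> differentiable phi x.
  move=> Vx; apply: differentiable_rV => i.
  exact: (Ck_differentiable oV (phi1 i)).
have df x : V x -> differentiable f (phi x).
  by move=> Vx; apply: (Ck_differentiable oU f1); exact: VU.
have dfphi x : V x -> differentiable (f \o phi) x.
  by move=> Vx; apply: differentiable_comp; [exact: dphi|exact: df].
apply: CkSE => [x Vx|v]; first by apply: differentiable_continuous; exact: dfphi.
split=> [x Vx|]; first by apply: diff_derivable; exact: dfphi.
apply: (@eq_Ck _ _ _ _ (fun x => \sum_i 'D_v (fun y => phi y 0 i) x *
   ('D_(delta_mx 0 i) f \o phi) x)) => // [x Vx|].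
  rewrite derive_comp //; [|exact: dphi|exact: df].
  rewrite (derive_rV _ oU f1 (VU x Vx)); apply: eq_bigr => i _.
  by rewrite derive_coord //; exact: dphi.
apply: Ck_sum => // i; apply: CkM => //; first by have [_] := (phik i).2 v.
by apply: IH => [l|]; [exact: CkS|exact: (fk.2 _).2].
Qed.

(** * Vector calculus on R^N minus the origin *)

Section SmoothClosure.
Variables (R : realType) (n : nat) (U : set 'rV[R]_n).
Hypothesis oU : open U.
Implicit Types f g : 'rV[R]_n -> R.

Lemma eq_smooth f g : (forall u, U u -> f u = g u) -> smooth U f -> smooth U g.
Proof. by move=> fg fk k; exact: eq_Ck (fk k). Qed.

Lemma smooth_cst (c : R) : smooth U (fun=> c).
Proof. by move=> k; exact: Ck_cst. Qed.

Lemma smoothD f g : smooth U f -> smooth U g -> smooth U (fun u => f u + g u).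
Proof. by move=> fk gk k; exact: CkD. Qed.

Lemma smoothM f g : smooth U f -> smooth U g -> smooth U (fun u => f u * g u).
Proof. by move=> fk gk k; exact: CkM. Qed.

Lemma smoothN f : smooth U f -> smooth U (fun u => - f u).
Proof. by move=> fk k; exact: CkN. Qed.

Lemma smoothB f g : smooth U f -> smooth U g -> smooth U (fun u => f u - g u).
Proof. by move=> fk gk; apply: smoothD => //; exact: smoothN. Qed.

Lemma smoothV f : (forall u, U u -> f u != 0) -> smooth U f ->
  smooth U (fun u => (f u)^-1).
Proof. by move=> f0 fk k; exact: CkV. Qed.

Lemma smoothX f p : smooth U f -> smooth U (fun u => f u ^+ p).
Proof. by move=> fk k; exact: CkX. Qed.

Lemma smooth_sum (I : Type) (r : seq I) (F : I -> 'rV[R]_n -> R) :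
  (forall i, smooth U (F i)) -> smooth U (fun u => \sum_(i <- r) F i u).
Proof. by move=> Fk k; apply: Ck_sum => // i; exact: Fk. Qed.

Lemma smooth_coord i : smooth U (fun u => u 0 i).
Proof. by move=> k; exact: Ck_coord. Qed.

Lemma smooth_derive f v : smooth U f -> smooth U ('D_v f).
Proof. by move=> fk k; have [_ /(_ v)[]] := fk k.+1. Qed.

Lemma smooth_differentiable f u : smooth U f -> U u -> differentiable f u.
Proof. by move=> fk; exact: Ck_differentiable. Qed.

Lemma smooth_derivable f u v : smooth U f -> U u -> derivable f u v.
Proof. by move=> fk Uu; apply: diff_derivable; exact: smooth_differentiable. Qed.

Lemma smooth_continuous f u : smooth U f -> U u -> {for u, continuous f}.
Proof. by move=> fk Uu; exact: (Ck_cont (fk 0%N)). Qed.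

Lemma sub_smooth U' f : U' `<=` U -> smooth U f -> smooth U' f.
Proof. by move=> UU fk k; exact: sub_Ck (fk k). Qed.

Lemma eq_derive f g u v : (forall w, U w -> f w = g w) -> U u -> 'D_v f u = 'D_v g u.
Proof.
move=> fg Uu; apply: near_eq_derive; near=> w; apply: fg.
by near: w; exact: open_nbhs_nbhs.
Unshelve. all: by end_near. Qed.

End SmoothClosure.

Lemma smooth_comp (R : realType) (p n : nat) (V : set 'rV[R]_p) (U : set 'rV[R]_n)
    (phi : 'rV[R]_p -> 'rV[R]_n) (f : 'rV[R]_n -> R) :
  open V -> open U -> (forall x, V x -> U (phi x)) ->
  (forall i, smooth V (fun x => phi x 0 i)) -> smooth U f -> smooth V (f \o phi).
Proof. by move=> oV oU VU phik fk k; apply: Ck_comp oV oU VU _ _ => // i; exact: phik. Qed.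

Section Vectors.
Variables (R : realType) (N : nat).
Implicit Types (v w x : 'rV[R]_N).

Definition dot v w : R := \sum_i v 0 i * w 0 i.

Lemma dotE v w : dot v w = (v *m w^T) 0 0.
Proof. by rewrite mxE; apply: eq_bigr => i _; rewrite mxE. Qed.

Lemma dotC v w : dot v w = dot w v.
Proof. by apply: eq_bigr => i _; rewrite mulrC. Qed.

Lemma dotDl v w x : dot (v + w) x = dot v x + dot w x.
Proof. by rewrite -big_split; apply: eq_bigr => i _; rewrite mxE mulrDl. Qed.

Lemma dotDr v w x : dot x (v + w) = dot x v + dot x w.
Proof. by rewrite dotC dotDl !(dotC x). Qed.

Lemma dotZl (c : R) v w : dot (c *: v) w = c * dot v w.
Proof. by rewrite mulr_sumr; apply: eq_bigr => i _; rewrite mxE mulrA. Qed.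

Lemma dotZr (c : R) v w : dot v (c *: w) = c * dot v w.
Proof. by rewrite dotC dotZl dotC. Qed.

Lemma dotNl v w : dot (- v) w = - dot v w.
Proof. by rewrite -scaleN1r dotZl mulN1r. Qed.

Lemma dotNr v w : dot v (- w) = - dot v w.
Proof. by rewrite dotC dotNl dotC. Qed.

Lemma dotBl v w x : dot (v - w) x = dot v x - dot w x.
Proof. by rewrite dotDl dotNl. Qed.

Lemma dotBr v w x : dot x (v - w) = dot x v - dot x w.
Proof. by rewrite dotDr dotNr. Qed.

Lemma dot0l v : dot 0 v = 0.
Proof. by apply: big1 => i _; rewrite mxE mul0r. Qed.

Lemma dot0r v : dot v 0 = 0.
Proof. by rewrite dotC dot0l. Qed.

Lemma dot_suml (I : Type) (r : seq I) (F : I -> 'rV[R]_N) w :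
  dot (\sum_(i <- r) F i) w = \sum_(i <- r) dot (F i) w.
Proof. by elim/big_rec2: _ => [|i x y _ <-]; rewrite ?dot0l ?dotDl. Qed.

Lemma dot_sumr (I : Type) (r : seq I) (F : I -> 'rV[R]_N) w :
  dot w (\sum_(i <- r) F i) = \sum_(i <- r) dot w (F i).
Proof. by rewrite dotC dot_suml; apply: eq_bigr => i _; rewrite dotC. Qed.

Lemma dot_mulmx v w (A : 'M[R]_N) : dot (v *m A) w = dot v (w *m A^T).
Proof. by rewrite !dotE trmx_mul trmxK mulmxA. Qed.

Lemma dot_delta v i : dot v (delta_mx 0 i) = v 0 i.
Proof.
rewrite /dot (bigD1 i) //= mxE !eqxx mulr1 big1 ?addr0 // => j ji.
by rewrite mxE (negbTE ji) andbF mulr0.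
Qed.

Lemma dot_ge0 v : 0 <= dot v v.
Proof. by apply: sumr_ge0 => i _; rewrite -expr2 sqr_ge0. Qed.

Lemma dot_eq0 v : (dot v v == 0) = (v == 0).
Proof.
apply/eqP/eqP => [v0|->]; last exact: dot0l.
apply/rowP => i; rewrite mxE; apply/eqP; rewrite -sqrf_eq0.
have /psumr_eq0P : \sum_i v 0 i ^+ 2 = 0.
  by rewrite -[RHS]v0; apply: eq_bigr => j _; rewrite expr2.
by move=> -> // j _; exact: sqr_ge0.
Qed.

Lemma dot_gt0 v : v != 0 -> 0 < dot v v.
Proof. by rewrite -dot_eq0 lt_def dot_ge0 andbT. Qed.

(** Functions on the sphere and on the projective space are represented by
    homogeneous functions, which are smooth only away from the origin. *)
Definition punctured : set 'rV[R]_N := [set v | v != 0].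

Lemma punctured_open : open punctured.
Proof.
have -> : punctured = ~` [set 0] by apply/seteqP; split=> v /=; move/eqP.
apply: closed_openC; apply: accessible_closed_set1; apply: hausdorff_accessible.
exact: norm_hausdorff.
Qed.

Definition grad (F : 'rV[R]_N -> R) v : 'rV[R]_N := \row_i 'D_(delta_mx 0 i) F v.

Definition divergence (X : 'rV[R]_N -> 'rV[R]_N) v : R :=
  \sum_i 'D_(delta_mx 0 i) (fun w => X w 0 i) v.

Lemma derive_grad F v w : smooth punctured F -> v != 0 -> 'D_w F v = dot w (grad F v).
Proof.
move=> sF v0; rewrite (derive_rV _ punctured_open (sF 1%N) v0).
by apply: eq_bigr => i _; rewrite mxE.
Qed.

Lemma derive_mulmx (V : normedModType R) (F : 'rV[R]_N -> V) (O : 'M[R]_N) v w :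
  'D_w (fun x => F (x *m O)) v = 'D_(w *m O) F (v *m O).
Proof.
rewrite /derive; under [X in lim (X @ _) = _]eq_fun do
  rewrite /= mulmxDl -scalemxAl.
by [].
Qed.

Definition orthogonal_mx (O : 'M[R]_N) := O *m O^T = 1%:M.

Lemma orthogonal_mxV O : orthogonal_mx O -> O^T *m O = 1%:M.
Proof. by move/mulmx1C. Qed.

Lemma orthogonal_tr O : orthogonal_mx O -> orthogonal_mx O^T.
Proof. by move=> /orthogonal_mxV; rewrite /orthogonal_mx trmxK. Qed.

Lemma orthogonal_neq0 O v : orthogonal_mx O -> v != 0 -> v *m O != 0.
Proof.
move=> oO; apply: contra_neq => vO.
by rewrite -[v]mulmx1 -oO mulmxA vO mul0mx.
Qed.

Lemma dot_orthogonal O v w : orthogonal_mx O -> dot (v *m O) (w *m O) = dot v w.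
Proof. by move=> oO; rewrite dot_mulmx -mulmxA oO mulmx1. Qed.

Lemma smooth_mulmx O F : orthogonal_mx O -> smooth punctured F ->
  smooth punctured (fun v => F (v *m O)).
Proof.
move=> oO; apply: (@smooth_comp _ _ _ _ _ (fun v => v *m O)).
- exact: punctured_open.
- exact: punctured_open.
- by move=> x; exact: orthogonal_neq0.
- move=> i; apply: (@eq_smooth _ _ _ punctured_open (fun v => \sum_j v 0 j * O j i)).
    by move=> v _; rewrite mxE.
  apply: (smooth_sum punctured_open) => j; apply: (smoothM punctured_open).
    exact: smooth_coord.
  exact: smooth_cst.
Qed.

Lemma grad_mulmx O F v : orthogonal_mx O -> smooth punctured F -> v != 0 ->
  grad (fun x => F (x *m O)) v = grad F (v *m O) *m O^T.
Proof.
move=> oO sF v0; apply/rowP => i; rewrite !mxE derive_mulmx.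
rewrite derive_grad //; last exact: orthogonal_neq0.
rewrite -rowE; apply: eq_bigr => j _; by rewrite !mxE mulrC.
Qed.

(** The divergence is the trace of the Jacobian matrix, and the Jacobian matrix
    of [Y] is conjugate under [O] to that of [X]. *)
Lemma divergence_mulmx O (X Y : 'rV[R]_N -> 'rV[R]_N) v : orthogonal_mx O ->
  (forall i, smooth punctured (fun w => X w 0 i)) -> v != 0 ->
  (forall w, w != 0 -> Y w = X (w *m O) *m O^T) ->
  divergence Y v = divergence X (v *m O).
Proof.
move=> oO sX v0 YX.
have v0' := orthogonal_neq0 oO v0.
rewrite /divergence.
transitivity (\sum_i \sum_l \sum_p (O i l * O i p) *
   'D_(delta_mx 0 p) (fun w => X w 0 l) (v *m O)).
  apply: eq_bigr => i _.
  rewrite (@eq_derive _ _ _ punctured_open _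
     (fun w => \sum_l O i l * X (w *m O) 0 l)) //; last first.
    by move=> w w0; rewrite YX // mxE; apply: eq_bigr => l _; rewrite mxE mulrC.
  have dX l : derivable (fun w => X (w *m O) 0 l) v (delta_mx 0 i).
    apply: (smooth_derivable punctured_open) => //.
    exact: (@smooth_mulmx O (fun w => X w 0 l)).
  have -> : (fun w => \sum_l O i l * X (w *m O) 0 l) =
     \sum_l (fun w => O i l * X (w *m O) 0 l) by apply/funext => w; rewrite fct_sumE.
  rewrite derive_sum => [|l]; last by apply: derivableM => //; exact: derivable_cst.
  apply: eq_bigr => l _.
  rewrite (@deriveM _ _ (cst (O i l)) (fun w => X (w *m O) 0 l)) //=.
  rewrite derive_cst scaler0 addr0.
  rewrite (@derive_mulmx _ (fun w => X w 0 l)) (derive_grad _ (sX l)) //.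
  rewrite -rowE /dot [in LHS]/GRing.scale /= mulr_sumr; apply: eq_bigr => p _.
  by rewrite !mxE mulrA.
rewrite exchange_big /=; apply: eq_bigr => l _; rewrite exchange_big /=.
rewrite (bigD1 l) //= -mulr_suml [X in _ + X]big1 ?addr0 => [|p pl].
  rewrite -[RHS]mul1r; congr (_ * _).
  have /matrixP/(_ l l) := orthogonal_mxV oO; rewrite !mxE eqxx mulr1n => <-.
  by apply: eq_bigr => i _; rewrite mxE.
rewrite -mulr_suml.
have /matrixP/(_ l p) := orthogonal_mxV oO; rewrite !mxE eq_sym (negbTE pl) => e.
by rewrite (eq_bigr (fun i => O^T l i * O i p)) ?e ?mul0r // => i _; rewrite mxE.
Qed.

End Vectors.

(** * Torus rotations and the twisted Laplacian in homogeneous form *)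

(** Complex structures on two orthogonal summands of R^N: [tP k] is the
    orthogonal projection onto the k-th summand and [tK k] multiplication by i
    there, both acting on row vectors from the right. *)
Record torus_frame (R : realType) (N : nat) := TorusFrame {
  tP : 'I_2 -> 'M[R]_N;
  tK : 'I_2 -> 'M[R]_N;
  tP_tr : forall k, (tP k)^T = tP k;
  tK_tr : forall k, (tK k)^T = - tK k;
  tPP : forall k l, tP k *m tP l = if k == l then tP k else 0;
  tKK : forall k, tK k *m tK k = - tP k;
  tKP : forall k, tK k *m tP k = tK k
}.

Section Rotations.
Variables (R : realType) (N : nat) (tf : torus_frame R N).
Local Notation P := (tP tf).
Local Notation K := (tK tf).

(** This is exp (a K_k), summed by means of K_k^2 = - P_k. *)
Definition rot k (a : R) : 'M[R]_N := 1%:M + (cos a - 1) *: P k + sin a *: K k.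

Lemma tPK k : P k *m K k = K k.
Proof.
apply: trmx_inj; rewrite trmx_mul tP_tr tK_tr mulNmx.
by rewrite tKP.
Qed.

Lemma rotD k a b : rot k (a + b) = rot k a *m rot k b.
Proof.
rewrite /rot !mulmxDl !mulmxDr !mul1mx !mulmx1 -!scalemxAl -!scalemxAr.
rewrite tPP eqxx tPK tKP tKK !scalerA cosD sinD.
apply/matrixP => i j; rewrite !mxE; ring.
Qed.

Lemma rot0 k : rot k 0 = 1%:M.
Proof. by rewrite /rot cos0 sin0 subrr !scale0r !addr0. Qed.

Lemma rot_tr k a : (rot k a)^T = rot k (- a).
Proof.
rewrite /rot cosN sinN !raddfD /= !linearZ /= tP_tr tK_tr trmx1.
by rewrite scalerN scaleNr.
Qed.

Lemma rot_orthogonal k a : orthogonal_mx (rot k a).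
Proof. by rewrite /orthogonal_mx rot_tr -rotD subrr rot0. Qed.

Lemma rot_periodic k a : rot k (a + pi *+ 2) = rot k a.
Proof. by rewrite /rot cosD2pi sinD2pi. Qed.

Lemma tK_mixed k l : k != l -> K k *m K l = 0.
Proof.
move=> kl; rewrite -[K k]tKP -[K l]tPK -mulmxA [P k *m _]mulmxA tPP (negbTE kl).
by rewrite mul0mx mulmx0.
Qed.

Lemma tKP_mixed k l : k != l -> K k *m P l = 0.
Proof.
by move=> kl; rewrite -[K k]tKP -mulmxA tPP (negbTE kl) mulmx0.
Qed.

Lemma tPK_mixed k l : k != l -> P k *m K l = 0.
Proof.
by move=> kl; rewrite -[K l]tPK mulmxA tPP (negbTE kl) mul0mx.
Qed.

Lemma rot_tK k l a : rot k a *m K l = K l *m rot k a.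
Proof.
rewrite /rot !mulmxDl !mulmxDr !mul1mx !mulmx1 -!scalemxAl -!scalemxAr.
have [->|kl] := eqVneq k l; first by rewrite tPK tKP.
by rewrite tPK_mixed // tK_mixed // tKP_mixed 1?eq_sym // tK_mixed // eq_sym.
Qed.

Lemma rotC k l a b : rot k a *m rot l b = rot l b *m rot k a.
Proof.
have [->|kl] := eqVneq k l; first by rewrite -!rotD addrC.
have lk : l != k by rewrite eq_sym.
rewrite /rot !mulmxDl !mulmxDr -!scalemxAl -!scalemxAr !mul1mx !mulmx1.
rewrite !tPP (negbTE kl) (negbTE lk) !tPK_mixed // !tKP_mixed // !tK_mixed //.
by rewrite !scaler0 !addr0; apply/matrixP => i j; rewrite !mxE; ring.
Qed.

Lemma rot_small k a (v : 'rV[R]_N) : v *m rot k a =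
  v - v *m P k + cos a *: (v *m P k) + sin a *: (v *m K k).
Proof.
rewrite /rot !mulmxDr mulmx1 -!scalemxAr scalerBl scale1r.
by rewrite [_ - v *m P k]addrC addrA.
Qed.

Lemma is_derive_scale (f : R -> R) (df b : R) (w : 'rV[R]_N) :
  is_derive b (1 : R) f df -> is_derive b (1 : R) (fun a => f a *: w) (df *: w).
Proof.
move=> [dfx <-].
have df' : differentiable f b by apply/derivable1_diffP.
split; first by apply: diff_derivable; exact: differentiableZl.
rewrite deriveE; last exact: differentiableZl.
by rewrite diffZl //= deriveE.
Qed.

Lemma is_derive_rot k (v : 'rV[R]_N) (b : R) :
  is_derive b (1 : R) (fun a => v *m rot k a) (v *m rot k b *m K k).
Proof.
have -> : (fun a => v *m rot k a) =
   cst (v - v *m P k) + (fun a => cos a *: (v *m P k)) + (fun a => sin a *: (v *m K k)).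
  by apply/funext => a; rewrite rot_small.
have dc := is_derive_scale (v *m P k) (is_derive_cos b).
have ds := is_derive_scale (v *m K k) (is_derive_sin b).
have d0 := is_derive_cst (v - v *m P k) b (1 : R).
have [dx ex] := is_deriveD (is_deriveD d0 dc) ds.
split; first exact: dx.
rewrite ex add0r /rot mulmxDr mulmxDr mulmx1 !mulmxDl -!scalemxAr -!scalemxAl.
rewrite -!mulmxA tPK tKK mulmxN !scalerN scalerBl scale1r scaleNr.
by rewrite addrC [v *m K k + _]addrC addrNK.
Qed.

End Rotations.

(** The fields ell_k that represent a torus-invariant z-valued 1-form through the
    Euclidean scalar product.  Orthogonality to the orbits makes the twist by
    the form unipotent, and orthogonality to the radius makes the fields tangent
    to the spheres around the origin.  Homogeneity allows every formula to
    be evaluated at any nonzero multiple of a point of the sphere; the degree 3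
    is that of the forms to be studied. *)
Record hfield (R : realType) (N : nat) (tf : torus_frame R N) := HField {
  hf :> 'I_2 -> 'rV[R]_N -> 'rV[R]_N;
  hf_smooth : forall k i, smooth (@punctured R N) (fun v => hf k v 0 i);
  hf_homog : forall k c v, hf k (c *: v) = c ^+ 3 *: hf k v;
  hf_radial : forall k v, dot (hf k v) v = 0;
  hf_horiz : forall k l v, dot (hf k v) (v *m tK tf l) = 0;
  hf_rot : forall k l a v, hf k (v *m rot tf l a) = hf k v *m rot tf l a
}.

Section Operator.
Variables (R : realType) (N : nat) (tf : torus_frame R N).
Local Notation K := (tK tf).
Local Notation U0 := (@punctured R N).
Local Notation oU0 := (@punctured_open R N).
Local Notation e_ i := (delta_mx 0 i : 'rV[R]_N).
Implicit Types (ell : hfield tf) (F G : 'rV[R]_N -> R) (v w g : 'rV[R]_N).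

(** The cometric of the twisted metric.  With Z_k = v K_k the twist is
    A = 1 + sum_k Z_k (x) ell_k, and A^-1 = 1 - sum_k Z_k (x) ell_k because
    <ell_k, Z_l> = 0; the three summands are those of A^-1 (A^-1)^T applied to
    [g].  The powers of [dot v v] make the result homogeneous of degree 2 in
    [v]. *)
Definition sharp ell v g : 'rV[R]_N :=
  dot v v *: g
  - (dot v v)^-1 *: \sum_k (dot (v *m K k) g *: ell k v + dot (ell k v) g *: (v *m K k))
  + (dot v v)^-1 ^+ 3 *: \sum_k (\sum_l dot (ell k v) (ell l v) * dot (v *m K l) g)
       *: (v *m K k).

Definition flux ell F v := sharp ell v (grad F v).

(** If [F] has degree 0, then [flux ell F] has degree 1 and is tangent to the
    spheres around the origin, and [Lop ell F] has degree 0; on the unit sphere it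
    is the Laplacian of the twisted metric, as [laplace_gproj] shows. *)
Definition Lop ell F v : R := - divergence (flux ell F) v.

Lemma sharp_linear ell v : linear (sharp ell v).
Proof.
move=> a x y; apply/rowP => i; rewrite !mxE !summxE.
rewrite (eq_bigr (fun k => a * (dot (v *m K k) x *: ell k v + dot (ell k v) x *: (v *m K k)) 0 i +
   (dot (v *m K k) y *: ell k v + dot (ell k v) y *: (v *m K k)) 0 i)); last first.
  by move=> k _; rewrite !mxE !dotDr !dotZr; ring.
rewrite [X in _ + _ * X](eq_bigr (fun k => a * ((\sum_l dot (ell k v) (ell l v) * dot (v *m K l) x)
       *: (v *m K k)) 0 i + ((\sum_l dot (ell k v) (ell l v) * dot (v *m K l) y)
       *: (v *m K k)) 0 i)); last first.
  move=> k _; rewrite !mxE.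
  rewrite (eq_bigr (fun l => a * (dot (ell k v) (ell l v) * dot (v *m K l) x) +
     dot (ell k v) (ell l v) * dot (v *m K l) y)); last first.
    by move=> l _; rewrite !dotDr !dotZr; ring.
  rewrite big_split -mulr_sumr /=; ring.
rewrite !big_split -!mulr_sumr /=; ring.
Qed.

Lemma smooth_vmul (A : 'M[R]_N) i : smooth U0 (fun v : 'rV[R]_N => (v *m A) 0 i).
Proof.
apply: (eq_smooth oU0 (f := fun v => \sum_j v 0 j * A j i)).
  by move=> v _; rewrite mxE.
apply: (smooth_sum oU0) => j; apply: (smoothM oU0); first exact: smooth_coord.
exact: smooth_cst.
Qed.

Lemma smooth_dot (X Y : 'rV[R]_N -> 'rV[R]_N) :
  (forall i, smooth U0 (fun v => X v 0 i)) -> (forall i, smooth U0 (fun v => Y v 0 i)) ->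
  smooth U0 (fun v => dot (X v) (Y v)).
Proof. by move=> sX sY; apply: (smooth_sum oU0) => i; exact: (smoothM oU0). Qed.

Lemma smooth_r2 : smooth U0 (fun v => dot v v).
Proof. by apply: smooth_dot => i; exact: smooth_coord. Qed.

Lemma smooth_r2V : smooth U0 (fun v => (dot v v)^-1).
Proof.
apply: (smoothV oU0); last exact: smooth_r2.
by move=> v v0; rewrite gt_eqF // dot_gt0.
Qed.

Lemma smooth_sharp ell (X : 'rV[R]_N -> 'rV[R]_N) :
  (forall i, smooth U0 (fun v => X v 0 i)) ->
  forall i, smooth U0 (fun v => sharp ell v (X v) 0 i).
Proof.
move=> sX i.
apply: (eq_smooth oU0 (f := fun v =>
  dot v v * X v 0 i
  - (dot v v)^-1 * \sum_k (dot (v *m K k) (X v) * ell k v 0 i +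
       dot (ell k v) (X v) * (v *m K k) 0 i)
  + (dot v v)^-1 ^+ 3 * \sum_k (\sum_l dot (ell k v) (ell l v) * dot (v *m K l) (X v))
       * (v *m K k) 0 i)).
  move=> v _; rewrite !mxE !summxE; congr (_ - _ * _ + _ * _).
    by apply: eq_bigr => k _; rewrite !mxE.
  by apply: eq_bigr => k _; rewrite !mxE.
have sK k := smooth_vmul (K k).
have sE k : forall i, smooth U0 (fun v => ell k v 0 i) := hf_smooth ell k.
apply: (smoothD oU0); first apply: (smoothB oU0).
- by apply: (smoothM oU0) => //; exact: smooth_r2.
- apply: (smoothM oU0); first exact: smooth_r2V.
  apply: (smooth_sum oU0) => k; apply: (smoothD oU0); apply: (smoothM oU0) => //; exact: smooth_dot.
- apply: (smoothM oU0); first by apply: (smoothX oU0); exact: smooth_r2V.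
  apply: (smooth_sum oU0) => k; apply: (smoothM oU0) => //.
  by apply: (smooth_sum oU0) => l; apply: (smoothM oU0); exact: smooth_dot.
Qed.

Lemma smooth_grad F : smooth U0 F -> forall i, smooth U0 (fun v => grad F v 0 i).
Proof.
move=> sF i; apply: (eq_smooth oU0 (f := 'D_(e_ i) F)) => [v _|]; first by rewrite mxE.
exact: smooth_derive.
Qed.

Lemma smooth_flux ell F : smooth U0 F -> forall i, smooth U0 (fun v => flux ell F v 0 i).
Proof. by move=> sF; apply: smooth_sharp; exact: smooth_grad. Qed.

Definition cometric ell i j v : R := sharp ell v (e_ j) 0 i.

Lemma smooth_cometric ell i j : smooth U0 (cometric ell i j).
Proof.
by apply: smooth_sharp => l; exact: smooth_cst.
Qed.

Lemma sharp_sum ell v g i : sharp ell v g 0 i = \sum_j cometric ell i j v * g 0 j.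
Proof.
pose L := HB.pack_for {linear 'rV[R]_N -> 'rV[R]_N} (sharp ell v)
  (GRing.isLinear.Build _ _ _ _ _ (@sharp_linear ell v)).
rewrite {1}[g]rV_sum -[sharp ell v]/(L : _ -> _) linear_sum summxE.
by apply: eq_bigr => j _; rewrite linearZ /= mxE mulrC.
Qed.

Lemma derive_sumM (I : Type) (r : seq I) (f g : I -> 'rV[R]_N -> R) v w :
  (forall i, smooth U0 (f i)) -> (forall i, smooth U0 (g i)) -> v != 0 ->
  'D_w (fun x => \sum_(i <- r) f i x * g i x) v =
  \sum_(i <- r) ('D_w (f i) v * g i v + f i v * 'D_w (g i) v).
Proof.
move=> sf sg v0.
have df h : smooth U0 h -> derivable h v w by move=> sh; exact: (smooth_derivable oU0).
elim: r => [|i r IH].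
  rewrite big_nil (_ : (fun _ => _) = cst 0) ?derive_cst //.
  by apply/funext => x; rewrite big_nil.
rewrite big_cons -IH (_ : (fun _ => _) = (f i * g i) + (fun x => \sum_(i <- r) f i x * g i x)).
  rewrite deriveD.
  - rewrite deriveM; [|exact: df..].
    by rewrite addrC [_ *: _ + _]addrC -!/(_ * _) [g i v *: _]mulrC addrC.
  - by apply: derivableM; exact: df.
  - by apply: df; apply: (smooth_sum oU0) => j; exact: (smoothM oU0).
by apply/funext => x; rewrite big_cons.
Qed.

Lemma LopE ell F v : smooth U0 F -> v != 0 ->
  Lop ell F v = - \sum_i \sum_j ('D_(e_ i) (cometric ell i j) v * 'D_(e_ j) F v +
     cometric ell i j v * 'D_(e_ i) ('D_(e_ j) F) v).
Proof.
move=> sF v0; congr (- _); apply: eq_bigr => i _.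
rewrite -(@derive_sumM _ (index_enum 'I_N) (cometric ell i) (fun j => 'D_(e_ j) F)) //; last first.
- by move=> j; exact: smooth_derive.
- exact: smooth_cometric.
apply: (congr1 (fun f => 'D_(e_ i) f v)); apply/funext => w; rewrite /flux sharp_sum.
by apply: eq_bigr => j _; rewrite mxE.
Qed.

Lemma Lop_lin ell (c : R) F G v : smooth U0 F -> smooth U0 G -> v != 0 ->
  Lop ell (fun w => c * F w + G w) v = c * Lop ell F v + Lop ell G v.
Proof.
move=> sF sG v0.
have sc : smooth U0 (fun w => c * F w + G w).
  by apply: (smoothD oU0) => //; apply: (smoothM oU0) => //; exact: smooth_cst.
rewrite !LopE // mulrN mulr_sumr -opprD -big_split /=; congr (- _).
have dl H1 H2 w x : smooth U0 H1 -> smooth U0 H2 -> x != 0 ->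
   'D_w (fun y => c * H1 y + H2 y) x = c * 'D_w H1 x + 'D_w H2 x.
  move=> s1 s2 x0.
  have -> : (fun y => c * H1 y + H2 y) = c *: H1 + H2 by apply/funext.
  rewrite deriveD; [|apply: derivableZ; exact: (smooth_derivable oU0)|exact: (smooth_derivable oU0)].
  by rewrite deriveZ //; exact: (smooth_derivable oU0).
apply: eq_bigr => i _; rewrite mulr_sumr -big_split /=; apply: eq_bigr => j _.
rewrite (dl F G (e_ j) v) // (@eq_derive _ _ _ oU0 ('D_(e_ j) (fun y => c * F y + G y)) (fun y => c * 'D_(e_ j) F y + 'D_(e_ j) G y)) //; last first.
  by move=> x x0; exact: dl.
rewrite (dl ('D_(e_ j) F) ('D_(e_ j) G)) //; [|exact: smooth_derive..].
by rewrite !mulrDr !(mulrCA _ c) addrACA.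
Qed.

(** Such an [O] is an isometry of the twisted metric. *)
Lemma Lop_mulmx ell O F v : orthogonal_mx O ->
  (forall k, O *m K k = K k *m O) -> (forall k w, ell k (w *m O) = ell k w *m O) ->
  smooth U0 F -> v != 0 ->
  Lop ell (fun w => F (w *m O)) v = Lop ell F (v *m O).
Proof.
move=> oO OK OE sF v0; rewrite /Lop; apply: (congr1 (fun x => - x)).
apply: divergence_mulmx => //; first exact: smooth_flux.
move=> w w0; rewrite /flux grad_mulmx //.
set g := grad F (w *m O).
have d x : dot x (g *m O^T) = dot (x *m O) g by rewrite [RHS]dot_mulmx.
have OO x : x *m O *m O^T = x by rewrite -mulmxA oO mulmx1.
have wK k : w *m O *m K k = w *m K k *m O by rewrite -!mulmxA OK.
rewrite /sharp dot_orthogonal // !mulmxDl mulNmx -!scalemxAl !mulmx_suml.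
congr (_ *: _ - _ *: _ + _ *: _); apply: eq_bigr => k _.
  by rewrite !d wK mulmxDl -!scalemxAl OE !OO.
rewrite wK -scalemxAl OO; congr (_ *: _).
by apply: eq_bigr => l _; rewrite !OE dot_orthogonal // d wK.
Qed.

Lemma Lop_rot ell k a F v : smooth U0 F -> v != 0 ->
  Lop ell (fun w => F (w *m rot tf k a)) v = Lop ell F (v *m rot tf k a).
Proof.
move=> sF v0; apply: Lop_mulmx => //; first exact: rot_orthogonal.
  by move=> l; exact: rot_tK.
by move=> l w; rewrite hf_rot.
Qed.

(** F - i G transforms under the torus by the character of weight [mu]. *)
Definition isotypic (mu : 'I_2 -> R) F G := forall k a v, v != 0 ->
  F (v *m rot tf k a) = cos (mu k * a) * F v + sin (mu k * a) * G v /\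
  G (v *m rot tf k a) = cos (mu k * a) * G v - sin (mu k * a) * F v.

Lemma derive_weight k (c : R) F G v : smooth U0 F -> v != 0 ->
  (forall a, F (v *m rot tf k a) = cos (c * a) * F v + sin (c * a) * G v) ->
  'D_(v *m K k) F v = c * G v.
Proof.
move=> sF v0 FG.
have [dr er] := is_derive_rot tf k v 0.
have dr' : differentiable (fun a => v *m rot tf k a) 0 by apply/derivable1_diffP.
have dF : differentiable F (v *m rot tf k 0).
  by rewrite rot0 mulmx1; exact: (smooth_differentiable oU0).
have := derive_comp (1 : R) dr' dF; rewrite er !rot0 !mulmx1 => <-.
have -> : F \o (fun a => v *m rot tf k a) =
    (fun a => F v * cos (c * a)) + (fun a => G v * sin (c * a)).
  by apply/funext => a /=; rewrite FG mulrC [X in _ + X]mulrC.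
have e0 : c * 0 = 0 by rewrite mulr0.
have dca : is_derive (0 : R) (1 : R) (fun a => c * a) c.
  have -> : (fun a => c * a) = c *: (id : R -> R) by apply/funext.
  by apply: is_derive_eq; rewrite [_ *: _]mulr1.
have d1 : is_derive (0 : R) (1 : R) (fun a => cos (c * a)) 0.
  have := @is_derive1_comp _ cos (fun a => c * a) 0 _ _ (is_derive_cos _) dca.
  by rewrite /= mulr0 sin0 oppr0 mul0r.
have d2 : is_derive (0 : R) (1 : R) (fun a => sin (c * a)) c.
  have := @is_derive1_comp _ sin (fun a => c * a) 0 _ _ (is_derive_sin _) dca.
  by rewrite /= mulr0 cos0 mul1r.
have -> : (fun a => F v * cos (c * a)) = F v *: (fun a => cos (c * a)) by apply/funext.
have -> : (fun a => G v * sin (c * a)) = G v *: (fun a => sin (c * a)) by apply/funext.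
rewrite deriveD; [|by apply: derivableZ; case: d1|by apply: derivableZ; case: d2].
rewrite !deriveZ; [|by case: d2|by case: d1].
by rewrite (@derive_val _ _ _ _ _ _ _ d1) (@derive_val _ _ _ _ _ _ _ d2) scaler0 add0r [LHS]mulrC.
Qed.

Definition weighted ell (mu : 'I_2 -> R) v : 'rV[R]_N := \sum_k mu k *: ell k v.

Lemma smooth_weighted ell mu i : smooth U0 (fun v => weighted ell mu v 0 i).
Proof.
apply: (eq_smooth oU0 (f := fun v => \sum_k mu k * ell k v 0 i)) => [v _|].
  by rewrite summxE; apply: eq_bigr => k _; rewrite mxE.
apply: (smooth_sum oU0) => k; apply: (smoothM oU0); first exact: smooth_cst.
exact: hf_smooth.
Qed.

(** The operator - [Lop] on functions of weight [mu] with the derivatives along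
    the orbits carried out.  The 1-form enters only through the field [X], which
    will be [weighted ell mu]. *)
Definition weight_op (X : 'rV[R]_N -> 'rV[R]_N) F G v : R :=
  divergence (fun w => dot w w *: grad F w - ((dot w w)^-1 * G w) *: X w) v
  - (dot v v)^-1 * dot (X v) (grad G v)
  - (dot v v)^-1 ^+ 3 * dot (X v) (X v) * F v.

End Operator.

(** * The Laplacian on functions of a given weight *)

Section Isotypic.
Variables (R : realType) (N : nat) (tf : torus_frame R N).
Local Notation K := (tK tf).
Local Notation U0 := (@punctured R N).
Local Notation oU0 := (@punctured_open R N).
Local Notation e_ i := (delta_mx 0 i : 'rV[R]_N).
Implicit Types (ell : hfield tf) (F G : 'rV[R]_N -> R) (v w g : 'rV[R]_N).

Lemma derive_coordE v w i : 'D_w (fun x : 'rV[R]_N => x 0 i) v = w 0 i.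
Proof.
have did : derivable (@id 'rV[R]_N) v w by exact: derivable_id.
have := derive_id v w; rewrite (derive_mx did) => /rowP/(_ i).
by rewrite mxE.
Qed.

Lemma divergenceD (X Y : 'rV[R]_N -> 'rV[R]_N) v :
  (forall i, smooth U0 (fun w => X w 0 i)) -> (forall i, smooth U0 (fun w => Y w 0 i)) ->
  v != 0 -> divergence (fun w => X w + Y w) v = divergence X v + divergence Y v.
Proof.
move=> sX sY v0; rewrite /divergence -big_split /=; apply: eq_bigr => i _.
rewrite (_ : (fun w => (X w + Y w) 0 i) = (fun w => X w 0 i) + (fun w => Y w 0 i)).
  by rewrite deriveD //; apply: (smooth_derivable oU0).
by apply/funext => w; rewrite mxE.
Qed.

Lemma eq_divergence (X Y : 'rV[R]_N -> 'rV[R]_N) v : v != 0 ->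
  (forall w, w != 0 -> X w = Y w) -> divergence X v = divergence Y v.
Proof.
move=> v0 XY; apply: eq_bigr => i _; apply: (@eq_derive _ _ _ oU0 _ _ v (e_ i)) => // w w0.
by rewrite XY.
Qed.

(** The field v |-> v K_k is divergence free, K_k being antisymmetric. *)
Lemma divergence_mulK (c : 'rV[R]_N -> R) k v : smooth U0 c -> v != 0 ->
  divergence (fun w => c w *: (w *m K k)) v = 'D_(v *m K k) c v.
Proof.
move=> sc v0; rewrite (derive_grad _ sc v0).
have t0 : \sum_i K k i i = 0.
  have : \tr (K k)^T = \tr (- K k) by rewrite tK_tr.
  rewrite mxtrace_tr raddfN /= /mxtrace => /eqP.
  by rewrite -addr_eq0 -mulr2n mulrn_eq0 /= => /eqP.
transitivity (\sum_i (c v * K k i i + (v *m K k) 0 i * grad c v 0 i)); last first.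
  by rewrite big_split /= -mulr_sumr t0 mulr0 add0r.
apply: eq_bigr => i _.
have sK := smooth_vmul (K k) i.
rewrite (_ : (fun w => (c w *: (w *m K k)) 0 i) = c * (fun w => (w *m K k) 0 i)); last first.
  by apply/funext => w; rewrite mxE.
rewrite deriveM; [|exact: (smooth_derivable oU0)..].
rewrite [grad c v 0 i]mxE; congr (_ + _); congr (_ * _).
rewrite (derive_mulmx (fun w : 'rV[R]_N => w 0 i)) derive_coordE.
by rewrite -rowE mxE.
Qed.

(** Along the orbits the derivative of [F] is mu_k G and that of [G] is - mu_k F.
    After substituting this into [flux], the components of the flux along the
    orbits have coefficients - [c k], and their divergence is - sum_k mu_k [c' k]
    because the orbit fields are divergence free.  Every sum over k now contains
    the factor mu_k and combines to [weighted ell mu]. *)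
Lemma Lop_isotypic ell mu F G v : smooth U0 F -> smooth U0 G ->
  isotypic tf mu F G -> v != 0 ->
  Lop ell F v = - weight_op (weighted ell mu) F G v.
Proof.
move=> sF sG FG v0.
have dK k w : w != 0 -> dot (w *m K k) (grad F w) = mu k * G w.
  move=> w0; rewrite -(derive_grad _ sF w0).
  by apply: (derive_weight sF w0) => a; case: (FG k a w w0).
pose c k w := (dot w w)^-1 * dot (ell k w) (grad F w)
  - (dot w w)^-1 ^+ 3 * dot (ell k w) (weighted ell mu w) * G w.
pose c' k w := (dot w w)^-1 * dot (ell k w) (grad G w)
  + (dot w w)^-1 ^+ 3 * dot (ell k w) (weighted ell mu w) * F w.
pose A w := dot w w *: grad F w - ((dot w w)^-1 * G w) *: weighted ell mu w.
have sW := smooth_weighted ell mu.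
have sr := @smooth_r2V R N.
have sE k i : smooth U0 (fun w => ell k w 0 i) := hf_smooth ell k i.
have sA i : smooth U0 (fun w => A w 0 i).
  apply: (eq_smooth oU0 (f := fun w => dot w w * grad F w 0 i -
     (dot w w)^-1 * G w * weighted ell mu w 0 i)) => [w _|]; first by rewrite !mxE.
  apply: (smoothB oU0); apply: (smoothM oU0) => //.
  - exact: smooth_r2.
  - exact: smooth_grad.
  - exact: (smoothM oU0).
have sc k : smooth U0 (c k).
  apply: (smoothB oU0); apply: (smoothM oU0) => //.
  - by apply: smooth_dot => //; exact: smooth_grad.
  - by apply: (smoothM oU0); [exact: (smoothX oU0)|exact: smooth_dot].
have scK k i : smooth U0 (fun w => (- c k w *: (w *m K k)) 0 i).
  apply: (eq_smooth oU0 (f := fun w => - c k w * (w *m K k) 0 i)) => [w _|].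
    by rewrite [RHS]mxE.
  apply: (smoothM oU0); last exact: smooth_vmul.
  exact: (smoothN oU0).
have fluxE w : w != 0 -> flux ell F w = A w + \sum_k (- c k w *: (w *m K k)).
  move=> w0; rewrite /flux /sharp /A -!addrA; congr (_ + _).
  apply/rowP => i; rewrite !mxE !summxE !mulr_sumr -!sumrN -!big_split /=.
  apply: eq_bigr => k _; rewrite !mxE dK // /c.
  have -> : \sum_l dot (ell k w) (ell l w) * dot (w *m K l) (grad F w) =
     dot (ell k w) (weighted ell mu w) * G w.
    rewrite /weighted dot_sumr mulr_suml; apply: eq_bigr => l _.
    by rewrite dK // dotZr; ring.
  ring.
have dc k : 'D_(v *m K k) (c k) v = mu k * c' k v.
  apply: derive_weight => // a; set O := rot tf k a.
  have oO : orthogonal_mx O by exact: rot_orthogonal.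
  have ellO l : ell l (v *m O) = ell l v *m O by rewrite hf_rot.
  have wO : weighted ell mu (v *m O) = weighted ell mu v *m O.
    by rewrite /weighted mulmx_suml; apply: eq_bigr => l _; rewrite ellO scalemxAl.
  have dO F1 F2 F3 b1 b2 : smooth U0 F1 -> smooth U0 F2 -> smooth U0 F3 ->
     (forall w, w != 0 -> F1 (w *m O) = b1 * F2 w + b2 * F3 w) ->
     dot (ell k v *m O) (grad F1 (v *m O)) =
       b1 * dot (ell k v) (grad F2 v) + b2 * dot (ell k v) (grad F3 v).
    move=> s1 s2 s3 e.
    have v0' := orthogonal_neq0 oO v0.
    rewrite -(derive_grad _ s1 v0') -derive_mulmx.
    rewrite (@eq_derive _ _ _ oU0 _ (fun w => b1 * F2 w + b2 * F3 w)) //.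
    have -> : (fun w => b1 * F2 w + b2 * F3 w) = b1 *: F2 + b2 *: F3 by apply/funext.
    rewrite deriveD; [|by apply: derivableZ; exact: (smooth_derivable oU0)..].
    rewrite !deriveZ; [|exact: (smooth_derivable oU0)..].
    by rewrite !derive_grad.
  rewrite /c /c' !dot_orthogonal // ellO wO !dot_orthogonal //.
  have FE w : w != 0 -> F (w *m O) = cos (mu k * a) * F w + sin (mu k * a) * G w.
    by move=> w0; case: (FG k a w w0).
  rewrite (dO _ _ _ _ _ sF sF sG FE).
  rewrite (FG k a v v0).2; ring.
have -> : Lop ell F v = - divergence (fun w => A w + \sum_k (- c k w *: (w *m K k))) v.
  by congr (- _); exact: eq_divergence.
have sS (r : seq 'I_2) i : smooth U0 (fun w => (\sum_(k <- r) (- c k w *: (w *m K k))) 0 i).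
  apply: (eq_smooth oU0 (f := fun w => \sum_(k <- r) (- c k w *: (w *m K k)) 0 i)) => [w _|].
    by rewrite summxE.
  exact: (smooth_sum oU0).
have divS (r : seq 'I_2) :
   divergence (fun w => \sum_(k <- r) (- c k w *: (w *m K k))) v = - \sum_(k <- r) mu k * c' k v.
  elim: r => [|k r IH].
    rewrite big_nil oppr0; apply: big1 => i _.
    rewrite (_ : (fun _ => _) = cst 0) ?derive_cst //.
    by apply/funext => w; rewrite big_nil mxE.
  rewrite (@eq_divergence _ (fun w => - c k w *: (w *m K k) + \sum_(k <- r) (- c k w *: (w *m K k)))) //; last first.
    by move=> w _; rewrite big_cons.
  rewrite divergenceD // IH big_cons opprD; congr (_ + _).
  rewrite divergence_mulK //; last exact: (smoothN oU0).
  rewrite (_ : (fun _ => _) = - c k); last by apply/funext.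
  by rewrite deriveN ?dc //; exact: (smooth_derivable oU0).
rewrite divergenceD // divS /weight_op.
have -> : \sum_k mu k * c' k v = (dot v v)^-1 * dot (weighted ell mu v) (grad G v)
   + (dot v v)^-1 ^+ 3 * dot (weighted ell mu v) (weighted ell mu v) * F v.
  rewrite {1 3}/weighted !dot_suml !mulr_sumr mulr_suml -big_split /=.
  by apply: eq_bigr => k _; rewrite /c' !dotZl; ring.
rewrite -/A; ring.
Qed.

Lemma weight_op_mulmx (O : 'M[R]_N) (X Y : 'rV[R]_N -> 'rV[R]_N) F G v :
  orthogonal_mx O -> (forall i, smooth U0 (fun w => X w 0 i)) ->
  (forall w, Y w = X (w *m O) *m O^T) -> smooth U0 F -> smooth U0 G -> v != 0 ->
  weight_op Y (fun w => F (w *m O)) (fun w => G (w *m O)) v = weight_op X F G (v *m O).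
Proof.
move=> oO sX YX sF sG v0; have oT := orthogonal_tr oO.
pose Z w := dot w w *: grad F w - ((dot w w)^-1 * G w) *: X w.
have e1 := grad_mulmx oO sG v0.
have e2 : dot (v *m O) (v *m O) = dot v v by exact: dot_orthogonal.
rewrite /weight_op e1 e2 (YX v) !(dot_orthogonal _ _ oT).
suff -> : divergence (fun w => dot w w *: grad (fun x => F (x *m O)) w -
    ((dot w w)^-1 * G (w *m O)) *: Y w) v = divergence Z (v *m O) by [].
apply: divergence_mulmx => // [i|w w0].
  apply: (eq_smooth oU0 (f := fun w => dot w w * grad F w 0 i -
     (dot w w)^-1 * G w * X w 0 i)) => [w _|]; first by rewrite !mxE.
  apply: (smoothB oU0); apply: (smoothM oU0) => //.
  - exact: smooth_r2.
  - exact: smooth_grad.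
  - by apply: (smoothM oU0) => //; exact: smooth_r2V.
by rewrite grad_mulmx // YX /Z dot_orthogonal // mulmxBl -!scalemxAl.
Qed.

End Isotypic.

(** * Means over a period *)

Lemma continuous_add (R : realType) (T : topologicalType) (f g : T -> R) :
  continuous f -> continuous g -> continuous (fun x => f x + g x).
Proof. by move=> cf cg x; apply: (@continuousD _ _ _ f g); [exact: cf|exact: cg]. Qed.

Lemma continuous_mul (R : realType) (T : topologicalType) (f g : T -> R) :
  continuous f -> continuous g -> continuous (fun x => f x * g x).
Proof. by move=> cf cg x; apply: (@continuousM _ _ f g); [exact: cf|exact: cg]. Qed.

Section Mean.
Variable R : realType.
Local Notation mu := (@lebesgue_measure R).
Implicit Types (h g : R -> R).

Definition period : set R := `[- pi, pi].

Definition mean h : R := \int[mu]_(a in period) h a.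

Lemma mperiod : measurable period. Proof. exact: measurable_itv. Qed.

Lemma compact_period : compact period.
Proof. exact: segment_compact. Qed.

Lemma mean_integrable h : continuous h -> mu.-integrable period (EFin \o h).
Proof.
move=> ch; apply: continuous_compact_integrable; first exact: compact_period.
exact: continuous_subspaceT.
Qed.

Lemma meanD h g : continuous h -> continuous g ->
  mean (fun a => h a + g a) = mean h + mean g.
Proof. by move=> ch cg; apply: RintegralD; [exact: mperiod|exact: mean_integrable..]. Qed.

Lemma meanZ c h : continuous h -> mean (fun a => c * h a) = c * mean h.
Proof. by move=> ch; apply: RintegralZl; [exact: mperiod|exact: mean_integrable]. Qed.

Lemma mean_cst c : mean (fun=> c) = c * (pi *+ 2).
Proof.
rewrite /mean Rintegral_cst //; last exact: mperiod.
congr (_ * _).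
transitivity (fine (if ((- pi)%R%:E < (pi : R)%:E)%E then ((pi : R)%:E - (- pi)%R%:E)%E else 0%E)).
  congr fine; exact: lebesgue_measure_itv.
rewrite lte_fin.
case: ifPn => [_|]; first by rewrite /= opprK mulr2n.
rewrite -leNgt => h; have : pi = 0 :> R.
  by apply/eqP; rewrite eq_le pi_ge0 andbT; have := pi_ge0 R; move: h; set p := pi; lra.
by move=> ->; rewrite mul0rn.
Qed.

Lemma ler_mean h g : continuous h -> continuous g ->
  (forall a, period a -> h a <= g a) -> mean h <= mean g.
Proof.
move=> ch cg hg.
have := @le_Rintegral _ _ R mu period h g mperiod (mean_integrable ch) (mean_integrable cg).
by apply; exact: hg.
Qed.

Lemma ler_norm_mean h (M : R) : continuous h -> (forall a, period a -> `|h a| <= M) ->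
  `|mean h| <= M * (pi *+ 2).
Proof.
move=> ch hM; have h1 : `|mean h| <= mean (fun a => `|h a|).
  have := @le_normr_Rintegral _ _ R mu period h mperiod (mean_integrable ch).
  by apply.
apply: (le_trans h1).
rewrite -mean_cst; apply: ler_mean => //; last exact: cst_continuous.
by move=> a; apply: continuous_comp; [exact: ch|exact: norm_continuous].
Qed.

Lemma mean_sum (I : Type) (r : seq I) (F : I -> R -> R) :
  (forall i, continuous (F i)) ->
  mean (fun a => \sum_(i <- r) F i a) = \sum_(i <- r) mean (F i).
Proof.
move=> cF; elim: r => [|i r IH].
  rewrite big_nil -[RHS](mul0r (pi *+ 2)) -mean_cst.
  by congr mean; apply/funext => a; rewrite big_nil.
rewrite big_cons -IH -meanD //.
  by congr mean; apply/funext => a; rewrite big_cons.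
by move=> a; apply: continuous_sum => j _; exact: cF.
Qed.

(** Compactness of the period turns joint continuity at the points (x, a) into a
    bound that is uniform in a. *)
Lemma tube (T : topologicalType) (Phi : T -> R -> R) (x : T) (e : R) : 0 < e ->
  (forall a, {for (x, a), continuous (fun p : T * R => Phi p.1 p.2)}) ->
  \forall y \near x, forall a, period a -> `|Phi y a - Phi x a| < e.
Proof.
move=> e0 cPhi.
have /compact_near_coveringP nc := compact_period.
have := nc T (nbhs x) (fun y a => `|Phi y a - Phi x a| < e) (nbhs_filter x).
apply=> a _.
have e20 : 0 < e / 2 by rewrite divr_gt0.
have /cvgrPdist_lt /(_ _ e20) := cPhi a.
move=> [[A B] /= [xA aB] AB].
exists (B, A) => //= -[b y] /= [Bb Ay].
have := AB (y, b) (conj Ay Bb); have := AB (x, b) (conj (nbhs_singleton xA) Bb).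
rewrite /= => h1 h2.
rewrite (splitr e) -(subrKA (Phi x a)) (le_lt_trans (ler_normD _ _)) // ltrD //.
by rewrite distrC.
Qed.

Lemma mean_continuous (T : topologicalType) (Phi : T -> R -> R) (x : T) :
  (forall a, {for (x, a), continuous (fun p : T * R => Phi p.1 p.2)}) ->
  (\forall y \near x, continuous (Phi y)) ->
  {for x, continuous (fun y => mean (Phi y))}.
Proof.
move=> cPhi cy; apply/cvgrPdist_le => e e0.
have p1 : 0 < pi *+ 2 + 1 :> R.
  by rewrite ltr_wpDl // mulrn_wge0 // pi_ge0.
have e10 : 0 < e / (pi *+ 2 + 1) by rewrite divr_gt0.
have cx := nbhs_singleton cy.
near=> y.
have cy' : continuous (Phi y) by near: y.
have -> : mean (Phi x) - mean (Phi y) = mean (fun a => Phi x a + -1 * Phi y a).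
  have cN : continuous (fun a => -1 * Phi y a).
    by apply: continuous_mul => //; exact: cst_continuous.
  by rewrite meanD // meanZ // mulN1r.
apply: le_trans (ler_norm_mean (M := e / (pi *+ 2 + 1)) _ _) _.
- apply: continuous_add => //; apply: continuous_mul => //; exact: cst_continuous.
- have : forall a, period a -> `|Phi y a - Phi x a| < e / (pi *+ 2 + 1).
    by near: y; exact: tube.
  by move=> + a pa => /(_ a pa)/ltW; rewrite mulN1r distrC.
- rewrite mulrAC ler_pdivrMr // ler_pM2l //.
  by rewrite lerDl ler01.
Unshelve. all: by end_near. Qed.

(** Differentiation under the integral sign; near t = 0 the derivatives are
    dominated by a constant, by [tube]. *)
Lemma derive_mean (V : normedModType R) (Phi : V -> R -> R) (dPhi : R -> R -> R)
    (v w : V) (r : R) : 0 < r ->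
  (forall t, `|t| < r -> continuous (Phi (v + t *: w))) ->
  (forall t a, `|t| < r -> is_derive t (1 : R) (fun t => Phi (v + t *: w) a) (dPhi t a)) ->
  (forall a, {for (0, a), continuous (fun p : R * R => dPhi p.1 p.2)}) ->
  derivable (fun x => mean (Phi x)) v w /\
  'D_w (fun x => mean (Phi x)) v = mean (dPhi 0).
Proof.
move=> r0 cPhi dP cd.
have cd0 : continuous (dPhi 0).
  move=> a; have /cvgrPdist_lt H := cd a; apply/cvgrPdist_lt => e e0.
  have [[A B] /= [A0 Ba] AB] := H e e0.
  by apply: filterS Ba => b Bb; apply: (AB (0, b)); split => //; exact: nbhs_singleton.
have [M HM] : exists M, forall a, period a -> `|dPhi 0 a| <= M.
  have p0 : period !=set0 by exists 0; rewrite /period /= in_itv /= oppr_le0 pi_ge0.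
  have cn : {within period, continuous (fun a => `|dPhi 0 a|)}.
    by apply: continuous_subspaceT => a; apply: continuous_comp; [exact: cd0|exact: norm_continuous].
  have [M _ HM] := @compact_EVT_max _ R (fun a => `|dPhi 0 a|) period p0 compact_period cn.
  by exists `|dPhi 0 M| => a pa; apply: HM; rewrite inE.
have : \forall t \near 0, forall a, period a -> `|dPhi t a - dPhi 0 a| < 1.
  by apply: tube.
move=> /nbhs_ballP[d /= d0 Hd].
pose s := Num.min r d.
have s0 : 0 < s by rewrite lt_min r0.
have Is t : `]- s, s[%classic t -> `|t| < r /\ `|t| < d.
  by rewrite /= in_itv /= -ltr_norml lt_min => /andP[].
pose f t a := Phi (v + t *: w) a.
have d1 t a : `]- s, s[%classic t -> partial1of2 f t a = dPhi t a.
  move=> /Is[tr _]; rewrite partial1of2E; have := dP t a tr.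
  by move=> H; rewrite (@derive_val _ _ _ _ _ _ _ H).
have i0 : `]- s, s[%classic (0 : R) by rewrite /= in_itv /= oppr_lt0 s0.
have G0 (a : R) : 0 <= (fun=> `|M| + 1) a by rewrite addr_ge0.
have hint t : `]- s, s[%classic t -> mu.-integrable period (EFin \o f t).
  by move=> /Is[tr _]; apply: mean_integrable; exact: cPhi.
have hder t a : `]- s, s[%classic t -> period a -> derivable (f ^~ a) t 1.
  by move=> /Is[tr _] _; case: (dP t a tr).
have hG : mu.-integrable period (EFin \o (fun=> `|M| + 1)).
  by apply: mean_integrable; exact: cst_continuous.
have hub t a : `]- s, s[%classic t -> period a -> `|partial1of2 f t a| <= (fun=> `|M| + 1) a.
  move=> ts pa; rewrite d1 //; have [_ td] := Is t ts.
  have /Hd/(_ a pa)/ltW h1 : ball 0 d t by rewrite -ball_normE /= sub0r normrN.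
  rewrite -(subrK (dPhi 0 a) (dPhi t a)) addrC (le_trans (ler_normD _ _)) // lerD //.
  exact: le_trans (HM a pa) (ler_norm _).
have e0 : v = v + 0 *: w by rewrite scale0r addr0.
split.
  rewrite e0; apply/derive_alongE.
  exact: (@derivable_under_integral R _ _ mu f period mperiod 0 _ _ i0 hint hder _ G0 hG hub).
rewrite {1}e0 derive_along -derive1E.
rewrite (@differentiation_under_integral R _ _ mu f period mperiod 0 _ _ i0 hint hder _ G0 hG hub).
by apply: eq_Rintegral => a _; exact: d1.
Qed.

End Mean.

(** * Averages along the circles of the torus *)

Section Average.
Variables (R : realType) (N : nat) (tf : torus_frame R N).
Local Notation K := (tK tf).
Local Notation U0 := (@punctured R N).
Local Notation oU0 := (@punctured_open R N).
Local Notation e_ i := (delta_mx 0 i : 'rV[R]_N).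
Implicit Types (ell : hfield tf) (F G : 'rV[R]_N -> R) (v w : 'rV[R]_N) (c : R -> R).

Definition avg k c G v : R := mean (fun a => c a * G (v *m rot tf k a)).

Lemma rot_neq0 k a v : v != 0 -> v *m rot tf k a != 0.
Proof. by move=> v0; apply: orthogonal_neq0 => //; exact: rot_orthogonal. Qed.

Lemma rot_coord k a v i : (v *m rot tf k a) 0 i =
  v 0 i + (cos a - 1) * (v *m tP tf k) 0 i + sin a * (v *m K k) 0 i.
Proof. by rewrite /rot !mulmxDr mulmx1 -!scalemxAr !mxE. Qed.

Lemma mulmx_coord_continuous (A : 'M[R]_N) i :
  continuous (fun v : 'rV[R]_N => (v *m A) 0 i).
Proof.
have -> : (fun v : 'rV[R]_N => (v *m A) 0 i) = (fun v => \sum_j v 0 j * A j i).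
  by apply/funext => v; rewrite mxE.
move=> v; apply: continuous_sum => j _.
by apply: continuous_mul; [exact: coord_continuous|exact: cst_continuous].
Qed.

Lemma rot_continuous k : continuous (fun p : 'rV[R]_N * R => p.1 *m rot tf k p.2).
Proof.
move=> p; apply: (@cvg_rV _ _ (nbhs p)) => i.
have -> : (fun q : 'rV[R]_N * R => (q.1 *m rot tf k q.2) 0 i) = (fun q =>
    q.1 0 i + (cos q.2 + -1) * (q.1 *m tP tf k) 0 i + sin q.2 * (q.1 *m K k) 0 i).
  by apply/funext => q; rewrite rot_coord.
have c1 (f : 'rV[R]_N -> R) : continuous f -> continuous (fun q : 'rV[R]_N * R => f q.1).
  by move=> cf q; apply: continuous_comp; [exact: cvg_fst|exact: cf].
have c2 (f : R -> R) : continuous f -> continuous (fun q : 'rV[R]_N * R => f q.2).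
  by move=> cf q; apply: continuous_comp; [exact: cvg_snd|exact: cf].
have cF : continuous (fun q : 'rV[R]_N * R =>
    q.1 0 i + (cos q.2 + -1) * (q.1 *m tP tf k) 0 i + sin q.2 * (q.1 *m K k) 0 i).
  apply: continuous_add; first apply: continuous_add.
  - by apply: (c1 (fun v => v 0 i)); exact: coord_continuous.
  - apply: continuous_mul; last by apply: (c1 (fun v => (v *m tP tf k) 0 i)); exact: mulmx_coord_continuous.
    apply: continuous_add; last exact: cst_continuous.
    by apply: c2; exact: continuous_cos.
  - apply: continuous_mul; last by apply: (c1 (fun v => (v *m K k) 0 i)); exact: mulmx_coord_continuous.
    by apply: c2; exact: continuous_sin.
by rewrite rot_coord; exact: cF.
Qed.

Lemma rot_continuous2 k v : continuous (fun a : R => v *m rot tf k a).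
Proof.
move=> a; apply: differentiable_continuous; apply/derivable1_diffP.
by case: (is_derive_rot tf k v a).
Qed.

Lemma kernel_continuous k c G v a : continuous c -> smooth U0 G -> v != 0 ->
  {for (v, a), continuous (fun p : 'rV[R]_N * R => c p.2 * G (p.1 *m rot tf k p.2))}.
Proof.
move=> cc sG v0; apply: (@continuousM _ _ (fun p : 'rV[R]_N * R => c p.2)
  (fun p : 'rV[R]_N * R => G (p.1 *m rot tf k p.2))).
  by apply: continuous_comp; [exact: cvg_snd|exact: cc].
apply: (@continuous_comp _ _ _ (fun p : 'rV[R]_N * R => p.1 *m rot tf k p.2) G).
  exact: rot_continuous.
by apply: (smooth_continuous sG); exact: rot_neq0.
Qed.

Lemma kernel_continuous2 k c G v : continuous c -> smooth U0 G -> v != 0 ->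
  continuous (fun a => c a * G (v *m rot tf k a)).
Proof.
move=> cc sG v0; apply: continuous_mul => // a.
apply: (@continuous_comp _ _ _ (fun a => v *m rot tf k a) G).
  exact: rot_continuous2.
by apply: (smooth_continuous sG); exact: rot_neq0.
Qed.

Lemma rot_coord_continuous k w i : continuous (fun a => (w *m rot tf k a) 0 i).
Proof.
move=> a; apply: (@continuous_comp _ _ _ (fun a => w *m rot tf k a) (fun v => v 0 i)).
  exact: rot_continuous2.
exact: coord_continuous.
Qed.

(** A derivative of an average is a sum of averages of the partial derivatives
    with new kernels, so the statement can be iterated. *)
Lemma avg_derive k c G v w : continuous c -> smooth U0 G -> v != 0 ->
  derivable (avg k c G) v w /\
  'D_w (avg k c G) v =
     \sum_i avg k (fun a => c a * (w *m rot tf k a) 0 i) ('D_(e_ i) G) v.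
Proof.
move=> cc sG v0.
have : \forall t \near (0 : R), v + t *: w != 0.
  have cont : {for (0 : R), continuous (fun t : R => v + t *: w)}.
    apply: cvgD; first exact: cvg_cst.
    by apply: cvgZr_tmp; exact: cvg_id.
  apply: (cont U0); rewrite scale0r addr0.
  exact: (open_nbhs_nbhs (conj oU0 v0)).
move=> /nbhs_ballP[r /= r0 Hr].
have vt (t : R) : `|t| < r -> v + t *: w != 0.
  by move=> tr; apply: Hr; rewrite -ball_normE /= sub0r normrN.
pose dPhi t a := \sum_i c a * (w *m rot tf k a) 0 i * 'D_(e_ i) G ((v + t *: w) *m rot tf k a).
have sD i : smooth U0 ('D_(e_ i) G) by exact: smooth_derive.
have cci i : continuous (fun a => c a * (w *m rot tf k a) 0 i).
  by apply: continuous_mul => //; exact: rot_coord_continuous.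
have [| | |d1 d2] := @derive_mean R _ (fun v a => c a * G (v *m rot tf k a)) dPhi v w r r0.
- by move=> t tr; apply: kernel_continuous2 => //; exact: vt.
- move=> t a tr.
  have sGr : smooth U0 (fun x => G (x *m rot tf k a)).
    by apply: smooth_mulmx => //; exact: rot_orthogonal.
  have dG : derivable (fun x => G (x *m rot tf k a)) (v + t *: w) w.
    by apply: (smooth_derivable oU0) => //; exact: vt.
  have -> : (fun t => c a * G ((v + t *: w) *m rot tf k a)) =
     c a *: (fun t => G ((v + t *: w) *m rot tf k a)) by apply/funext.
  have dG' := (derive_alongE _ _ _ _).1 dG.
  split; first exact: derivableZ.
  rewrite deriveZ // -(derive_along (fun x => G (x *m rot tf k a))).
  rewrite derive_mulmx (derive_grad _ sG); last by apply: rot_neq0; exact: vt.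
  rewrite /dPhi [LHS]mulr_sumr; apply: eq_bigr => i _.
  by rewrite mulrA; congr (_ * _); rewrite [LHS]mxE.
- move=> a; apply: continuous_sum => i _.
  apply: (@continuous_comp _ _ _ (fun p : R * R => (v + p.1 *: w, p.2))
    (fun p : 'rV[R]_N * R => c p.2 * (w *m rot tf k p.2) 0 i * 'D_(e_ i) G (p.1 *m rot tf k p.2))).
    apply: (@cvg_pair _ _ _ (nbhs ((0 : R), a)) (nbhs (v + (0 : R) *: w)) (nbhs a) _ _ _
      (fun p : R * R => v + p.1 *: w) snd); last exact: cvg_snd.
    apply: cvgD; first exact: cvg_cst.
    by apply: cvgZr_tmp; exact: cvg_fst.
  have v0' : v + (0 : R) *: w != 0 by rewrite scale0r addr0.
  exact: (kernel_continuous (k := k) (a := a) (cci i) (sD i) v0').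
split=> //; rewrite /avg d2 /dPhi -mean_sum; last first.
  by move=> i; exact: (kernel_continuous2 (k := k) (cci i) (sD i) v0).
by congr mean; apply/funext => a; apply: eq_bigr => i _; rewrite scale0r addr0.
Qed.

Lemma avg_smooth k c G : continuous c -> smooth U0 G -> smooth U0 (avg k c G).
Proof.
move=> cc sG n; elim: n c G cc sG => [|n IH] c G cc sG.
all: have cont v : U0 v -> {for v, continuous (avg k c G)}
  by move=> v0; apply: mean_continuous => [a|]; [exact: kernel_continuous|
   apply: filterS (open_nbhs_nbhs (conj oU0 v0)) => y y0; exact: kernel_continuous2].
  by split.
apply: CkSE => // w; split=> [v v0|]; first by case: (avg_derive k w cc sG v0).
apply: (@eq_Ck _ _ _ _ (fun v => \sum_i avg k (fun a => c a * (w *m rot tf k a) 0 i) ('D_(e_ i) G) v)).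
- exact: oU0.
- by move=> v v0; rewrite (avg_derive k w cc sG v0).2.
apply: Ck_sum => [|i]; first exact: oU0.
apply: IH; last exact: smooth_derive.
by apply: continuous_mul => //; exact: rot_coord_continuous.
Qed.

Lemma derive_rot_grad k a G v w : smooth U0 G -> v != 0 ->
  'D_w (fun x => G (x *m rot tf k a)) v =
  \sum_i (w *m rot tf k a) 0 i * 'D_(e_ i) G (v *m rot tf k a).
Proof.
move=> sG v0; rewrite derive_mulmx (derive_grad _ sG); last exact: rot_neq0.
by apply: eq_bigr => i _; rewrite [X in _ * X]mxE.
Qed.

Lemma derive_avg k c G v w : continuous c -> smooth U0 G -> v != 0 ->
  'D_w (avg k c G) v = mean (fun a => c a * 'D_w (fun x => G (x *m rot tf k a)) v).
Proof.
move=> cc sG v0; rewrite (avg_derive k w cc sG v0).2 -mean_sum; last first.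
  move=> i; have sD : smooth U0 ('D_(e_ i) G) by exact: smooth_derive.
  apply: (kernel_continuous2 (k := k) (c := fun a => c a * (w *m rot tf k a) 0 i) _ sD v0).
  by apply: continuous_mul => //; exact: rot_coord_continuous.
congr mean; apply/funext => a; rewrite derive_rot_grad // mulr_sumr.
by apply: eq_bigr => i _; rewrite mulrA.
Qed.

Lemma derive_rot_continuous k c G v w : continuous c -> smooth U0 G -> v != 0 ->
  continuous (fun a => c a * 'D_w (fun x => G (x *m rot tf k a)) v).
Proof.
move=> cc sG v0.
rewrite (_ : (fun a => _) = (fun a => \sum_i (c a * (w *m rot tf k a) 0 i) *
   'D_(e_ i) G (v *m rot tf k a))); last first.
  apply/funext => a; rewrite derive_rot_grad // mulr_sumr.
  by apply: eq_bigr => i _; rewrite mulrA.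
move=> a; apply: continuous_sum => i _.
have sD : smooth U0 ('D_(e_ i) G) by exact: smooth_derive.
apply: (kernel_continuous2 (k := k) (c := fun a => c a * (w *m rot tf k a) 0 i) _ sD v0).
by apply: continuous_mul => //; exact: rot_coord_continuous.
Qed.

Lemma derive2_rot k a G v w x : smooth U0 G -> v != 0 ->
  'D_x ('D_w (fun y => G (y *m rot tf k a))) v =
  \sum_i (w *m rot tf k a) 0 i * 'D_x (fun y => 'D_(e_ i) G (y *m rot tf k a)) v.
Proof.
move=> sG v0.
have sD i : smooth U0 (fun y => 'D_(e_ i) G (y *m rot tf k a)).
  by apply: (@smooth_mulmx _ _ _ ('D_(e_ i) G)); [exact: rot_orthogonal|exact: smooth_derive].
rewrite (@eq_derive _ _ _ oU0 _ (fun y => \sum_i (w *m rot tf k a) 0 i * 'D_(e_ i) G (y *m rot tf k a))) //;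
  last by move=> y y0; rewrite derive_rot_grad.
rewrite (@derive_sumM _ _ _ _ (fun i => fun=> (w *m rot tf k a) 0 i)
   (fun i y => 'D_(e_ i) G (y *m rot tf k a))) //; last by move=> i; exact: smooth_cst.
by apply: eq_bigr => i _; rewrite derive_cst mul0r add0r.
Qed.

Lemma derive2_avg k c G v w x : continuous c -> smooth U0 G -> v != 0 ->
  'D_x ('D_w (avg k c G)) v = mean (fun a => c a * 'D_x ('D_w (fun y => G (y *m rot tf k a))) v) /\
  continuous (fun a => c a * 'D_x ('D_w (fun y => G (y *m rot tf k a))) v).
Proof.
move=> cc sG v0.
have cci i : continuous (fun a => c a * (w *m rot tf k a) 0 i).
  by apply: continuous_mul => //; exact: rot_coord_continuous.
have sD i : smooth U0 ('D_(e_ i) G) by exact: smooth_derive.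
have e : (fun a => c a * 'D_x ('D_w (fun y => G (y *m rot tf k a))) v) =
  (fun a => \sum_i c a * (w *m rot tf k a) 0 i * 'D_x (fun y => 'D_(e_ i) G (y *m rot tf k a)) v).
  apply/funext => a; rewrite derive2_rot // mulr_sumr.
  by apply: eq_bigr => i _; rewrite mulrA.
have ci i := derive_rot_continuous (k := k) (w := x) (cci i) (sD i) v0.
split; last by rewrite e => a; apply: continuous_sum => i _; exact: ci.
rewrite e mean_sum; last exact: ci.
rewrite (@eq_derive _ _ _ oU0 _ (fun v => \sum_i avg k (fun a => c a * (w *m rot tf k a) 0 i) ('D_(e_ i) G) v)) //;
  last by move=> y y0; rewrite (avg_derive k w cc sG y0).2.
have -> : (fun v => \sum_i avg k (fun a => c a * (w *m rot tf k a) 0 i) ('D_(e_ i) G) v) =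
  \sum_i avg k (fun a => c a * (w *m rot tf k a) 0 i) ('D_(e_ i) G).
  by apply/funext => y; rewrite fct_sumE.
rewrite derive_sum; last by move=> i; case: (avg_derive k x (cci i) (sD i) v0).
by apply: eq_bigr => i _; rewrite derive_avg.
Qed.

(** An average of translates under isometries.  The expansion [LopE] reduces the
    claim to the first and second derivatives of the average. *)
Lemma Lop_avg ell k c F v : continuous c -> smooth U0 F -> v != 0 ->
  Lop ell (avg k c F) v = mean (fun a => c a * Lop ell F (v *m rot tf k a)).
Proof.
move=> cc sF v0; rewrite LopE //; last exact: avg_smooth.
have sFr a : smooth U0 (fun y => F (y *m rot tf k a)).
  by apply: smooth_mulmx => //; exact: rot_orthogonal.
pose T i j a := 'D_(e_ i) (cometric ell i j) v * (c a * 'D_(e_ j) (fun y => F (y *m rot tf k a)) v) +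
   cometric ell i j v * (c a * 'D_(e_ i) ('D_(e_ j) (fun y => F (y *m rot tf k a))) v).
have cT1 i j : continuous (fun a => 'D_(e_ i) (cometric ell i j) v * (c a * 'D_(e_ j) (fun y => F (y *m rot tf k a)) v)).
  by apply: continuous_mul; [exact: cst_continuous|exact: derive_rot_continuous].
have cT2 i j : continuous (fun a => cometric ell i j v * (c a * 'D_(e_ i) ('D_(e_ j) (fun y => F (y *m rot tf k a))) v)).
  by apply: continuous_mul; [exact: cst_continuous|exact: (derive2_avg _ _ _ cc sF v0).2].
have cT i j : continuous (T i j) by exact: continuous_add.
have cS i : continuous (fun a => \sum_j T i j a).
  by move=> a; apply: continuous_sum => j _; exact: cT.
have cSS : continuous (fun a => \sum_i \sum_j T i j a).
  by move=> a; apply: continuous_sum => i _; exact: cS.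
transitivity (mean (fun a => -1 * \sum_i \sum_j T i j a)); last first.
  congr mean; apply/funext => a; rewrite mulN1r -Lop_rot // LopE // mulrN mulr_sumr.
  congr (- _); apply: eq_bigr => i _; rewrite mulr_sumr; apply: eq_bigr => j _.
  by rewrite /T mulrDr !(mulrCA (c a)).
rewrite meanZ // mulN1r mean_sum //; congr (- _); apply: eq_bigr => i _.
rewrite mean_sum //; apply: eq_bigr => j _.
have h1 := derive_rot_continuous (k := k) (w := e_ j) cc sF v0.
have h2 := (derive2_avg k (e_ j) (e_ i) cc sF v0).2.
rewrite /T meanD // (meanZ _ h1) (meanZ _ h2).
by rewrite derive_avg // (derive2_avg _ _ _ cc sF v0).1.
Qed.

End Average.

(** * Fourier components of eigenfunctions *)

Section Shift.
Variable R : realType.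

Lemma mean_derivative0 (h h' : R -> R) : (forall a, is_derive a (1 : R) h (h' a)) ->
  continuous h' -> h pi = h (- pi) -> mean h' = 0.
Proof.
move=> dh ch' hpi.
have ch : continuous h.
  by move=> a; apply: differentiable_continuous; apply/derivable1_diffP; case: (dh a).
have pp : - pi < pi :> R by rewrite gtrN // pi_gt0.
have F2 := @continuous_FTC2 R h' h (- pi) pi pp.
rewrite /mean /Rintegral /period F2.
- by rewrite hpi -EFinB /= subrr.
- exact: continuous_subspaceT.
- split=> [a _||]; first by case: (dh a).
  + by apply: cvg_at_right_filter; exact: ch.
  + by apply: cvg_at_left_filter; exact: ch.
- by move=> a _; rewrite derive1E; have := dh a => H; rewrite (@derive_val _ _ _ _ _ _ _ H).
Qed.

(** As a function of [b] the left hand side has derivative zero, by periodicity. *)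
Lemma mean_shift (h h' : R -> R) b : (forall a, is_derive a (1 : R) h (h' a)) ->
  continuous h' -> (forall a, h (a + pi *+ 2) = h a) -> mean (fun a => h (a + b)) = mean h.
Proof.
move=> dh ch' per.
have ch : continuous h.
  by move=> a; apply: differentiable_continuous; apply/derivable1_diffP; case: (dh a).
have dsh (x a : R) : is_derive x (1 : R) (fun t => h (a + t)) (h' (a + x)).
  have da : is_derive x (1 : R) (fun t : R => a + t) 1.
    have [d e] := is_deriveD (is_derive_cst a x (1 : R)) (is_derive_id x (1 : R)).
    by split; [exact: d|rewrite e add0r].
  by have := @is_derive1_comp _ h (fun t => a + t) x _ _ (dh (a + x)) da; rewrite mulr1.
have csh (x : R) : continuous (fun a : R => h' (a + x)).
  move=> a; apply: (@continuous_comp _ _ _ (fun a : R => a + x) h'); last exact: ch'.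
  by apply: continuous_add; [move=> y; exact: cvg_id|exact: cst_continuous].
have csh0 (x : R) : continuous (fun a : R => h (a + x)).
  move=> a; apply: (@continuous_comp _ _ _ (fun a : R => a + x) h); last exact: ch.
  by apply: continuous_add; [move=> y; exact: cvg_id|exact: cst_continuous].
have d0 b0 : is_derive b0 (1 : R) (fun x => mean (fun a => h (a + x))) 0.
  have [||| d e] := @derive_mean R R^o (fun x a => h (a + x)) (fun t a => h' (a + (b0 + t))) b0 1 1 ltr01.
  - by move=> t _; exact: csh0.
  - move=> t a _.
    have -> : (fun t : R => h (a + (b0 + t *: (1 : R^o)))) = (fun t => h ((a + b0) + t)).
      by apply/funext => s; rewrite [_ *: _]mulr1 addrA.
    by rewrite addrA; exact: dsh.
  - move=> a; apply: (@continuous_comp _ _ _ (fun p : R * R => p.2 + (b0 + p.1)) h'); last exact: ch'.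
    have : continuous (fun p : R * R => p.2 + (b0 + p.1)).
      apply: continuous_add; first by move=> p; exact: cvg_snd.
      by apply: continuous_add; [exact: cst_continuous|move=> p; exact: cvg_fst].
    exact.
  split; first exact: d.
  rewrite e addr0; apply: (@mean_derivative0 (fun a => h (a + b0))).
  - move=> a; rewrite (_ : (fun a => h (a + b0)) = (fun a => h (b0 + a))).
      by rewrite addrC; exact: dsh.
    by apply/funext => s; rewrite addrC.
  - exact: csh.
  - rewrite -[RHS]per; congr h; rewrite mulr2n; ring.
rewrite (@is_derive_0_is_cst _ (fun x => mean (fun a => h (a + x))) b 0 d0).
by congr mean; apply/funext => a; rewrite addr0.
Qed.

End Shift.

Section Pieces.
Variables (R : realType) (N : nat) (tf : torus_frame R N).
Local Notation K := (tK tf).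
Local Notation U0 := (@punctured R N).
Local Notation oU0 := (@punctured_open R N).
Implicit Types (ell : hfield tf) (F G : 'rV[R]_N -> R) (v w : 'rV[R]_N).

(** Negative factors are included: these are the functions on the projective
    space, not merely on the sphere. *)
Definition degree0 F := forall t v, t != 0 -> v != 0 -> F (t *: v) = F v.

Definition eigen ell (lam : R) F :=
  [/\ smooth U0 F, degree0 F & forall v, v != 0 -> Lop ell F v = lam * F v].

Lemma eigen_lin ell lam (c : R) F G : eigen ell lam F -> eigen ell lam G ->
  eigen ell lam (fun v => c * F v + G v).
Proof.
move=> [sF hF eF] [sG hG eG]; split.
- by apply: (smoothD oU0) => //; apply: (smoothM oU0) => //; exact: smooth_cst.
- by move=> t v t0 v0; rewrite hF // hG.
- by move=> v v0; rewrite Lop_lin // eF // eG // mulrDr mulrCA.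
Qed.

Lemma eigen0 ell lam : eigen ell lam (fun=> 0).
Proof.
split=> // [|v v0]; first exact: smooth_cst.
rewrite mulr0 /Lop /divergence big1 ?oppr0 // => i _.
rewrite (@eq_derive _ _ _ oU0 _ (cst 0)) ?derive_cst // => w w0.
have -> : flux ell (fun=> 0) w = 0; last by rewrite mxE.
have -> : (fun=> 0) = (fun _ : 'rV[R]_N => 0 * 0 + 0) :> ('rV[R]_N -> R).
  by apply/funext => x; rewrite mulr0 addr0.
rewrite /flux; have -> : grad (fun _ : 'rV[R]_N => 0 * 0 + 0 : R) w = 0.
  by apply/rowP => l; rewrite !mxE mulr0 addr0 derive_cst.
apply/rowP => l; rewrite sharp_sum big1 ?mxE // => p _.
by rewrite mxE mulr0.
Qed.

Lemma eigenZ ell lam (c : R) F : eigen ell lam F -> eigen ell lam (fun v => c * F v).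
Proof.
move=> eF; have := eigen_lin c eF (eigen0 ell lam).
by under [X in eigen _ _ X -> _]eq_fun do rewrite addr0.
Qed.

Lemma eigen_sum ell lam (I : Type) (r : seq I) (F : I -> 'rV[R]_N -> R) :
  (forall i, eigen ell lam (F i)) -> eigen ell lam (fun v => \sum_(i <- r) F i v).
Proof.
move=> eF; elim: r => [|i r IH].
  by under eq_fun do rewrite big_nil; exact: eigen0.
have := eigen_lin 1 (eF i) IH.
by under [X in eigen _ _ X -> _]eq_fun do rewrite mul1r; under [X in _ -> eigen _ _ X]eq_fun do rewrite big_cons.
Qed.

Lemma eigen_avg ell lam k c F : continuous c -> eigen ell lam F -> eigen ell lam (avg tf k c F).
Proof.
move=> cc [sF hF eF]; split.
- exact: avg_smooth.
- move=> t v t0 v0; rewrite /avg; congr mean; apply/funext => a.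
  by rewrite -scalemxAl hF //; exact: rot_neq0.
- move=> v v0; rewrite Lop_avg // -meanZ; last exact: kernel_continuous2.
  congr mean; apply/funext => a; rewrite eF; last exact: rot_neq0.
  by rewrite mulrCA.
Qed.

Lemma avg_lin k c (x y : R) F G v : continuous c -> smooth U0 F -> smooth U0 G -> v != 0 ->
  avg tf k c (fun w => x * F w + y * G w) v = x * avg tf k c F v + y * avg tf k c G v.
Proof.
move=> cc sF sG v0; have cF := kernel_continuous2 (k := k) cc sF v0.
have cG := kernel_continuous2 (k := k) cc sG v0.
rewrite /avg -!meanZ // -meanD; last 2 first.
- by apply: continuous_mul => //; exact: cst_continuous.
- by apply: continuous_mul => //; exact: cst_continuous.
by congr mean; apply/funext => a; rewrite mulrDr !(mulrCA (c a)).
Qed.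

Lemma eq_avg k c F G v : v != 0 -> (forall w, w != 0 -> F w = G w) ->
  avg tf k c F v = avg tf k c G v.
Proof.
by move=> v0 FG; congr mean; apply/funext => a; rewrite FG //; exact: rot_neq0.
Qed.

Lemma avg_rotC k l c F v b : k != l ->
  avg tf k c F (v *m rot tf l b) = avg tf k c (fun w => F (w *m rot tf l b)) v.
Proof.
by move=> kl; congr mean; apply/funext => a; rewrite -!mulmxA rotC.
Qed.

(** The Fourier coefficients of a |-> F (v rot a) are [cavg] and [savg]. *)
Definition cavg k (n : nat) F := avg tf k (fun a => cos (n%:R * a)) F.
Definition savg k (n : nat) F := avg tf k (fun a => sin (n%:R * a)) F.

Lemma mull_continuous (x : R) : continuous (fun a : R => x * a).
Proof. by apply: continuous_mul; [exact: cst_continuous|move=> y; exact: cvg_id]. Qed.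

Lemma cos_mul_continuous n : continuous (fun a : R => cos (n%:R * a)).
Proof.
move=> a; apply: (@continuous_comp _ _ _ (fun a : R => n%:R * a) cos).
  exact: mull_continuous.
exact: continuous_cos.
Qed.

Lemma sin_mul_continuous n : continuous (fun a : R => sin (n%:R * a)).
Proof.
move=> a; apply: (@continuous_comp _ _ _ (fun a : R => n%:R * a) sin).
  exact: mull_continuous.
exact: continuous_sin.
Qed.

Lemma is_derive_affine (x y b : R) : is_derive b (1 : R) (fun a => x * (a - y)) x.
Proof.
have -> : (fun a => x * (a - y)) = x *: ((id : R -> R) + cst (- y)) by apply/funext.
have [d e] := is_deriveZ x (is_deriveD (is_derive_id b (1 : R)) (is_derive_cst (- y) b (1 : R))).
by split; [exact: d|rewrite e addr0 [_ *: _]mulr1].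
Qed.

Lemma cosN2pi (n : nat) (x : R) : cos (x + n%:R * (pi *+ 2)) = cos x.
Proof.
elim: n => [|n IH]; first by rewrite mul0r addr0.
by rewrite -addn1 natrD mulrDl mul1r addrA cosD2pi.
Qed.

Lemma sinN2pi (n : nat) (x : R) : sin (x + n%:R * (pi *+ 2)) = sin x.
Proof.
elim: n => [|n IH]; first by rewrite mul0r addr0.
by rewrite -addn1 natrD mulrDl mul1r addrA sinD2pi.
Qed.

(** Invariance of the mean under translation moves the rotation from the point to
    the kernel. *)
Lemma avg_shift k (f : R -> R) (f' : R -> R) (b : R) F v :
  (forall a, is_derive a (1 : R) f (f' a)) -> continuous f' ->
  (forall a, f (a + pi *+ 2) = f a) -> smooth U0 F -> v != 0 ->
  avg tf k f F (v *m rot tf k b) = mean (fun a => f (a - b) * F (v *m rot tf k a)).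
Proof.
move=> df cf' per sF v0.
pose h a := f (a - b) * F (v *m rot tf k a).
pose h' a := f' (a - b) * F (v *m rot tf k a) + f (a - b) * 'D_(v *m rot tf k a *m K k) F (v *m rot tf k a).
have cf : continuous f.
  by move=> a; apply: differentiable_continuous; apply/derivable1_diffP; case: (df a).
have csub : continuous (fun a : R => a - b).
  by apply: continuous_add; [move=> y; exact: cvg_id|exact: cst_continuous].
have cfb : continuous (fun a => f (a - b)).
  by move=> a; apply: (@continuous_comp _ _ _ (fun a : R => a - b) f); [exact: csub|exact: cf].
have cfb' : continuous (fun a => f' (a - b)).
  by move=> a; apply: (@continuous_comp _ _ _ (fun a : R => a - b) f'); [exact: csub|exact: cf'].
suff [H1 H2 H3] : [/\ forall a, is_derive a (1 : R) h (h' a), continuous h' &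
    forall a, h (a + pi *+ 2) = h a].
  rewrite -(mean_shift b H1 H2 H3).
  by congr mean; apply/funext => a; rewrite /h addrK -mulmxA -rotD addrC.
split.
- move=> a.
  have d1 : is_derive a (1 : R) (fun a => f (a - b)) (f' (a - b)).
    have da := is_derive_affine 1 b a.
    have := @is_derive1_comp _ f (fun a => 1 * (a - b)) a (f' (a - b)) _ _ da.
    rewrite mulr1 (_ : f \o _ = (fun a => f (a - b))); last first.
      by apply/funext => x /=; rewrite mul1r.
    by apply; rewrite mul1r.
  have [dr er] := is_derive_rot tf k v a.
  have dr' : differentiable (fun a => v *m rot tf k a) a by apply/derivable1_diffP.
  have dF : differentiable F (v *m rot tf k a).
    by apply: (smooth_differentiable oU0) => //; exact: rot_neq0.
  have d2 : is_derive a (1 : R) (fun a => F (v *m rot tf k a)) ('D_(v *m rot tf k a *m K k) F (v *m rot tf k a)).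
    split; last by have := derive_comp (1 : R) dr' dF; rewrite er.
    by apply/derivable1_diffP; exact: differentiable_comp.
  have [dx ex] := is_deriveM d1 d2.
  by split; [exact: dx|rewrite [LHS]ex /h' addrC [X in X + _]mulrC].
- apply: continuous_add; apply: continuous_mul => //.
    move=> a; apply: (@continuous_comp _ _ _ (fun a => v *m rot tf k a) F).
      exact: rot_continuous2.
    by apply: (smooth_continuous sF); exact: rot_neq0.
  rewrite (_ : (fun a => _) = (fun a => \sum_i (v *m K k *m rot tf k a) 0 i * 'D_(delta_mx 0 i) F (v *m rot tf k a))).
    move=> a; apply: continuous_sum => i _.
    have sD : smooth U0 ('D_(delta_mx 0 i) F) by exact: smooth_derive.
    exact: (kernel_continuous2 (k := k) (@rot_coord_continuous _ _ tf k (v *m K k) i) sD v0).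
  apply/funext => a; rewrite -mulmxA rot_tK mulmxA (derive_grad _ sF); last exact: rot_neq0.
  by apply: eq_bigr => i _; rewrite [X in _ * X]mxE.
- by move=> a; rewrite /h rot_periodic addrAC per.
Qed.

Lemma is_derive_cosn (n : nat) (a : R) :
  is_derive a (1 : R) (fun a => cos (n%:R * a)) (- sin (n%:R * a) * n%:R).
Proof.
have da := is_derive_affine n%:R 0 a.
have := @is_derive1_comp _ cos (fun a => n%:R * (a - 0)) a _ _ (is_derive_cos _) da.
by rewrite (_ : cos \o _ = (fun a => cos (n%:R * a))) ?subr0 //; apply/funext => x /=; rewrite subr0.
Qed.

Lemma is_derive_sinn (n : nat) (a : R) :
  is_derive a (1 : R) (fun a => sin (n%:R * a)) (cos (n%:R * a) * n%:R).
Proof.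
have da := is_derive_affine n%:R 0 a.
have := @is_derive1_comp _ sin (fun a => n%:R * (a - 0)) a _ _ (is_derive_sin _) da.
by rewrite (_ : sin \o _ = (fun a => sin (n%:R * a))) ?subr0 //; apply/funext => x /=; rewrite subr0.
Qed.

Lemma cavg_rot k n F v b : smooth U0 F -> v != 0 ->
  cavg k n F (v *m rot tf k b) = cos (n%:R * b) * cavg k n F v + sin (n%:R * b) * savg k n F v.
Proof.
move=> sF v0; rewrite /cavg (@avg_shift k _ _ b F v (is_derive_cosn n)) //; last 2 first.
- apply: continuous_mul; last exact: cst_continuous.
  by move=> a; apply: cvgN; exact: sin_mul_continuous.
- by move=> a; rewrite mulrDr cosN2pi.
have cC := kernel_continuous2 (k := k) (@cos_mul_continuous n) sF v0.
have cS := kernel_continuous2 (k := k) (@sin_mul_continuous n) sF v0.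
rewrite /savg /avg -!meanZ // -meanD.
- congr mean; apply/funext => a; rewrite mulrBr cosB; ring.
- by apply: continuous_mul => //; exact: cst_continuous.
- by apply: continuous_mul => //; exact: cst_continuous.
Qed.

Lemma savg_rot k n F v b : smooth U0 F -> v != 0 ->
  savg k n F (v *m rot tf k b) = cos (n%:R * b) * savg k n F v - sin (n%:R * b) * cavg k n F v.
Proof.
move=> sF v0; rewrite /savg (@avg_shift k _ _ b F v (is_derive_sinn n)) //; last 2 first.
- by apply: continuous_mul; [exact: cos_mul_continuous|exact: cst_continuous].
- by move=> a; rewrite mulrDr sinN2pi.
have cC := kernel_continuous2 (k := k) (@cos_mul_continuous n) sF v0.
have cS := kernel_continuous2 (k := k) (@sin_mul_continuous n) sF v0.
rewrite /cavg /avg -mulNr -!meanZ // -meanD.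
- congr mean; apply/funext => a; rewrite mulrBr sinB; ring.
- by apply: continuous_mul => //; exact: cst_continuous.
- by apply: continuous_mul => //; exact: cst_continuous.
Qed.

Lemma cavg_smooth k n F : smooth U0 F -> smooth U0 (cavg k n F).
Proof. by apply: avg_smooth; exact: cos_mul_continuous. Qed.

Lemma savg_smooth k n F : smooth U0 F -> smooth U0 (savg k n F).
Proof. by apply: avg_smooth; exact: sin_mul_continuous. Qed.

End Pieces.

(** * A positive trigonometric kernel *)

Section Kernel.
Variable R : realType.

(** These are the functions cos (a / 2) ^ (2 n): nonnegative trigonometric
    polynomials whose mass concentrates at a = 0. *)
Definition bump (n : nat) (a : R) : R := ((1 + cos a) / 2) ^+ n.

Lemma bump_ge0 n a : 0 <= bump n a.
Proof. by rewrite exprn_ge0 // divr_ge0 //; have := cos_geN1 a; lra. Qed.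

Lemma bump_continuous n : continuous (bump n).
Proof.
elim: n => [|n IH].
  by rewrite (_ : bump 0 = fun=> 1); [exact: cst_continuous|apply/funext => a; rewrite /bump expr0].
rewrite (_ : bump n.+1 = fun a => (1 + cos a) * 2^-1 * bump n a).
  apply: continuous_mul => //; apply: continuous_mul; last exact: cst_continuous.
  by apply: continuous_add; [exact: cst_continuous|exact: continuous_cos].
by apply/funext => a; rewrite /bump exprS.
Qed.

Lemma bumpS n a : bump n.+1 a = bump n a - (1 - cos a) * bump n a / 2.
Proof. by rewrite /bump exprS; field. Qed.

Lemma is_derive_bump n (a : R) :
  is_derive a (1 : R) (bump n) (- n%:R / 2 * sin a * bump n.-1 a).
Proof.
have d1 : is_derive a (1 : R) (fun a => (1 + cos a) / 2) (- sin a / 2).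
  have -> : (fun a : R => (1 + cos a) / 2) = 2^-1 *: (cst 1 + cos).
    by apply/funext => x; rewrite /= [RHS]mulrC.
  have [d e] := is_deriveZ 2^-1 (is_deriveD (is_derive_cst (1 : R) a (1 : R)) (is_derive_cos a)).
  by split; [exact: d|rewrite e add0r [LHS]mulrC].
case: n => [|n].
  rewrite (_ : bump 0 = cst 1); last by apply/funext => x; rewrite /bump expr0.
  by rewrite oppr0 !mul0r; exact: is_derive_cst.
have [d e] := is_deriveX n.+1 d1.
have eb k : (fun a : R => (1 + cos a) / 2) ^+ k = bump k.
  apply/funext => x; elim: k => [|k IH]; first by rewrite /bump !expr0.
  by rewrite exprS /bump exprS -/(bump k x) -IH.
rewrite eb in d e.
split; first exact: d.
by rewrite e /bump /GRing.scale /=; field.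
Qed.

(** Integrate the derivative of [sin a * bump n a] over the period. *)
Lemma bump_moment n :
  n.+1%:R * mean (fun a => (1 - cos a) * bump n a) = mean (bump n).
Proof.
have c1 : continuous (fun a => (1 - cos a) * bump n a).
  apply: continuous_mul; last exact: bump_continuous.
  by apply: continuous_add; [exact: cst_continuous|move=> a; apply: cvgN; exact: continuous_cos].
have cS : continuous (fun a => n.+1%:R * ((1 - cos a) * bump n a)).
  by apply: continuous_mul => //; exact: cst_continuous.
have cN : continuous (fun a => -1 * (n.+1%:R * ((1 - cos a) * bump n a))).
  by apply: continuous_mul => //; exact: cst_continuous.
have cb := @bump_continuous n.
apply/esym/eqP; rewrite -subr_eq0 -meanZ // -mulN1r -meanZ // -meanD //.
apply/eqP; apply: (@mean_derivative0 _ (fun a => sin a * bump n a)).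
- move=> a.
  have [d e] := is_deriveM (is_derive_sin a) (is_derive_bump n a).
  split; first exact: d.
  rewrite [LHS]e /GRing.scale /=.
  have s2 : sin a * sin a = (1 - cos a) * (1 + cos a).
    by have := cos2Dsin2 a; rewrite !expr2; nra.
  case: n {c1 cS cN cb d e} => [|n] /=.
    by rewrite /bump !expr0; ring.
  have -> : sin a * (- n.+1%:R / 2 * sin a * bump n a) = - n.+1%:R / 2 * (sin a * sin a) * bump n a.
    ring.
  by rewrite s2 /bump !exprS -[in RHS]natr1; field.
- exact: continuous_add.
- by rewrite sinN sinpi oppr0 !mul0r.
Qed.

Lemma mean_bump_gt0 n : 0 < mean (bump n).
Proof.
elim: n => [|n IH].
  rewrite (_ : bump 0 = fun=> 1); last by apply/funext => x; rewrite /bump expr0.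
  by rewrite mean_cst mul1r mulrn_wgt0 // pi_gt0.
have c1 : continuous (fun a => (1 - cos a) * bump n a).
  apply: continuous_mul; last exact: bump_continuous.
  by apply: continuous_add; [exact: cst_continuous|move=> a; apply: cvgN; exact: continuous_cos].
have -> : mean (bump n.+1) = mean (bump n) - 2^-1 * mean (fun a => (1 - cos a) * bump n a).
  rewrite -mulNr -meanZ // -meanD //.
  - by congr mean; apply/funext => a; rewrite bumpS; field.
  - exact: bump_continuous.
  - by apply: continuous_mul => //; exact: cst_continuous.
have m := bump_moment n; move: (mean (fun a => (1 - cos a) * bump n a)) m => y m.
have n0 : 1 <= n.+1%:R :> R by rewrite ler1n.
have y0 : 0 < y by rewrite -(pmulr_rgt0 _ (lt_le_trans ltr01 n0)) m.
have yI : y <= mean (bump n) by rewrite -m ler_peMl // ltW.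
by rewrite subr_gt0; lra.
Qed.

(** On the period, |h a - h 0| <= e / 2 + C (1 - cos a) for some constant C, and
    by [bump_moment] the normalised mean of the second term is C / (n + 1). *)
Lemma bump_approx (h : R -> R) : continuous h ->
  (mean (bump n))^-1 * mean (fun a => bump n a * h a) @[n --> \oo] --> h 0.
Proof.
move=> ch; apply/cvgrPdist_le => e e0.
have e20 : 0 < e / 2 by rewrite divr_gt0.
have [M HM] : exists M, forall a, period a -> `|h a - h 0| <= M.
  have p0 : @period R !=set0 by exists 0; rewrite /period /= in_itv /= oppr_le0 pi_ge0.
  have cn : {within (@period R), continuous (fun a => `|h a - h 0|)}.
    apply: continuous_subspaceT.
    have c1 : continuous (fun a => h a + - h 0) by apply: continuous_add => //; exact: cst_continuous.
    by move=> a; apply: (@continuous_comp _ _ _ (fun a => h a + - h 0) Num.norm); [exact: c1|exact: norm_continuous].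
  have [M _ HM] := @compact_EVT_max _ R (fun a => `|h a - h 0|) _ p0 (@compact_period R) cn.
  by exists `|h M - h 0| => a pa; apply: HM; rewrite inE.
have M0 : 0 <= M.
  by apply: le_trans (HM 0 _) => //; rewrite /period /= in_itv /= oppr_le0 pi_ge0.
have /cvgrPdist_lt /(_ _ e20) /nbhs_ballP[d0 /= d00 Hd0] := ch 0.
pose d := Num.min d0 1 / 2.
have d_gt0 : 0 < d by rewrite divr_gt0 // lt_min d00 ltr01.
have dm1 : Num.min d0 1 <= d0 by rewrite ge_min lexx.
have dm2 : Num.min d0 1 <= 1 :> R by rewrite ge_min lexx orbT.
have d_lt : d < d0 by move: d_gt0; rewrite /d; move: (Num.min d0 1) dm1 => x; lra.
have d_le1 : d <= 1 by move: d_gt0; rewrite /d; move: (Num.min d0 1) dm2 => x; lra.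
have pi1 : 2 <= pi :> R by exact: pi_ge2.
have cd1 : cos d < 1.
  rewrite -cos0; rewrite ltr_cos // in_itv /= ?lexx ?pi_ge0 //.
  by apply/andP; split; lra.
have c0 : 0 < 1 - cos d by rewrite subr_gt0.
pose C := M / (1 - cos d).
have bound a : period a -> `|h a - h 0| <= e / 2 + C * (1 - cos a).
  move=> pa; have [ad|ad] := ltP `|a| d0.
    apply: (@le_trans _ _ (e / 2)).
      by rewrite distrC ltW // Hd0 // -ball_normE /= sub0r normrN.
    rewrite lerDl; apply: mulr_ge0; first exact: divr_ge0 M0 (ltW c0).
    by rewrite subr_ge0 cos_le1.
  apply: le_trans (HM a pa) _.
  have cosa : cos a <= cos d.
    have -> : cos a = cos `|a| by case: (ger0P a) => // _; rewrite cosN.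
    have ia : `|a| \in `[0, pi]%R.
      rewrite in_itv /= normr_ge0 /= ler_norml.
      by move: pa; rewrite /period /= in_itv.
    have id : d \in `[0, pi]%R by rewrite in_itv /=; apply/andP; split; lra.
    by rewrite le_eqVlt (ltr_cos id ia) (lt_le_trans d_lt ad) orbT.
  have : M <= C * (1 - cos a).
    by rewrite /C mulrAC ler_pdivlMr // ler_wpM2l //; lra.
  lra.
near=> n.
have In := mean_bump_gt0 n.
have cb := @bump_continuous n.
have cbh : continuous (fun a => bump n a * h a) by exact: continuous_mul.
have c1 : continuous (fun a => (1 - cos a) * bump n a).
  apply: continuous_mul => //.
  by apply: continuous_add; [exact: cst_continuous|move=> a; apply: cvgN; exact: continuous_cos].
have cbn : continuous (fun a => - h 0 * bump n a).
  by apply: continuous_mul => //; exact: cst_continuous.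
have c2 : continuous (fun a => bump n a * h a + - h 0 * bump n a) by exact: continuous_add.
have c3 : continuous (fun a => C * ((1 - cos a) * bump n a)).
  by apply: continuous_mul => //; exact: cst_continuous.
have c4 : continuous (fun a => e / 2 * bump n a).
  by apply: continuous_mul => //; exact: cst_continuous.
have key : `|mean (fun a => bump n a * h a + - h 0 * bump n a)| <=
    mean (fun a => e / 2 * bump n a + C * ((1 - cos a) * bump n a)).
  rewrite ler_norml; apply/andP; split.
    rewrite lerNl -mulN1r -meanZ //; apply: ler_mean.
    - by apply: continuous_mul => //; exact: cst_continuous.
    - exact: continuous_add.
    - move=> a pa; have := bound a pa; rewrite ler_norml => /andP[b1 b2].
      by have := bump_ge0 n a; nra.
  apply: ler_mean => //; first exact: continuous_add.
  move=> a pa; have := bound a pa; rewrite ler_norml => /andP[b1 b2].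
  by have := bump_ge0 n a; nra.
move: key; rewrite !meanD // !meanZ // => key.
have -> : h 0 - (mean (bump n))^-1 * mean (fun a => bump n a * h a) =
    - ((mean (bump n))^-1 * (mean (fun a => bump n a * h a) + - h 0 * mean (bump n))).
  by field; rewrite gt_eqF.
rewrite normrN normrM gtr0_norm ?invr_gt0 // mulrC ler_pdivrMr //.
apply: (le_trans key).
have := bump_moment n; move: (mean (fun a => (1 - cos a) * bump n a)) => y m.
have n0 : 0 < n.+1%:R :> R by rewrite ltr0n.
have Cn : C <= e / 2 * n.+1%:R.
  rewrite -ler_pdivrMl //; apply: (@le_trans _ _ n%:R); last by rewrite ler_nat.
  near: n; exact: nbhs_infty_ger.
have y0 : 0 < y by rewrite -(pmulr_rgt0 _ n0) m.
have : C * y <= e / 2 * mean (bump n).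
  by rewrite -m mulrA ler_wpM2r // ltW.
lra.
Unshelve. all: by end_near. Qed.

Definition even_trig (f : R -> R) := exists r : seq (R * nat),
  forall a, f a = \sum_(p <- r) p.1 * cos (p.2%:R * a).

Lemma bump_trig n : even_trig (bump n).
Proof.
elim: n => [|n [r IH]].
  by exists [:: (1, 0%N)] => a; rewrite big_seq1 /= mul0r cos0 mulr1 /bump expr0.
exists ([seq (p.1 / 2, p.2) | p <- r] ++ [seq (p.1 / 4, p.2.+1) | p <- r] ++
  [seq (p.1 / 4, if p.2 is l.+1 then l else 1%N) | p <- r]) => a.
rewrite !big_cat !big_map /= -!big_split /= /bump exprS -/(bump n a) IH mulr_sumr.
apply: eq_bigr => -[x l] _ /=.
have -> : cos ((if l is l'.+1 then l' else 1%N)%:R * a) = cos (l%:R * a - a).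
  case: l => [|l]; first by rewrite mul0r add0r mul1r cosN.
  by congr cos; rewrite -[in RHS]natr1; ring.
have -> : cos (l.+1%:R * a) = cos (l%:R * a + a) by congr cos; rewrite -natr1; ring.
by rewrite cosB cosD; field.
Qed.

End Kernel.

(** * Transplantation of eigenfunctions *)

Section Free.
Variables (R : realType) (X : Type) (D : set X).

Definition free_on q (F : 'I_q -> X -> R) :=
  forall c : 'I_q -> R, (forall x, D x -> \sum_i c i * F i x = 0) -> forall i, c i = 0.

Definition values q (F : 'I_q -> X -> R) (pts : 'I_q -> X) : 'M[R]_q :=
  \matrix_(i, j) F i (pts j).

Lemma det_free q (F : 'I_q -> X -> R) pts : (forall j, D (pts j)) ->
  \det (values F pts) != 0 -> free_on F.
Proof.
move=> Dp d0 c Hc i.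
have : (\row_i c i) *m values F pts = 0.
  apply/rowP => j; rewrite !mxE -[RHS](Hc (pts j) (Dp j)).
  by apply: eq_bigr => l _; rewrite !mxE.
have u : values F pts \in unitmx by rewrite unitmxE unitfE.
move=> /(congr1 (mulmx^~ (invmx (values F pts)))) /=.
by rewrite mulmxK // mul0mx => /rowP/(_ i); rewrite !mxE.
Qed.

(** Induction on [q].  If the determinant vanished for every choice of the last
    point, its expansion along the last column would be a linear relation between
    the [F i] in which the last coefficient is the determinant for the first [q]
    functions. *)
Lemma free_points q (F : 'I_q -> X -> R) : free_on F ->
  exists pts, (forall j, D (pts j)) /\ \det (values F pts) != 0.
Proof.
elim: q F => [|q IH] F fF.
  have pts (j : 'I_0) : X by case: j.
  by exists pts; split=> [[]//|]; rewrite det_mx00 oner_eq0.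
have [|pts [Dp dp]] := IH (fun i => F (lift ord_max i)).
  move=> c Hc i.
  have := fF (fun i => if unlift ord_max i is Some j then c j else 0) _ (lift ord_max i).
  rewrite liftK; apply=> x Dx; rewrite (bigD1 ord_max) //= unlift_none mul0r add0r.
  rewrite (reindex_omap (lift ord_max) (unlift ord_max)) /=.
    rewrite -[RHS](Hc x Dx); apply: eq_big => [j|j _]; last by rewrite liftK.
    by rewrite liftK eqxx eq_sym neq_lift.
  by move=> j; rewrite eq_sym => /unlift_some[k -> ->].
pose P t (j : 'I_q.+1) := if unlift ord_max j is Some k then pts k else t.
pose cof (i : 'I_q.+1) := (-1) ^+ (i + @ord_max q) *
  \det (\matrix_(a, b) F (lift i a) (pts b)) : R.
have detE t : \det (values F (P t)) = \sum_i cof i * F i t.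
  rewrite (expand_det_col _ ord_max); apply: eq_bigr => i _.
  rewrite mxE /P unlift_none mulrC; congr (_ * _); rewrite /cofactor; congr (_ * \det _).
  by apply/matrixP => a b; rewrite !mxE liftK.
have [[t [Dt dt]]|nt] := pselect (exists t, D t /\ \det (values F (P t)) != 0).
  exists (P t); split=> // j; rewrite /P.
  by case: unliftP => [k|] _.
have cof0 := fF cof _ ord_max.
have : cof ord_max = 0.
  apply: cof0 => x Dx; rewrite -detE; apply/eqP/negPn/negP => dx.
  by apply: nt; exists x.
rewrite /cof => /eqP; rewrite mulf_eq0 signr_eq0 /= => d0; case/negP: dp.
by apply: etrans d0; congr (\det _ == 0).
Qed.

(** By [free_points] independence follows from the nonvanishing of a single
    determinant, which is an open condition. *)
Lemma free_cvg q (F : 'I_q -> X -> R) (G : nat -> 'I_q -> X -> R) : free_on F ->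
  (forall i x, D x -> G n i x @[n --> \oo] --> F i x) -> exists n, free_on (G n).
Proof.
move=> fF GF; have [pts [Dp dp]] := free_points fF.
have : \det (values (G n) pts) @[n --> \oo] --> \det (values F pts).
  rewrite /determinant.
  apply: cvg_big => [|s _]; first exact: add_continuous.
  apply: cvgM; first exact: cvg_cst.
  apply: cvg_big => [|i _].
    exact: mul_continuous.
  under eq_fun do rewrite mxE; rewrite mxE; exact: GF.
move=> /cvgrPdist_lt /(_ `|\det (values F pts)|).
rewrite normr_gt0 dp => /(_ isT)[n _ /(_ n (leqnn n)) /= Hn].
exists n; apply: (det_free Dp); apply: contraTneq Hn => ->.
by rewrite subr0 ltxx.
Qed.

End Free.

(** The operator that sends [h] to (h o W + h o W') / 2 has each [H p] as an
    eigenfunction, with eigenvalue [th p].  Composing its differences with the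
    eigenvalues other than [t] kills all summands except those with eigenvalue
    [t], which are multiplied by a nonzero number. *)
Lemma separate_eigenvalues (R : realType) (X : Type) (D : set X) (T : eqType) (S : seq T)
    (th : T -> R) (H : T -> X -> R) (W W' : X -> X) :
  (forall x, D x -> D (W x) /\ D (W' x)) ->
  (forall p x, D x -> H p (W x) + H p (W' x) = 2 * th p * H p x) ->
  (forall x, D x -> \sum_(p <- S) H p x = 0) ->
  forall t x, D x -> \sum_(p <- S | th p == t) H p x = 0.
Proof.
move=> DW HW HS t.
have claim (rs : seq R) x : D x -> \sum_(p <- S) \prod_(r <- rs) (th p - r) * H p x = 0.
  elim: rs x => [|r rs IH] x Dx.
    rewrite -[RHS](HS x Dx); apply: eq_bigr => p _; by rewrite big_nil mul1r.
  have [D1 D2] := DW x Dx.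
  transitivity (2^-1 * (\sum_(p <- S) \prod_(r <- rs) (th p - r) * H p (W x) +
     \sum_(p <- S) \prod_(r <- rs) (th p - r) * H p (W' x)) -
     r * \sum_(p <- S) \prod_(r <- rs) (th p - r) * H p x); last first.
    by rewrite !IH // addr0 !mulr0 subr0.
  rewrite -big_split /= !mulr_sumr -sumrB; apply: eq_bigr => p _.
  rewrite big_cons -mulrDr HW //.
  by move: (\prod_(r0 <- rs) (th p - r0)) (H p x) (th p) => y z u; field.
move=> x Dx.
have := claim [seq r <- map th S | r != t] x Dx.
have z0 : \sum_(p <- S | th p != t)
    \prod_(r <- [seq r <- map th S | r != t]) (th p - r) * H p x = 0.
  rewrite big_seq_cond; apply: big1 => p /andP[pS pt].
  suff -> : \prod_(r <- [seq r <- map th S | r != t]) (th p - r) = 0 by rewrite mul0r.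
  apply/eqP; rewrite prodf_seq_eq0; apply/hasP; exists (th p); last by rewrite /= subrr.
  by rewrite mem_filter pt map_f.
rewrite (bigID (fun p => th p == t)) /= z0 addr0.
rewrite (eq_bigr (fun p => \prod_(r <- [seq r <- map th S | r != t]) (t - r) * H p x)).
  rewrite -mulr_sumr => /eqP; rewrite mulf_eq0 => /orP[|/eqP //].
  rewrite prodf_seq_eq0 => /hasP[r]; rewrite mem_filter /= => /andP[rt _].
  by rewrite subr_eq0 eq_sym (negbTE rt).
by move=> p /eqP ->.
Qed.

Lemma eq_sum_seq (R : realType) (T : eqType) (S : seq T) (P : pred T) (f g : T -> R) :
  (forall p, p \in S -> P p -> f p = g p) ->
  \sum_(p <- S | P p) f p = \sum_(p <- S | P p) g p.
Proof.
move=> fg; rewrite big_seq_cond [RHS]big_seq_cond; apply: eq_bigr => p /andP[].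
exact: fg.
Qed.

Lemma sum_fibers (R : realType) (T : eqType) (S : seq T) (th : T -> R) (f : T -> R) :
  \sum_(p <- S) f p = \sum_(t <- undup (map th S)) \sum_(p <- S | th p == t) f p.
Proof.
under [RHS]eq_bigr do rewrite big_mkcond.
rewrite exchange_big /= big_seq [RHS]big_seq; apply: eq_bigr => p pS.
rewrite (bigD1_seq (th p)) ?undup_uniq ?mem_undup ?map_f //= eqxx big1 ?addr0 //.
by move=> t; rewrite eq_sym => /negbTE ->.
Qed.

Lemma small_multiple (B z x : int) : z = B * x -> - B < z -> z < B -> x = 0.
Proof.
move=> zB z1 z2; apply/eqP; rewrite eq_le; apply/andP; split; rewrite leNgt; apply/negP => x0; nia.
Qed.

(** Base B representations with digits of either sign; this recovers the two
    components of a weight from one integer. *)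
Lemma digits_inj (B n n' y y' : int) : n + B * y = n' + B * y' ->
  - B < n' - n -> n' - n < B -> n = n' /\ y = y'.
Proof.
move=> e h1 h2.
have e' : n' - n = B * (y - y').
  rewrite mulrBr; move: (B * y) (B * y') e => u u' e; lia.
have /eqP := small_multiple e' h1 h2; rewrite subr_eq0 => /eqP yy.
by move: e; rewrite yy; split => //; lia.
Qed.

Section Transplant.
Variables (R : realType) (N : nat) (tf : torus_frame R N).
Local Notation K := (tK tf).
Local Notation U0 := (@punctured R N).
Local Notation oU0 := (@punctured_open R N).
Implicit Types (ell : hfield tf) (F G : 'rV[R]_N -> R) (v w : 'rV[R]_N).
Local Notation k0 := (0 : 'I_2).
Local Notation k1 := (1 : 'I_2).

Definition sgnb (b : bool) : R := if b then 1 else -1.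

(** The components of F for the weight (n1, n2) if [b] is true and (n1, - n2)
    otherwise: the kernel of [piece] is the cosine of n1 a + n2 a' or n1 a - n2 a',
    that of [copiece] the sine.  Up to a common sign every weight is of this
    form. *)
Definition piece b n1 n2 F v := cavg tf k0 n1 (cavg tf k1 n2 F) v
  - sgnb b * savg tf k0 n1 (savg tf k1 n2 F) v.
Definition copiece b n1 n2 F v := savg tf k0 n1 (cavg tf k1 n2 F) v
  + sgnb b * cavg tf k0 n1 (savg tf k1 n2 F) v.
Definition weight b (n1 n2 : nat) (k : 'I_2) : R := if k == 0 then n1%:R else sgnb b * n2%:R.

Lemma eigen_piece ell lam b n1 n2 F : eigen ell lam F -> eigen ell lam (piece b n1 n2 F).
Proof.
move=> eF.
have eC k n H : eigen ell lam H -> eigen ell lam (cavg tf k n H).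
  by apply: eigen_avg; exact: cos_mul_continuous.
have eS k n H : eigen ell lam H -> eigen ell lam (savg tf k n H).
  by apply: eigen_avg; exact: sin_mul_continuous.
rewrite (_ : piece b n1 n2 F = fun v => - sgnb b * savg tf k0 n1 (savg tf k1 n2 F) v +
  cavg tf k0 n1 (cavg tf k1 n2 F) v); last by apply/funext => v; rewrite /piece mulNr addrC.
by apply: eigen_lin; [exact: eS (eS _ _ _ eF)|exact: eC (eC _ _ _ eF)].
Qed.

Lemma eigen_copiece ell lam b n1 n2 F : eigen ell lam F -> eigen ell lam (copiece b n1 n2 F).
Proof.
move=> eF.
have eC k n H : eigen ell lam H -> eigen ell lam (cavg tf k n H).
  by apply: eigen_avg; exact: cos_mul_continuous.
have eS k n H : eigen ell lam H -> eigen ell lam (savg tf k n H).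
  by apply: eigen_avg; exact: sin_mul_continuous.
rewrite (_ : copiece b n1 n2 F = fun v => sgnb b * cavg tf k0 n1 (savg tf k1 n2 F) v +
  savg tf k0 n1 (cavg tf k1 n2 F) v); last by apply/funext => v; rewrite /copiece addrC.
by apply: eigen_lin; [exact: eC (eS _ _ _ eF)|exact: eS (eC _ _ _ eF)].
Qed.

Lemma isotypic_piece b n1 n2 F : smooth U0 F ->
  isotypic tf (weight b n1 n2) (piece b n1 n2 F) (copiece b n1 n2 F).
Proof.
move=> sF k a v v0.
have sC := cavg_smooth tf k1 n2 sF.
have sS := savg_smooth tf k1 n2 sF.
have [->|kk] := eqVneq k 0.
  rewrite /weight eqxx /piece /copiece (cavg_rot tf _ _ _ sC v0) (savg_rot tf _ _ _ sS v0).
  rewrite (cavg_rot tf _ _ _ sS v0) (savg_rot tf _ _ _ sC v0).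
  move: (cavg _ _ _ _ _) (savg _ _ _ _ _) (cavg _ _ _ (savg _ _ _ _) _) (savg _ _ _ (cavg _ _ _ _) _).
  by move=> x1 x2 x3 x4; move: (sgnb b) (cos _) (sin _) => s y z; split; ring.
have {kk}-> : k = k1 by apply/val_inj; case: k kk => -[|[|[]]].
rewrite /weight /=.
have e : (cos (sgnb b * n2%:R * a) = cos (n2%:R * a)) *
         (sin (sgnb b * n2%:R * a) = sgnb b * sin (n2%:R * a)).
  by case: b; rewrite /sgnb ?mul1r // -!mulrA !mulN1r cosN sinN.
have bb : sgnb b * sgnb b = 1 by case: b {e}; rewrite /sgnb ?mulr1 // mulrNN mulr1.
have k01 : k0 != k1 by [].
have sH H : smooth U0 H -> smooth U0 (fun w => H (w *m rot tf k1 a)).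
  by move=> s; apply: smooth_mulmx => //; exact: rot_orthogonal.
have rC f H : continuous f -> smooth U0 H ->
    (forall w, w != 0 -> cavg tf k1 n2 H (w *m rot tf k1 a) =
      cos (n2%:R * a) * cavg tf k1 n2 H w + sin (n2%:R * a) * savg tf k1 n2 H w) ->
    avg tf k0 f (cavg tf k1 n2 H) (v *m rot tf k1 a) =
      cos (n2%:R * a) * avg tf k0 f (cavg tf k1 n2 H) v +
      sin (n2%:R * a) * avg tf k0 f (savg tf k1 n2 H) v.
  move=> cf sHH eH; rewrite avg_rotC // (eq_avg _ _ _ v0 eH) avg_lin //.
  - exact: cavg_smooth.
  - exact: savg_smooth.
have rS f H : continuous f -> smooth U0 H ->
    (forall w, w != 0 -> savg tf k1 n2 H (w *m rot tf k1 a) =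
      cos (n2%:R * a) * savg tf k1 n2 H w + - sin (n2%:R * a) * cavg tf k1 n2 H w) ->
    avg tf k0 f (savg tf k1 n2 H) (v *m rot tf k1 a) =
      cos (n2%:R * a) * avg tf k0 f (savg tf k1 n2 H) v +
      - sin (n2%:R * a) * avg tf k0 f (cavg tf k1 n2 H) v.
  move=> cf sHH eH; rewrite avg_rotC // (eq_avg _ _ _ v0 eH) avg_lin //.
  - exact: savg_smooth.
  - exact: cavg_smooth.
have eC w : w != 0 -> cavg tf k1 n2 F (w *m rot tf k1 a) =
      cos (n2%:R * a) * cavg tf k1 n2 F w + sin (n2%:R * a) * savg tf k1 n2 F w.
  by move=> w0; exact: cavg_rot.
have eS w : w != 0 -> savg tf k1 n2 F (w *m rot tf k1 a) =
      cos (n2%:R * a) * savg tf k1 n2 F w + - sin (n2%:R * a) * cavg tf k1 n2 F w.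
  by move=> w0; rewrite mulNr; exact: savg_rot.
have r1 := rC _ F (@cos_mul_continuous R n1) sF eC.
have r2 := rC _ F (@sin_mul_continuous R n1) sF eC.
have r3 := rS _ F (@cos_mul_continuous R n1) sF eS.
have r4 := rS _ F (@sin_mul_continuous R n1) sF eS.
rewrite -!/(cavg tf k0 n1 _) -!/(savg tf k0 n1 _) in r1 r2 r3 r4.
rewrite !e /piece /copiece r1 r2 r3 r4.
move: (cavg _ _ _ _ _) (savg _ _ _ _ _) (cavg _ _ _ (savg _ _ _ _) _) (savg _ _ _ (cavg _ _ _ _) _).
move=> x1 x2 x3 x4; move: (sgnb b) bb (cos _) (sin _) => s ss y z.
split.
  transitivity (y * (x1 - s * x2) + z * (s * x4 + s * s * x3)); last by ring.
  by rewrite ss; ring.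
transitivity (y * (x4 + s * x3) - z * (s * x1 - s * s * x2)); last by ring.
by rewrite ss; ring.
Qed.

Lemma avg_sum k c (I : Type) (r : seq I) (al : I -> R) (G : I -> 'rV[R]_N -> R) v :
  continuous c -> (forall i, smooth U0 (G i)) -> v != 0 ->
  avg tf k c (fun w => \sum_(i <- r) al i * G i w) v = \sum_(i <- r) al i * avg tf k c (G i) v.
Proof.
move=> cc sG v0; rewrite /avg.
have ci i : continuous (fun a => al i * (c a * G i (v *m rot tf k a))).
  apply: continuous_mul; first exact: cst_continuous.
  exact: (kernel_continuous2 (k := k) cc (sG i) v0).
transitivity (mean (fun a => \sum_(i <- r) al i * (c a * G i (v *m rot tf k a)))).
  congr mean; apply/funext => a; rewrite mulr_sumr.
  by apply: eq_bigr => i _; rewrite mulrCA.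
rewrite mean_sum //; apply: eq_bigr => i _; rewrite meanZ //.
exact: (kernel_continuous2 (k := k) cc (sG i) v0).
Qed.

Definition smoothing k n F v := (mean (@bump R n))^-1 * avg tf k (@bump R n) F v.

Lemma eigen_smoothing ell lam k n F : eigen ell lam F -> eigen ell lam (smoothing k n F).
Proof. by move=> eF; apply: eigenZ; apply: eigen_avg => //; exact: bump_continuous. Qed.

Lemma smoothing_cvg k F v : smooth U0 F -> v != 0 -> smoothing k n F v @[n --> \oo] --> F v.
Proof.
move=> sF v0; have := @bump_approx R (fun a => F (v *m rot tf k a)).
rewrite rot0 mulmx1; apply => a.
apply: (@continuous_comp _ _ _ (fun a => v *m rot tf k a) F).
  exact: rot_continuous2.
by apply: (smooth_continuous sF); exact: rot_neq0.
Qed.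

(** The averages converge pointwise to the functions themselves as [n] grows, so
    [free_cvg] applies. *)
Lemma smoothing_free ell lam k q (F : 'I_q -> 'rV[R]_N -> R) :
  (forall i, eigen ell lam (F i)) -> free_on U0 F ->
  exists n, free_on U0 (fun i => smoothing k n (F i)).
Proof.
move=> eF fF; apply: (free_cvg (G := fun n i => smoothing k n (F i)) fF) => i v v0.
by apply: smoothing_cvg => //; case: (eF i).
Qed.

Lemma smoothing_trig k n : exists r : seq (R * nat), forall F v, smooth U0 F -> v != 0 ->
  smoothing k n F v = \sum_(p <- r) p.1 * cavg tf k p.2 F v.
Proof.
have [r er] := bump_trig R n.
exists [seq ((mean (@bump R n))^-1 * p.1, p.2) | p <- r] => F v sF v0.
rewrite big_map /= /smoothing.
have ci (p : R * nat) : continuous (fun a : R => p.1 * (cos (p.2%:R * a) * F (v *m rot tf k a))).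
  apply: continuous_mul; first exact: cst_continuous.
  exact: (kernel_continuous2 (k := k) (@cos_mul_continuous R p.2) sF v0).
have -> : avg tf k (@bump R n) F v = \sum_(p <- r) p.1 * cavg tf k p.2 F v.
  rewrite /avg; transitivity (mean (fun a : R => \sum_(p <- r) p.1 * (cos (p.2%:R * a) * F (v *m rot tf k a)))).
    congr mean; apply/funext => a; rewrite er mulr_suml.
    by apply: eq_bigr => p _; rewrite mulrA.
  rewrite mean_sum //; apply: eq_bigr => p _; rewrite meanZ //.
  exact: (kernel_continuous2 (k := k) (@cos_mul_continuous R p.2) sF v0).
by rewrite mulr_sumr; apply: eq_bigr => p _; rewrite mulrA.
Qed.

(** A product of two cosines is half the sum of the cosines of sum and
    difference. *)
Lemma smoothing2_pieces n1 n2 : exists S : seq (R * (bool * nat * nat)),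
  forall F v, smooth U0 F -> v != 0 -> smoothing k0 n1 (smoothing k1 n2 F) v =
    \sum_(p <- S) p.1 * piece p.2.1.1 p.2.1.2 p.2.2 F v.
Proof.
have [r1 e1] := smoothing_trig k0 n1; have [r2 e2] := smoothing_trig k1 n2.
exists ([seq (x.1 * y.1 / 2, (true, x.2, y.2)) | x <- r1, y <- r2] ++
        [seq (x.1 * y.1 / 2, (false, x.2, y.2)) | x <- r1, y <- r2]) => F v sF v0.
have ss n : smooth U0 (smoothing k1 n F).
  apply: (smoothM oU0); first exact: smooth_cst.
  by apply: avg_smooth => //; exact: bump_continuous.
rewrite e1 // big_cat /= !big_allpairs_dep /= -big_split /=; apply: eq_bigr => x _.
rewrite /cavg (@eq_avg _ _ tf k0 _ (smoothing k1 n2 F)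
  (fun w => \sum_(y <- r2) y.1 * cavg tf k1 y.2 F w) v v0); last first.
  by move=> w w0; rewrite e2.
rewrite avg_sum //; last 2 first.
- exact: cos_mul_continuous.
- by move=> y; exact: cavg_smooth.
rewrite mulr_sumr -big_split /=; apply: eq_bigr => y _.
rewrite -/(cavg tf k0 x.2 _) /piece /sgnb.
by move: (cavg _ _ _ _ _) (savg _ _ _ _ _) => z1 z2; field.
Qed.

Lemma isotypic_rot2 mu F G v a b : isotypic tf mu F G -> v != 0 ->
  F (v *m rot tf k0 a *m rot tf k1 b) =
    cos (mu k0 * a + mu k1 * b) * F v + sin (mu k0 * a + mu k1 * b) * G v.
Proof.
move=> FG v0.
rewrite (FG k1 b _ (rot_neq0 tf k0 a v0)).1 (FG k0 a v v0).1 (FG k0 a v v0).2.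
by rewrite cosD sinD; ring.
Qed.

Lemma isotypic_rot2_sum mu F G v a b : isotypic tf mu F G -> v != 0 ->
  F (v *m rot tf k0 a *m rot tf k1 b) + F (v *m rot tf k0 (- a) *m rot tf k1 (- b)) =
    2 * cos (mu k0 * a + mu k1 * b) * F v.
Proof.
move=> FG v0; rewrite !(isotypic_rot2 _ _ FG) // !mulrN -opprD cosN sinN; ring.
Qed.

Lemma commute_rot O k a : (forall l, O *m K l = K l *m O) ->
  O *m rot tf k a = rot tf k a *m O.
Proof.
move=> OK; have OP : O *m tP tf k = tP tf k *m O.
  by apply: oppr_inj; rewrite -mulmxN -mulNmx -tKK mulmxA OK -mulmxA OK mulmxA.
by rewrite /rot !mulmxDr !mulmxDl mulmx1 mul1mx -!scalemxAl -!scalemxAr OP OK.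
Qed.

Lemma isotypic_mulmx O mu F G : orthogonal_mx O -> (forall k, O *m K k = K k *m O) ->
  isotypic tf mu F G -> isotypic tf mu (fun v => F (v *m O)) (fun v => G (v *m O)).
Proof.
move=> oO OK FG k a v v0.
have [e1 e2] := FG k a (v *m O) (orthogonal_neq0 oO v0).
by rewrite -mulmxA -commute_rot // mulmxA e1 e2.
Qed.

(** On functions of weight [mu] both operators are given by [weight_op], for the
    two weighted fields, and composition with [O] carries one field to the
    other. *)
Lemma eigen_transplant ell ell' lam O mu F G : orthogonal_mx O ->
  (forall k, O *m K k = K k *m O) ->
  (forall w, weighted ell' mu w = weighted ell mu (w *m O) *m O^T) ->
  isotypic tf mu F G -> eigen ell lam F -> smooth U0 G ->
  eigen ell' lam (fun v => F (v *m O)).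
Proof.
move=> oO OK EW FG [sF hF eF] sG; split.
- exact: smooth_mulmx.
- by move=> t v t0 v0; rewrite -scalemxAl hF //; exact: orthogonal_neq0.
move=> v v0; have v0' := orthogonal_neq0 oO v0.
have sFO := smooth_mulmx oO sF; have sGO := smooth_mulmx oO sG.
have iO := isotypic_mulmx oO OK FG.
rewrite (Lop_isotypic ell' sFO sGO iO v0) -eF // (Lop_isotypic ell sF sG FG v0').
apply: (congr1 (fun x => - x)).
apply: (weight_op_mulmx (X := weighted ell mu) (Y := weighted ell' mu) oO _ EW sF sG v0).
exact: smooth_weighted.
Qed.

(** The functions G are the sums of the weight components of averages of the F,
    each composed with the orthogonal map of its weight.  They are eigenfunctions
    by [eigen_transplant].  To see that they are independent, apply
    [separate_eigenvalues] to a linear relation, with a rotation of the torus that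
    distinguishes the occurring weights up to sign.  Within one weight the same
    map was applied to all components, and undoing it yields the relation for the
    averages of the F, which are independent. *)
Lemma transplant ell ell' (O : ('I_2 -> R) -> 'M[R]_N) lam q (F : 'I_q -> 'rV[R]_N -> R) :
  (forall mu, orthogonal_mx (O mu)) ->
  (forall mu k, O mu *m K k = K k *m O mu) ->
  (forall mu, O (fun k => - mu k) = O mu) ->
  (forall mu w, weighted ell' mu w = weighted ell mu (w *m O mu) *m (O mu)^T) ->
  (forall i, eigen ell lam (F i)) -> free_on U0 F ->
  exists G : 'I_q -> 'rV[R]_N -> R, (forall i, eigen ell' lam (G i)) /\ free_on U0 G.
Proof.
move=> oO OK ON EW eF fF.
have [n2 f2] := smoothing_free k1 eF fF.
have e2 i := eigen_smoothing k1 n2 (eF i).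
have [n1 f1] := smoothing_free k0 e2 f2.
have [S eS] := smoothing2_pieces n1 n2.
pose T := (R * (bool * nat * nat))%type.
pose mu (p : T) := weight p.2.1.1 p.2.1.2 p.2.2.
pose pc (p : T) i v := p.1 * piece p.2.1.1 p.2.1.2 p.2.2 (F i) v.
have sF i : smooth U0 (F i) by case: (eF i).
have ePc (p : T) i : eigen ell' lam (fun v => pc p i (v *m O (mu p))).
  apply: eigenZ.
  apply: (eigen_transplant (oO (mu p)) (OK (mu p)) (EW (mu p)) (isotypic_piece _ _ _ (sF i))).
    exact: eigen_piece.
  by case: (eigen_copiece p.2.1.1 p.2.1.2 p.2.2 (eF i)).
exists (fun i v => \sum_(p <- S) pc p i (v *m O (mu p))); split.
  by move=> i; apply: eigen_sum.
move=> c Hc; apply: f1 => v v0.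
pose H (p : T) v := \sum_i c i * pc p i v.
have HO0 w : U0 w -> \sum_(p <- S) H p (w *m O (mu p)) = 0.
  move=> w0; rewrite exchange_big /= -[RHS](Hc w w0); apply: eq_bigr => i _.
  by rewrite mulr_sumr.
suff : \sum_(p <- S) H p v = 0.
  move=> e; rewrite -[RHS]e [RHS]exchange_big /=; apply: eq_bigr => i _.
  by rewrite eS // mulr_sumr.
(* Rotation by a and b = B a in the two circles acts on a function of weight
   mu p through the angle (dd p) a.  With B > 2 M the integer dd p determines the
   weight, and |dd p| a < 1 <= pi makes its cosine determine dd p up to sign. *)
have [M HM] : exists M : nat, forall p : T, p \in S -> (p.2.1.2 <= M)%N && (p.2.2 <= M)%N.
  exists (\sum_(p <- S) (p.2.1.2 + p.2.2))%N => p pS.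
  have : (p.2.1.2 + p.2.2 <= \sum_(p <- S) (p.2.1.2 + p.2.2))%N.
    by rewrite (big_rem p) //= leq_addr.
  by lia.
pose B : nat := (2 * M).+1.
pose D : nat := (M + B * M)%N.
pose a : R := D.+1%:R^-1.
pose b : R := B%:R * a.
pose th (p : T) := cos (mu p k0 * a + mu p k1 * b).
pose dd (p : T) : int := p.2.1.2%:Z + B%:Z * ((if p.2.1.1 then 1 else -1) * p.2.2%:Z).
have thE p : th p = cos ((dd p)%:~R * a).
  rewrite /th /mu /weight /= /b /dd; congr cos.
  rewrite mulrA -mulrDl; congr (_ * a).
  rewrite rmorphD !rmorphM /= /sgnb; case: (p.2.1.1) => /=; ring.
have a0 : 0 < a by rewrite invr_gt0 ltr0n.
have th_inj (p q' : T) : p \in S -> q' \in S -> th p = th q' -> O (mu p) = O (mu q').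
  move=> /HM/andP[p1 p2] /HM/andP[q1 q2].
  have cosn (x : R) : cos x = cos `|x| by case: (ger0P x) => // _; rewrite cosN.
  have inI r : (r.2.1.2 <= M)%N -> (r.2.2 <= M)%N -> `|(dd r)%:~R * a| \in `[0, pi]%R.
    move=> r1 r2; rewrite in_itv /= normr_ge0 /= normrM (gtr0_norm a0).
    apply: (@le_trans _ _ 1); last by apply: le_trans (pi_ge2 R); rewrite ler1n.
    rewrite ler_pdivrMr ?ltr0n // mul1r -intr_norm -[leRHS]/((D.+1 : int)%:~R) ler_int.
    by rewrite /dd /D /B; case: (r.2.1.1); nia.
  rewrite !thE cosn [RHS]cosn => /(cos_inj (inI p p1 p2) (inI q' q1 q2)).
  rewrite !normrM (gtr0_norm a0) => /(mulIf (lt0r_neq0 a0)); rewrite -!intr_norm.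
  move=> /(intr_inj) edd.
  have [epq|epq] : dd p = dd q' \/ dd p = - dd q' by lia.
  - congr O; apply/funext => k; rewrite /mu /weight /sgnb.
    have [/eqP + h2] : p.2.1.2%:Z = q'.2.1.2%:Z /\
       (if p.2.1.1 then 1 else -1) * p.2.2%:Z = (if q'.2.1.1 then 1 else -1) * q'.2.2%:Z :> int.
      by apply: (digits_inj epq); rewrite /B; lia.
    rewrite eqz_nat => /eqP h1.
    case: ifP => _; first by rewrite h1.
    by move: h2 => /(congr1 (fun z : int => z%:~R : R)); rewrite !rmorphM /=;
      case: (p.2.1.1); case: (q'.2.1.1).
  - rewrite -ON; congr O; apply/funext => k; rewrite /mu /weight /sgnb.
    have [h1 h2] : p.2.1.2%:Z = - q'.2.1.2%:Z /\
       (if p.2.1.1 then 1 else -1) * p.2.2%:Z = - ((if q'.2.1.1 then 1 else -1) * q'.2.2%:Z) :> int.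
      apply: (@digits_inj B%:Z); [|rewrite /B; lia..].
      by move: epq; rewrite /dd opprD mulrN.
    case: ifP => _.
      by move: h1 => /(congr1 (fun z : int => z%:~R : R)); rewrite rmorphN /= -!pmulrn => ->; rewrite opprK.
    by move: h2 => /(congr1 (fun z : int => z%:~R : R)); rewrite rmorphN !rmorphM /= -!pmulrn;
      case: (p.2.1.1); case: (q'.2.1.1) => /= ->; rewrite opprK.
pose W w := w *m rot tf k0 a *m rot tf k1 b.
pose W' w := w *m rot tf k0 (- a) *m rot tf k1 (- b).
have sep := @separate_eigenvalues R _ U0 T S th (fun p w => H p (w *m O (mu p))) W W'.
have h1 w : U0 w -> U0 (W w) /\ U0 (W' w).
  by move=> w0; split; apply: rot_neq0; exact: rot_neq0.
have h2 p w : U0 w -> H p (W w *m O (mu p)) + H p (W' w *m O (mu p)) = 2 * th p * H p (w *m O (mu p)).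
  move=> w0; rewrite /H mulr_sumr -big_split /=; apply: eq_bigr => i _.
  have iso := isotypic_mulmx (oO (mu p)) (OK (mu p)) (isotypic_piece p.2.1.1 p.2.1.2 p.2.2 (sF i)).
  have := isotypic_rot2_sum a b iso w0; rewrite /pc -/(W w) -/(W' w) -/(mu p) -/(th p) => e.
  rewrite -!mulrDr e; move: (piece _ _ _ _ _) (th p) (c i) => y1 y2 y3; ring.
have {}sep t x (x0 : U0 x) := sep h1 h2 HO0 t x x0.
rewrite (sum_fibers S th (fun p => H p v)); apply: big1 => t _.
have [/hasP[p0 p0S /eqP p0t]|/hasPn nS] := boolP (has (fun p => th p == t) S); last first.
  rewrite (@eq_sum_seq _ T S (fun p => th p == t) (fun p => H p v) (fun=> 0)) ?big1 //.
  by move=> p pS pt; have := nS p pS; rewrite pt.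
have vO : v *m (O (mu p0))^T != 0.
  by apply: orthogonal_neq0 => //; apply: orthogonal_tr.
apply: etrans (sep t _ vO); apply: eq_sum_seq => p pS /eqP pt.
have eO : O (mu p) = O (mu p0) by apply: th_inj => //; rewrite pt p0t.
by rewrite eO -mulmxA (orthogonal_mxV (oO (mu p0))) mulmx1.
Qed.

End Transplant.

(** * Affine charts of the sphere *)

Section RadialCalculus.
Variables (R : realType) (N : nat).
Local Notation U0 := (@punctured R N).
Local Notation oU0 := (@punctured_open R N).
Implicit Types v w : 'rV[R]_N.

Definition inv_norm v : R := (Num.sqrt (dot v v))^-1.

Lemma inv_norm_gt0 v : v != 0 -> 0 < inv_norm v.
Proof. by move=> v0; rewrite invr_gt0 sqrtr_gt0 dot_gt0. Qed.

Lemma inv_norm2 v : inv_norm v ^+ 2 = (dot v v)^-1.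
Proof. by rewrite exprVn sqr_sqrtr // dot_ge0. Qed.

Lemma derive_r2 v w : 'D_w (fun x => dot x x) v = 2 * dot v w.
Proof.
rewrite (@derive_rV _ _ setT) //; last 2 first.
- exact: openT.
- apply: Ck_sum => [|i]; first exact: openT.
  by apply: CkM; [exact: openT|exact: Ck_coord..].
rewrite [in RHS]/dot mulr_sumr; apply: eq_bigr => i _.
have dc j : derivable (fun x : 'rV[R]_N => x 0 j) v (delta_mx 0 i).
  by apply: diff_derivable; exact: differentiable_coord.
have -> : (fun x => dot x x) = \sum_j (fun x : 'rV[R]_N => x 0 j) * (fun x => x 0 j).
  by apply/funext => x; rewrite fct_sumE.
rewrite derive_sum => [|j]; last exact: derivableM.
rewrite (bigD1 i) //= big1 ?addr0 => [|j ji]; last first.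
  by rewrite deriveM // !derive_coordE mxE eqxx (negbTE ji) !scaler0 addr0.
by rewrite deriveM // !derive_coordE mxE !eqxx /= [_ *: _]mulr1; ring.
Qed.

Lemma derive_inv (V : normedModType R) (f : V -> R) (x y : V) (a : R) :
  f x != 0 -> derivable f x y -> 'D_y f x = a ->
  'D_y (fun z => (f z)^-1) x = - (a * (f x)^-1 ^+ 2).
Proof. by move=> f0 df <-; rewrite deriveV // [LHS]mulNr exprVn mulrC. Qed.

Lemma is_derive_inv_norm v w : v != 0 ->
  differentiable inv_norm v /\ 'D_w inv_norm v = - (dot v w * inv_norm v ^+ 3).
Proof.
move=> v0; have v2 := dot_gt0 v0.
have [dS eS] := is_derive1_sqrt v2.
have dr : differentiable (fun x : 'rV[R]_N => dot x x) v.
  exact: (smooth_differentiable oU0 (@smooth_r2 R N) v0).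
have dS' : differentiable (@Num.sqrt R) (dot v v) by apply/derivable1_diffP.
have dSr : differentiable (fun x : 'rV[R]_N => Num.sqrt (dot x x)) v.
  exact: (@differentiable_comp _ _ _ _ (fun x : 'rV[R]_N => dot x x) (@Num.sqrt R)).
have s0 : Num.sqrt (dot v v) != 0 by rewrite gt_eqF // sqrtr_gt0.
split; first exact: (differentiableV dSr).
have dSd : derivable (fun x : 'rV[R]_N => Num.sqrt (dot x x)) v w by exact: diff_derivable.
have e : 'D_w (fun x => Num.sqrt (dot x x)) v = dot v w / Num.sqrt (dot v v).
  have e1 := derive_comp w dr dS'.
  apply: etrans e1 _; rewrite derive_r2.
  have -> : 2 * dot v w = (2 * dot v w) *: (1 : R) by rewrite [RHS]mulr1.
  rewrite deriveE // linearZ /= -deriveE // eS [LHS]mulrC.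
  by move: s0; move: (Num.sqrt _) (dot v w) => a b a0; field.
have e2 := @derive_inv _ (fun x : 'rV[R]_N => Num.sqrt (dot x x)) v w _ s0 dSd e.
have eI : (fun z : 'rV[R]_N => (Num.sqrt (dot z z))^-1) = inv_norm by [].
rewrite eI in e2.
rewrite e2.
rewrite [in RHS]exprS.
by rewrite mulrA.
Qed.

End RadialCalculus.

Section SphereChart.
Variables (R : realType) (n : nat).
Local Notation N := n.+1.
Implicit Types (k : 'I_N) (u v : 'rV[R]_n) (x : sphere R n).

Lemma sqnormE (y : 'rV[R]_N) : sqnorm y = dot y y.
Proof. by apply: eq_bigr => i _; rewrite expr2. Qed.

(** The linear part of the affine map [homog k]. *)
Definition hlift k v : 'rV[R]_N := \row_i oapp (v 0) 0 (unlift k i).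

Lemma homog_add k u v (t : R) : homog k (t *: v + u) = t *: hlift k v + homog k u.
Proof.
apply/rowP => i; rewrite !mxE; case: unliftP => [j _|_] /=; first by rewrite !mxE.
by rewrite mulr0 add0r.
Qed.

Lemma derive_homog (V : normedModType R) (F : 'rV[R]_N -> V) k u v :
  'D_v (fun w => F (homog k w)) u = 'D_(hlift k v) F (homog k u).
Proof.
rewrite /derive; under [X in lim (X @ _) = _]eq_fun do
  rewrite /= homog_add.
by [].
Qed.

Lemma homog_neq0 k u : homog k u != 0.
Proof. by rewrite -dot_eq0 -sqnormE gt_eqF // sqnorm_homog. Qed.

Lemma smooth_homog U k i : smooth U (fun u : 'rV[R]_n => homog k u 0 i).
Proof. by move=> r; exact: Ck_homog. Qed.

Lemma smooth_homog_comp (F : 'rV[R]_N -> R) k : smooth (@punctured R N) F ->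
  smooth setT (fun u => F (homog k u)).
Proof.
move=> sF; apply: (@smooth_comp _ _ _ _ (@punctured R N) (homog k)) sF.
- exact: openT.
- exact: punctured_open.
- by move=> u _; exact: homog_neq0.
- by move=> i; exact: smooth_homog.
Qed.

Lemma hlift_delta k i : hlift k (delta_mx 0 i) = delta_mx 0 (lift k i).
Proof.
apply/rowP => a; rewrite !mxE /=; case: unliftP => [j ->|->] /=.
  by rewrite !mxE /= (inj_eq lift_inj).
by rewrite (negbTE (neq_lift _ _)).
Qed.

Lemma hlift_lift k v i : hlift k v 0 (lift k i) = v 0 i.
Proof. by rewrite mxE liftK. Qed.

Lemma hlift_pivot k v : hlift k v 0 k = 0.
Proof. by rewrite mxE unlift_none. Qed.

(** The point of the unit sphere on the line through [homog k u], with the sign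
    [s] of its k-th coordinate. *)
Definition chart_point (s : R) k u : 'rV[R]_N := (s * inv_norm (homog k u)) *: homog k u.

Lemma sphere_paramE x u : val (sphere_param x u) =
  chart_point (Num.sg (val x 0 (pivot (val x)))) (pivot (val x)) u.
Proof. by rewrite /= /sphere_scale sqnormE. Qed.

Definition chart_frame (s : R) k u v : 'rV[R]_N :=
  (s * inv_norm (homog k u)) *: (hlift k v
    - (dot (homog k u) (hlift k v) / dot (homog k u) (homog k u)) *: homog k u).

Lemma differentiable_homog k u : differentiable (homog k : 'rV[R]_n -> 'rV[R]_N) u.
Proof.
apply: differentiable_rV => i.
exact: (smooth_differentiable (@openT _) (@smooth_homog setT k i)).
Qed.

Lemma differentiable_chart_point s k u : differentiable (chart_point s k) u.
Proof.
have dh := differentiable_homog k u.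
have [di _] := is_derive_inv_norm 0 (homog_neq0 k u).
apply: differentiable_rV => i.
rewrite (_ : (fun y => _) = (fun y => (cst s y * inv_norm (homog k y)) * homog k y 0 i)); last first.
  by apply/funext => y; rewrite mxE.
apply: differentiableM; first apply: differentiableM.
- exact: differentiable_cst.
- exact: (@differentiable_comp _ _ _ _ (homog k) (@inv_norm R N)).
- exact: differentiable_coord_rV.
Qed.

Lemma derive_chart_point s k u v : 'D_v (chart_point s k) u = chart_frame s k u v.
Proof.
have h0 := homog_neq0 k u.
have dh := differentiable_homog k u.
have [di ei] := is_derive_inv_norm (hlift k v) h0.
apply/rowP => i; rewrite (derive_coord _ _ (differentiable_chart_point s k u)).
rewrite (_ : (fun y => _) = (fun w => (s *: (fun z => inv_norm z * z 0 i)) (homog k w))); last first.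
  by apply/funext => y; rewrite mxE [RHS]mulrA.
rewrite derive_homog.
have d1 : derivable (@inv_norm R N) (homog k u) (hlift k v) by exact: diff_derivable.
have d2 : derivable (fun z : 'rV[R]_N => z 0 i) (homog k u) (hlift k v).
  by apply: diff_derivable; exact: differentiable_coord.
rewrite (deriveZ s (derivableM d1 d2)) (deriveM d1 d2) derive_coordE ei /chart_frame !mxE exprS inv_norm2.
move: (inv_norm _) (dot _ (hlift _ _)) (dot _ _)^-1 (homog k u 0 i) (oapp _ _ _) => a b c d e.
rewrite /GRing.scale /=; ring.
Qed.

(** The chart around [g p] followed by its inverse is the identity near [g p], so
    the velocity of [g] read in that chart and pushed to the ambient space is the
    ambient velocity. *)
Lemma embed_vector_curve (V : normedModType R) (g : V -> sphere R n) (p v : V) :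
  differentiable (fun q => val (g q)) p ->
  'D_('D_v (fun q => sphere_coord (g p) (g q)) p) (fun u => val (sphere_param (g p) u))
     (sphere_coord (g p) (g p)) = 'D_v (fun q => val (g q)) p.
Proof.
set x := g p; set k := pivot (val x) => dg.
have xk : val x 0 k != 0 by exact: pivotP.
have dgk i : differentiable (fun q => val (g q) 0 i) p by exact: differentiable_coord_rV.
have dc : differentiable (fun q => sphere_coord x (g q)) p.
  apply: differentiable_rV => i.
  rewrite (_ : (fun y => _) = (fun q => val (g q) 0 (lift k i) * (val (g q) 0 k)^-1)); last first.
    by apply/funext => y; rewrite mxE.
  by apply: differentiableM => //; exact: differentiableV.
have dp : differentiable (fun u => val (sphere_param x u)) (sphere_coord x x).
  rewrite (_ : (fun u => _) = chart_point (Num.sg (val x 0 k)) k); last first.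
    by apply/funext => u; rewrite sphere_paramE.
  exact: differentiable_chart_point.
rewrite -(derive_comp v dc dp); apply: near_eq_derive.
have cgk : {for p, continuous (fun q => val x 0 k * val (g q) 0 k)}.
  apply: continuousM; first exact: cst_continuous.
  exact: differentiable_continuous.
have : \forall q \near p, 0 < val x 0 k * val (g q) 0 k.
  apply: (cgk [set t | 0 < t]); apply: open_nbhs_nbhs; split; first exact: open_gt.
  by rewrite /= -expr2 exprn_even_gt0.
by apply: filterS => q q0; exact: (congr1 val (sphere_param_affine q0)).
Qed.

End SphereChart.

(** * Volume and gradient of the twisted metric in affine charts *)

(** Both determinants are that of the block matrix with rows (1, - B) and (A, 1),
    factored in two ways. *)
Lemma det_one_add (F : comUnitRingType) p q (A : 'M[F]_(p, q)) (B : 'M[F]_(q, p)) :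
  \det (1%:M + A *m B) = \det (1%:M + B *m A).
Proof.
have e : block_mx (1%:M : 'M[F]_q) 0 A 1%:M *m block_mx 1%:M (- B) 0 (1%:M + A *m B) =
         block_mx 1%:M (- B) 0 1%:M *m block_mx (1%:M + B *m A) 0 A (1%:M : 'M[F]_p).
  rewrite !mulmx_block !(mul1mx, mulmx1, mul0mx, mulmx0, addr0, add0r).
  by rewrite mulNmx addrK mulmxN addrCA addNr addr0.
have /(congr1 determinant) := e; rewrite !det_mulmx !det_lblock !det_ublock !det1.
by rewrite !mul1r !mulr1.
Qed.

Section Frame.
Variables (R : realType) (n : nat).
Local Notation N := n.+1.
Variables (tf : torus_frame R N) (ell : hfield tf).
Local Notation K := (tK tf).
Local Notation U0 := (@punctured R N).
Local Notation oU0 := (@punctured_open R N).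
Local Notation e_ i := (delta_mx 0 i : 'rV[R]_N).
Implicit Types (F G : 'rV[R]_N -> R) (v w h : 'rV[R]_N) (u : 'rV[R]_n).

(** The twist applied to the part of [w] orthogonal to [v], made homogeneous of
    degree 0 in [v]. *)
Definition twist_tangent v w : 'rV[R]_N := w - (dot v w / dot v v) *: v
  + (dot v v)^-1 ^+ 2 *: \sum_k (dot (ell k v) w *: (v *m K k)).

Lemma dot_tK v (k : 'I_2) : dot v (v *m K k) = 0.
Proof.
have := dot_mulmx v v (K k); rewrite tK_tr mulmxN dotNr dotC => /eqP.
by rewrite -addr_eq0 -mulr2n mulrn_eq0 /= => /eqP.
Qed.

Lemma dot_twist_tangent v w : v != 0 -> dot v (twist_tangent v w) = 0.
Proof.
move=> v0; have r0 : dot v v != 0 by rewrite dot_eq0.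
rewrite /twist_tangent dotDr dotBr !dotZr dot_sumr big1 => [|k _]; last by rewrite dotZr dot_tK mulr0.
by rewrite mulr0 addr0 divfK // subrr.
Qed.

Lemma twist_tangent_lin v (a : R) w x : twist_tangent v (a *: w + x) = a *: twist_tangent v w + twist_tangent v x.
Proof.
apply/rowP => i; rewrite !mxE !summxE !dotDr !dotZr.
rewrite (eq_bigr (fun k => a * (dot (ell k v) w *: (v *m K k)) 0 i +
  (dot (ell k v) x *: (v *m K k)) 0 i)); last first.
  by move=> k _; rewrite !mxE dotDr dotZr; ring.
rewrite big_split -mulr_sumr /=; ring.
Qed.

Lemma twist_tangent_self v : v != 0 -> twist_tangent v v = 0.
Proof.
move=> v0; have r0 : dot v v != 0 by rewrite dot_eq0.
rewrite /twist_tangent divff // scale1r subrr add0r big1 ?scaler0 // => k _.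
by rewrite hf_radial scale0r.
Qed.

Lemma twist_tangent0 v : twist_tangent v 0 = 0.
Proof.
rewrite /twist_tangent dot0r mul0r scale0r subr0 add0r big1 ?scaler0 // => k _.
by rewrite dot0r scale0r.
Qed.

Lemma twist_tangent_sum v (I : Type) (r : seq I) (c : I -> R) (w : I -> 'rV[R]_N) :
  twist_tangent v (\sum_(i <- r) c i *: w i) = \sum_(i <- r) c i *: twist_tangent v (w i).
Proof.
elim: r => [|i r IH]; first by rewrite !big_nil twist_tangent0.
by rewrite !big_cons twist_tangent_lin IH.
Qed.

Lemma twist_tangentE v w : dot v w = 0 ->
  twist_tangent v w = w + (dot v v)^-1 ^+ 2 *: \sum_k (dot (ell k v) w *: (v *m K k)).
Proof. by move=> e; rewrite /twist_tangent e mul0r scale0r subr0. Qed.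

Lemma smooth_twist_tangent w i : smooth U0 (fun v => twist_tangent v w 0 i).
Proof.
apply: (eq_smooth oU0 (f := fun v => w 0 i - dot v w * (dot v v)^-1 * v 0 i
   + (dot v v)^-1 ^+ 2 * \sum_k (dot (ell k v) w * (v *m K k) 0 i))).
  move=> v _; rewrite !mxE summxE; congr (_ - _ + _ * _).
  by apply: eq_bigr => k _; rewrite [RHS]mxE.
have sw j : smooth U0 (fun _ : 'rV[R]_N => w 0 j) by exact: smooth_cst.
have sr := @smooth_r2V R N.
apply: (smoothD oU0); first apply: (smoothB oU0) => //.
- apply: (smoothM oU0); last exact: smooth_coord.
  by apply: (smoothM oU0) => //; apply: smooth_dot => // j; exact: smooth_coord.
- apply: (smoothM oU0); first exact: (smoothX oU0).
  apply: (smooth_sum oU0) => k; apply: (smoothM oU0); last exact: smooth_vmul.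
  by apply: smooth_dot => // j; exact: hf_smooth.
Qed.

(** The factor [(dot v v)^-1] comes from the radial projection to the unit
    sphere. *)
Definition chart_gram (k : 'I_N) v : 'M[R]_n := \matrix_(i, j) ((dot v v)^-1 *
  dot (twist_tangent v (e_ (lift k i))) (twist_tangent v (e_ (lift k j)))).

Lemma smooth_chart_gram (k : 'I_N) i j : smooth setT (fun u => chart_gram k (homog k u) i j).
Proof.
apply: (eq_smooth (@openT _) (f := fun u => (fun v => (dot v v)^-1 *
  dot (twist_tangent v (e_ (lift k i))) (twist_tangent v (e_ (lift k j)))) (homog k u))).
  by move=> u _; rewrite mxE.
apply: (@smooth_homog_comp _ _ (fun v => (dot v v)^-1 *
  dot (twist_tangent v (e_ (lift k i))) (twist_tangent v (e_ (lift k j))))).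
apply: (smoothM oU0); first exact: smooth_r2V.
by apply: smooth_dot => l; exact: smooth_twist_tangent.
Qed.

(** The twist on all of R^N, the identity plus an endomorphism of square 0. *)
Definition shear v : 'M[R]_N := 1%:M +
  (\matrix_(a, k) ((dot v v)^-1 ^+ 2 * ell k v 0 a)) *m (\matrix_(k, b) (v *m K k) 0 b).

Lemma mul_shear v w : w *m shear v = w +
  (dot v v)^-1 ^+ 2 *: \sum_k (dot (ell k v) w *: (v *m K k)).
Proof.
rewrite /shear mulmxDr mulmx1; congr (_ + _); rewrite mulmxA.
apply/rowP => b; rewrite !mxE summxE mulr_sumr; apply: eq_bigr => k _.
rewrite !mxE [in RHS]mulrA; congr (_ * _); rewrite [in RHS]/dot mulr_sumr.
by apply: eq_bigr => a _; rewrite mxE; ring.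
Qed.

(** By [det_one_add] this is the determinant of the identity plus the 2 x 2 matrix
    of the scalar products of the ell_l with the orbit fields. *)
Lemma det_shear v : \det (shear v) = 1.
Proof.
rewrite /shear det_one_add (_ : _ *m _ = 0) ?addr0 ?det1 //.
apply/matrixP => k l; rewrite !mxE.
transitivity ((dot v v)^-1 ^+ 2 * dot (ell l v) (v *m K k)); last by rewrite hf_horiz mulr0.
rewrite mulr_sumr; apply: eq_bigr => a _; rewrite [X in X * _]mxE [X in _ * X]mxE.
by rewrite mulrCA; congr (_ * _); rewrite mulrC.
Qed.

(** The twist does not change the determinant, which is therefore the one of the
    round metric.  The tangent frame is completed by the radial vector [h], which
    is orthogonal to it and contributes the factor [dot h h]; up to row operations
    the completed frame is the shear of a unitriangular matrix. *)
Lemma det_chart_gram (k : 'I_N) u : \det (chart_gram k (homog k u)) = (dot (homog k u) (homog k u))^-1 ^+ N.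
Proof.
set h := homog k u.
have h0 : h != 0 by exact: homog_neq0.
have r0 : dot h h != 0 by rewrite dot_eq0.
have hk : h 0 k = 1 by exact: homog_pivot.
pose row_of (f : 'I_n -> 'rV[R]_N) (g : 'rV[R]_N) : 'M[R]_N :=
  \matrix_(a, b) (if unlift k a is Some i then f i 0 b else g 0 b).
pose M := row_of (fun i => twist_tangent h (e_ (lift k i))) h.
pose T1 := row_of (fun i => e_ (lift k i)) h.
pose E1 : 'M[R]_N := row_of (fun i => e_ (lift k i) - (dot h (e_ (lift k i)) / dot h h) *: e_ k) (e_ k).
have rowE1 f g a : row a (row_of f g) = if unlift k a is Some i then f i else g.
  by apply/rowP => b; rewrite !mxE; case: unliftP.
have ET : M = E1 *m T1 *m shear h.
  apply/row_matrixP => a; rewrite -mulmxA !row_mul !rowE1.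
  have rT (w : 'rV[R]_N) : w *m T1 = \sum_b w 0 b *: row b T1 by rewrite mulmx_sum_row.
  have eT b : e_ b *m T1 = row b T1 by rewrite -rowE.
  case: unliftP => [i ai|ak].
    rewrite mulmxA mulmxBl -scalemxAl !eT !rowE1 liftK unlift_none mul_shear.
    rewrite /twist_tangent; congr (_ + _ *: _); apply: eq_bigr => l _.
    by rewrite dotBr dotZr hf_radial mulr0 subr0.
  rewrite mulmxA eT rowE1 unlift_none mul_shear big1 ?scaler0 ?addr0 // => l _.
  by rewrite hf_radial scale0r.
have entry f g a b : row_of f g a b = if unlift k a is Some i then f i 0 b else g 0 b.
  by rewrite mxE.
have dE : \det E1 = 1.
  rewrite (expand_det_row _ k) (bigD1 k) //= big1 ?addr0 => [|b bk]; last first.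
    by rewrite entry unlift_none mxE (negbTE bk) andbF mul0r.
  rewrite entry unlift_none mxE !eqxx mul1r /cofactor addnn -signr_odd odd_double mul1r.
  rewrite (_ : row' k (col' k E1) = 1%:M) ?det1 //.
  apply/matrixP => i j; rewrite [LHS]mxE [LHS]mxE entry liftK !mxE /= (inj_eq lift_inj) eq_sym.
  by rewrite [lift k j == k]eq_sym (negbTE (neq_lift _ _)) mulr0 subr0.
have dT : \det T1 = 1.
  rewrite (expand_det_col _ k) (bigD1 k) //= big1 ?addr0 => [|b bk]; last first.
    rewrite entry; case: unliftP bk => [i ->|->]; last by rewrite eqxx.
    by rewrite mxE /= (negbTE (neq_lift _ _)) mul0r.
  rewrite entry unlift_none hk mul1r /cofactor addnn -signr_odd odd_double mul1r.
  rewrite (_ : row' k (col' k T1) = 1%:M) ?det1 //.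
  by apply/matrixP => i j; rewrite [LHS]mxE [LHS]mxE entry liftK !mxE /= (inj_eq lift_inj) eq_sym.
have dM : \det M = 1 by rewrite ET !det_mulmx dE dT det_shear !mulr1.
pose A : 'M[R]_n := \matrix_(i, j) dot (twist_tangent h (e_ (lift k i))) (twist_tangent h (e_ (lift k j))).
have MM a b : (M *m M^T) a b = dot (row a M) (row b M).
  by rewrite mxE; apply: eq_bigr => c _; rewrite !mxE.
have dMM : \det (M *m M^T) = dot h h * \det A.
  rewrite (expand_det_row _ k) (bigD1 k) //= big1 ?addr0 => [|b bk]; last first.
    rewrite MM !rowE1 unlift_none; case: unliftP bk => [i ->|->]; last by rewrite eqxx.
    by rewrite dot_twist_tangent // mul0r.
  rewrite MM !rowE1 unlift_none; congr (_ * _).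
  rewrite /cofactor addnn -signr_odd odd_double mul1r; congr (\det _).
  by apply/matrixP => i j; rewrite [LHS]mxE [LHS]mxE MM !rowE1 !liftK mxE.
have dA : \det A = (dot h h)^-1.
  apply: (mulfI r0); rewrite -dMM det_mulmx det_tr dM mulr1 divff //.
rewrite (_ : chart_gram k h = (dot h h)^-1 *: A); last by apply/matrixP => i j; rewrite !mxE.
by rewrite detZ dA -exprSr.
Qed.

Lemma chart_gram_unit (k : 'I_N) u : chart_gram k (homog k u) \in unitmx.
Proof.
rewrite unitmxE det_chart_gram unitfE expf_neq0 // invr_eq0 dot_eq0.
exact: homog_neq0.
Qed.

Lemma sqrt_det_chart_gram (k : 'I_N) u : Num.sqrt (\det (chart_gram k (homog k u))) = inv_norm (homog k u) ^+ N.
Proof.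
rewrite det_chart_gram -inv_norm2 -exprM mulnC exprM sqrtr_sqr ger0_norm // exprn_ge0 // ltW //.
by apply: inv_norm_gt0; exact: homog_neq0.
Qed.

Lemma dot_flux F v : dot v (grad F v) = 0 -> dot v (flux ell F v) = 0.
Proof.
move=> g0; rewrite /flux /sharp dotDr dotBr !dotZr g0 mulr0 !dot_sumr.
rewrite big1 => [|k _]; last by rewrite dotDr !dotZr [dot v (ell k v)]dotC hf_radial dot_tK !mulr0 addr0.
rewrite big1 => [|k _]; last by rewrite dotZr dot_tK mulr0.
by rewrite !mulr0 subrr addr0.
Qed.

(** Applying the twist A to A^-1 (A^-1)^T g leaves (A^-1)^T g. *)
Lemma twist_tangent_flux F v : v != 0 -> dot v (grad F v) = 0 ->
  twist_tangent v (flux ell F v) =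
  dot v v *: grad F v - (dot v v)^-1 *: \sum_k (dot (v *m K k) (grad F v) *: ell k v).
Proof.
move=> v0 g0; have r0 : dot v v != 0 by rewrite dot_eq0.
have dl k : dot (ell k v) (flux ell F v) = dot v v * dot (ell k v) (grad F v)
    - (dot v v)^-1 * \sum_l dot (ell k v) (ell l v) * dot (v *m K l) (grad F v).
  rewrite /flux /sharp dotDr dotBr !dotZr !dot_sumr [X in _ + _ * X]big1 ?mulr0 ?addr0; last first.
    by move=> l _; rewrite dotZr hf_horiz mulr0.
  congr (_ - _ * _); apply: eq_bigr => l _.
  by rewrite dotDr !dotZr hf_horiz mulr0 addr0 mulrC.
rewrite twist_tangentE; last exact: dot_flux.
rewrite (eq_bigr (fun k => (dot v v * dot (ell k v) (grad F v) -
  (dot v v)^-1 * \sum_l dot (ell k v) (ell l v) * dot (v *m K l) (grad F v)) *: (v *m K k)));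
  last by move=> k _; rewrite dl.
apply/rowP => i; rewrite /flux /sharp !mxE !summxE.
rewrite -!addrA; congr (_ + _); rewrite !mulr_sumr -!sumrN -!big_split /=.
apply: eq_bigr => k _; rewrite !mxE.
move: (dot v v) r0 (\sum_l _) (dot (ell k v) _) (dot (v *m K k) _) ((v *m K k) 0 i) (ell k v 0 i).
by move=> r r0 s x y z t; field.
Qed.

(** The affine chart forgets multiples of [homog k u]; subtracting the right one
    removes the k-th component. *)
Lemma affine_components (k : 'I_N) u (X : 'rV[R]_N) :
  \sum_j (X 0 (lift k j) - u 0 j * X 0 k) *: e_ (lift k j) = X - X 0 k *: homog k u.
Proof.
apply/rowP => a; rewrite summxE [RHS]mxE [X in _ = _ + X]mxE [X in _ = _ - X]mxE.
have [j ->|->] := unliftP k a.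
  rewrite homog_lift (bigD1 j) //= big1 ?addr0 => [|c cb].
    by rewrite mxE mxE !eqxx mulr1 [u 0 j * _]mulrC.
  by rewrite mxE mxE (inj_eq lift_inj) eq_sym (negbTE cb) mulr0.
rewrite homog_pivot mulr1 subrr big1 // => c _; rewrite mxE mxE eqxx /=.
by rewrite (negbTE (neq_lift _ _)) mulr0.
Qed.

(** The chart components of the flux are those of the gradient for the twisted
    metric: paired with the i-th coordinate field they give the i-th partial
    derivative of F. *)
Lemma chart_gram_flux (k : 'I_N) u F : dot (homog k u) (grad F (homog k u)) = 0 ->
  chart_gram k (homog k u) *m (\col_j (flux ell F (homog k u) 0 (lift k j)
      - u 0 j * flux ell F (homog k u) 0 k)) =
  \col_i grad F (homog k u) 0 (lift k i).
Proof.
set h := homog k u => g0.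
have h0 : h != 0 by exact: homog_neq0.
have r0 : dot h h != 0 by rewrite dot_eq0.
have hk : h 0 k = 1 by exact: homog_pivot.
set X := flux ell F h.
apply/colP => i; rewrite [LHS]mxE [RHS]mxE.
have eX := affine_components k u X; rewrite -/h in eX.
transitivity ((dot h h)^-1 * dot (twist_tangent h (e_ (lift k i))) (twist_tangent h X)).
  have -> : twist_tangent h X = twist_tangent h (X - X 0 k *: h).
    rewrite [X - _]addrC -scaleNr twist_tangent_lin twist_tangent_self // scaler0 add0r //.
  rewrite -eX twist_tangent_sum dot_sumr mulr_sumr; apply: eq_bigr => j _.
  by rewrite [X in X * _]mxE [X in _ * X]mxE dotZr -mulrA; congr (_ * _); exact: mulrC.
rewrite twist_tangent_flux //; set g := grad F h in g0 *; set e := e_ (lift k i).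
set S := \sum_k0 _.
have dS w : dot w S = \sum_l dot (h *m K l) g * dot w (ell l h).
  by rewrite dot_sumr; apply: eq_bigr => l _; rewrite dotZr.
have hS : dot h S = 0.
  by rewrite dS big1 // => l _; rewrite [dot h (ell l h)]dotC hf_radial mulr0.
have zS l : dot (h *m K l) S = 0.
  by rewrite dS big1 // => l' _; rewrite [dot _ (ell _ _)]dotC hf_horiz mulr0.
rewrite /twist_tangent dotDl dotBl !dotZl dot_suml !dotBr !dotZr g0 hS mulr0 mulr0 subr0 mulr0 subr0.
rewrite (eq_bigr (fun l => dot h h * (dot (h *m K l) g * dot e (ell l h)))); last first.
  by move=> l _; rewrite dotZl dotBr !dotZr zS mulr0 subr0 [dot (ell l h) e]dotC; ring.
rewrite -mulr_sumr -dS dotC dot_delta.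
by move: (dot h h) r0 (dot e S) => r r0 y; field.
Qed.

End Frame.

(** * Homogeneity and the divergence in affine charts *)

Lemma exp_funE (R : realType) (T : Type) (f : T -> R) p :
  f ^+ p = (fun v => f v ^+ p).
Proof.
by apply/funext => v; elim: p => [|p IH]; rewrite ?expr0 // exprS [in RHS]exprS -IH.
Qed.

Section Homogeneity.
Variables (R : realType) (N : nat) (tf : torus_frame R N) (ell : hfield tf).
Local Notation K := (tK tf).
Local Notation U0 := (@punctured R N).
Local Notation oU0 := (@punctured_open R N).
Implicit Types (F : 'rV[R]_N -> R) (v w : 'rV[R]_N).

Lemma scale_neq0 (t : R) v : t != 0 -> v != 0 -> t *: v != 0.
Proof. by move=> t0 v0; rewrite scaler_eq0 negb_or t0. Qed.

Lemma derive_scale F (t : R) v w :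
  'D_w (fun x => F (t *: x)) v = 'D_(t *: w) F (t *: v).
Proof.
have := derive_mulmx F (t%:M) v w; rewrite !mul_mx_scalar => <-.
by congr ('D_w _ v); apply/funext => x; rewrite mul_mx_scalar.
Qed.

Lemma near0_1D : \forall t \near (0 : R), 1 + t != 0.
Proof.
have c : {for (0 : R), continuous (fun t : R => 1 + t)}.
  by apply: cvgD; [exact: cvg_cst|exact: cvg_id].
apply: (c [set t | t != 0]); apply: open_nbhs_nbhs; split; first exact: open_neq.
by rewrite /= addr0 oner_eq0.
Qed.

Lemma euler0 F v : smooth U0 F -> degree0 F -> v != 0 -> dot v (grad F v) = 0.
Proof.
move=> sF hF v0; rewrite -(derive_grad _ sF v0).
have -> : 'D_v F v = 'D_v F (v + (0 : R) *: v) by rewrite scale0r addr0.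
rewrite derive_along -[RHS](@derive_cst R R^o R^o (F v) 0 1).
apply: near_eq_derive; apply: filterS near0_1D => t t0.
by rewrite -[X in F (X + _)]scale1r -scalerDl hF.
Qed.

(** Euler's relation for a function of degree 1. *)
Lemma euler1 F v : (forall t w, t != 0 -> w != 0 -> F (t *: w) = t * F w) -> v != 0 ->
  'D_v F v = F v.
Proof.
move=> hF v0.
have -> : 'D_v F v = 'D_v F (v + (0 : R) *: v) by rewrite scale0r addr0.
rewrite derive_along.
have [d e] := is_deriveZ (F v) (is_deriveD (is_derive_cst (1 : R) 0 (1 : R)) (is_derive_id (0 : R) (1 : R))).
transitivity ('D_1 (F v *: (cst (1 : R) + id)) (0 : R)); last by rewrite e add0r [_ *: _]mulr1.
apply: near_eq_derive; apply: filterS near0_1D => t t0.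
by rewrite -[X in F (X + _)]scale1r -scalerDl hF // mulrC.
Qed.

Lemma derive_scale1 (f : 'rV[R]_N -> R) t v w : smooth U0 f -> t != 0 -> v != 0 ->
  (forall x, x != 0 -> f (t *: x) = t * f x) -> 'D_w f (t *: v) = 'D_w f v.
Proof.
move=> sf t0 v0 hf.
have e1 : 'D_w (fun x => f (t *: x)) v = t * 'D_w f v.
  have -> : t * 'D_w f v = 'D_w (t *: f) v.
    by rewrite deriveZ //; exact: (smooth_derivable oU0).
  exact: (@eq_derive _ _ _ oU0 (fun x => f (t *: x)) (t *: f)).
move: e1; rewrite derive_scale !(derive_grad _ sf) ?scale_neq0 // dotZl.
by move/(mulfI t0).
Qed.

Lemma grad_scale F t v : smooth U0 F -> degree0 F -> t != 0 -> v != 0 ->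
  grad F (t *: v) = t^-1 *: grad F v.
Proof.
move=> sF hF t0 v0; apply/rowP => i; rewrite !mxE.
have := derive_scale F t v (delta_mx 0 i).
rewrite (@eq_derive _ _ _ oU0 _ F) //; last by move=> w w0; exact: hF.
move=> ->; rewrite !(derive_grad _ sF) ?scale_neq0 // dotZl mulrA mulVf // mul1r.
by [].
Qed.

Lemma flux_scale F t v : smooth U0 F -> degree0 F -> t != 0 -> v != 0 ->
  flux ell F (t *: v) = t *: flux ell F v.
Proof.
move=> sF hF t0 v0; have r0 : dot v v != 0 by rewrite dot_eq0.
rewrite /flux /sharp grad_scale // !dotZl !dotZr.
rewrite [X in _ - _ *: X](eq_bigr (fun k => (t ^+ 3) *: (dot (v *m K k) (grad F v) *: ell k v +
    dot (ell k v) (grad F v) *: (v *m K k)))); last first.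
  move=> k _; rewrite -!scalemxAl !hf_homog !dotZl !dotZr !scalerDr !scalerA.
  congr (_ *: _ + _ *: _); field; exact: t0.
rewrite [X in _ + _ *: X](eq_bigr (fun k => t ^+ 7 *: ((\sum_l dot (ell k v) (ell l v) *
    dot (v *m K l) (grad F v)) *: (v *m K k)))); last first.
  move=> k _; rewrite -!scalemxAl !scalerA; congr (_ *: _).
  rewrite mulr_suml mulr_sumr; apply: eq_bigr => l _.
  rewrite -!scalemxAl !hf_homog !dotZl !dotZr; field; exact: t0.
rewrite -!scaler_sumr !scalerDr scalerN !scalerA.
congr (_ *: _ - _ *: _ + _ *: _); move: (dot v v) r0 => r r0; field; by rewrite ?r0 ?t0.
Qed.

Lemma Lop_scale F t v : smooth U0 F -> degree0 F -> t != 0 -> v != 0 ->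
  Lop ell F (t *: v) = Lop ell F v.
Proof.
move=> sF hF t0 v0; rewrite /Lop; apply: (congr1 (fun x => - x)); apply: eq_bigr => i _.
apply: (@derive_scale1 (fun w => flux ell F w 0 i)) => //; first exact: smooth_flux.
by move=> w w0; rewrite flux_scale // mxE.
Qed.

End Homogeneity.

Section Laplacian.
Variables (R : realType) (n : nat).
Local Notation N := n.+1.
Variables (tf : torus_frame R N) (ell : hfield tf).
Local Notation K := (tK tf).
Local Notation U0 := (@punctured R N).
Local Notation oU0 := (@punctured_open R N).
Local Notation e_ i := (delta_mx 0 i : 'rV[R]_N).
Implicit Types (F : 'rV[R]_N -> R) (v w : 'rV[R]_N) (u : 'rV[R]_n).

(** With respect to the density |h|^-N of the chart, a tangential field of degree
    1 has the same divergence as in R^N.  Euler's relation for the k-th component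
    accounts for the derivative in the direction that the chart lacks, and
    tangency for the derivative of the density. *)
Lemma divergence_chart (X : 'rV[R]_N -> 'rV[R]_N) (k : 'I_N) u :
  (forall i, smooth U0 (fun v => X v 0 i)) ->
  (forall t v, t != 0 -> v != 0 -> X (t *: v) = t *: X v) ->
  dot (homog k u) (X (homog k u)) = 0 ->
  \sum_i 'D_(delta_mx 0 i) (fun u => inv_norm (homog k u) ^+ N *
     (X (homog k u) 0 (lift k i) - u 0 i * X (homog k u) 0 k)) u =
  inv_norm (homog k u) ^+ N * divergence X (homog k u).
Proof.
move=> sX hX tX; set h := homog k u.
have h0 : h != 0 by exact: homog_neq0.
have r0 : dot h h != 0 by rewrite dot_eq0.
have hk : h 0 k = 1 by exact: homog_pivot.
have dX a b : derivable (fun v => X v 0 a) h b by exact: (smooth_derivable oU0 (sX a) h0).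
have dc a b : derivable (fun v : 'rV[R]_N => v 0 a) h b.
  by apply: diff_derivable; exact: differentiable_coord.
have term i : 'D_(delta_mx 0 i) (fun u => inv_norm (homog k u) ^+ N *
     (X (homog k u) 0 (lift k i) - u 0 i * X (homog k u) 0 k)) u =
   inv_norm h ^+ N * ('D_(e_ (lift k i)) (fun v => X v 0 (lift k i)) h - X h 0 k
      - h 0 (lift k i) * 'D_(e_ (lift k i)) (fun v => X v 0 k) h
      - N%:R * (dot h h)^-1 * (h 0 (lift k i) * (X h 0 (lift k i) - h 0 (lift k i) * X h 0 k))).
  pose Y (v : 'rV[R]_N) := X v 0 (lift k i) - v 0 (lift k i) * X v 0 k.
  have -> : (fun u => inv_norm (homog k u) ^+ N *
     (X (homog k u) 0 (lift k i) - u 0 i * X (homog k u) 0 k)) =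
     (fun u => (fun v => inv_norm v ^+ N * Y v) (homog k u)).
    by apply/funext => u'; rewrite /Y homog_lift.
  rewrite (derive_homog (fun v => inv_norm v ^+ N * Y v)) hlift_delta -/h.
  have [di ei] := is_derive_inv_norm (e_ (lift k i)) h0.
  have di' : derivable (@inv_norm R N) h (e_ (lift k i)) by exact: diff_derivable.
  have dp : is_derive h (e_ (lift k i)) (fun v => inv_norm v ^+ N)
      (- (N%:R * inv_norm h ^+ N * ((dot h h)^-1 * h 0 (lift k i)))).
    have ep : (@inv_norm R N) ^+ N = (fun v => inv_norm v ^+ N).
      exact: exp_funE.
    have [d e] := is_deriveX N (DeriveDef di' ei).
    rewrite ep in d e; split; first exact: d.
    rewrite e dot_delta exprS inv_norm2 [LHS]/GRing.scale /= [inv_norm h ^+ n.+1]exprS.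
    move: (inv_norm h) (inv_norm h ^+ n) (dot h h)^-1 (h 0 _) => a b c d'; ring.
  have ec : (e_ (lift k i)) 0 (lift k i) = 1 by rewrite mxE !eqxx.
  have dXN := derivableM (dc (lift k i) (e_ (lift k i))) (dX k (e_ (lift k i))).
  have dY : is_derive h (e_ (lift k i)) Y ('D_(e_ (lift k i)) (fun v => X v 0 (lift k i)) h -
      (h 0 (lift k i) * 'D_(e_ (lift k i)) (fun v => X v 0 k) h + X h 0 k)).
    split; first exact: (derivableB (dX (lift k i) (e_ (lift k i))) dXN).
    have e1 := deriveB (dX (lift k i) (e_ (lift k i))) dXN.
    apply: etrans e1 _; rewrite (deriveM (dc _ _) (dX _ _)) derive_coordE ec.
    by congr (_ - (_ + _)); rewrite [LHS]mulr1.
  have [d e] := is_deriveM dp dY.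
  apply: etrans e _; rewrite /GRing.scale /= -/(Y h) /Y.
  move: (inv_norm h ^+ N) (X h 0 (lift k i)) (X h 0 k) (h 0 (lift k i)) (dot h h)^-1 (N%:R : R).
  move: ('D_(e_ (lift k i)) _ h) ('D_(e_ (lift k i)) _ h) => a b c d1 d2 d3 d4 d5; ring.
rewrite (eq_bigr _ (fun i _ => term i)) -mulr_sumr; congr (_ * _).
have split_k (f : 'I_N -> R) : \sum_a f a = f k + \sum_i f (lift k i).
  rewrite (bigD1 k) //=; congr (_ + _).
  rewrite (reindex_omap (lift k) (unlift k)) /=.
    by apply: eq_big => [j|//]; rewrite liftK eqxx eq_sym neq_lift.
  by move=> j; rewrite eq_sym => /unlift_some[i -> ->].
have s1 : \sum_i h 0 (lift k i) * (X h 0 (lift k i) - h 0 (lift k i) * X h 0 k) = - (dot h h * X h 0 k).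
  have t1 : \sum_i h 0 (lift k i) * X h 0 (lift k i) = - X h 0 k.
    apply/eqP; rewrite -addr_eq0 addrC; apply/eqP.
    by rewrite -[RHS]tX /dot split_k hk mul1r.
  have t2 : \sum_i h 0 (lift k i) * h 0 (lift k i) = dot h h - 1.
    by rewrite /dot split_k hk mulr1 addrC addKr.
  under eq_bigr do rewrite mulrBr mulrA.
  by rewrite sumrB t1 -mulr_suml t2; ring.
have s2 : \sum_i h 0 (lift k i) * 'D_(e_ (lift k i)) (fun v => X v 0 k) h =
    X h 0 k - 'D_(e_ k) (fun v => X v 0 k) h.
  have := @euler1 _ _ (fun v => X v 0 k) h _ h0.
  rewrite (derive_rV _ oU0 (sX k 1%N) h0) split_k hk mul1r => <-; first by rewrite addrC addKr.
  by move=> t w t0 w0; rewrite hX // mxE.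
rewrite !sumrB sumr_const card_ord -mulr_sumr s1 s2 /divergence split_k -[N%:R]natr1.
rewrite -mulr_natl mulrN -[_ * (dot h h)^-1 * _]mulrA mulKf //; ring.
Qed.

End Laplacian.

(** * The twisted metrics on the sphere and on the projective space *)

Section Metrics.
Variables (R : realType) (n : nat).
Local Notation N := n.+1.
Variables (tf : torus_frame R N) (ell : hfield tf).
Local Notation K := (tK tf).
Local Notation U0 := (@punctured R N).
Local Notation oU0 := (@punctured_open R N).
Local Notation e_ i := (delta_mx 0 i : 'rV[R]_N).
Local Notation S := (sphere_manifold R n).
Local Notation P := (projective_manifold R n).
Implicit Types (x y : sphere R n) (z : projective R n) (F : 'rV[R]_N -> R) (v w : 'rV[R]_N) (u V W : 'rV[R]_n).

Local Notation piv x := (pivot (val x)).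
Local Notation sgp x := (Num.sg (val x 0 (pivot (val x)))).

(** The vector of R^N tangent to the sphere that corresponds to the coordinate
    vector [V] in the preferred chart at [x]. *)
Definition emb x V : 'rV[R]_N := 'D_V (fun u => val (sphere_param x u)) (sphere_coord x x).

Lemma derive_param x u V :
  'D_V (fun u => val (sphere_param x u)) u = chart_frame (sgp x) (piv x) u V.
Proof.
rewrite (_ : (fun u => _) = chart_point (sgp x) (piv x)); first exact: derive_chart_point.
by apply/funext => u'; rewrite sphere_paramE.
Qed.

Lemma embE x V : emb x V = chart_frame (sgp x) (piv x) (sphere_coord x x) V.
Proof. exact: derive_param. Qed.

Lemma hlift_lin k (a : R) V W : hlift k (a *: V + W) = a *: hlift k V + hlift k W.
Proof.
by apply/rowP => i; rewrite !mxE; case: unliftP => [j _|_] /=; rewrite ?mxE // mulr0 addr0.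
Qed.

Lemma emb_lin x (a : R) V W : emb x (a *: V + W) = a *: emb x V + emb x W.
Proof.
rewrite !embE /chart_frame hlift_lin; apply/rowP => i; rewrite !mxE dotDr dotZr.
move: (oapp _ _ _) (oapp (V 0) _ _) (oapp (W 0) _ _) => b c d; ring.
Qed.

Definition twistv (y w : 'rV[R]_N) : 'rV[R]_N := w + \sum_k dot (ell k y) w *: (y *m K k).

Lemma twistv_lin (y : 'rV[R]_N) (a : R) v w : twistv y (a *: v + w) = a *: twistv y v + twistv y w.
Proof.
rewrite /twistv scalerDr addrACA; congr (_ + _); rewrite scaler_sumr -big_split /=.
by apply: eq_bigr => k _; rewrite dotDr dotZr scalerDl scalerA.
Qed.

(** The radial term of [chart_frame] is orthogonal to ell_l, and three powers of
    the scaling factor come from the foot point, one from the vector. *)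
Lemma dot_hf_chart s k u V l : s ^+ 2 = 1 ->
  dot (ell l (chart_point s k u)) (chart_frame s k u V) =
  (dot (homog k u) (homog k u))^-1 ^+ 2 * dot (ell l (homog k u)) (hlift k V).
Proof.
move=> s2; rewrite /chart_point /chart_frame; set h := homog k u; set w := hlift k V.
set c := s * inv_norm h.
have c4 : c ^+ 4 = (dot h h)^-1 ^+ 2.
  have s4 : s ^+ 4 = 1 by rewrite -[4%N]/(2 * 2)%N exprM s2 expr1n.
  by rewrite -inv_norm2 /c exprMn s4 mul1r -exprM.
rewrite hf_homog dotZl dotZr dotBr dotZr hf_radial mulr0 subr0 -c4.
by rewrite mulrA -exprSr.
Qed.

Lemma twistv_chart s k u V : s ^+ 2 = 1 ->
  twistv (chart_point s k u) (chart_frame s k u V) =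
  (s * inv_norm (homog k u)) *: twist_tangent ell (homog k u) (hlift k V).
Proof.
move=> s2; rewrite /twistv /twist_tangent [in RHS]scalerDr; congr (_ + _).
rewrite !scaler_sumr; apply: eq_bigr => l _.
rewrite dot_hf_chart // -scalemxAl !scalerA; congr (_ *: _); ring.
Qed.

Lemma sg_sq x : sgp x ^+ 2 = 1.
Proof. by rewrite sqr_sg pivotP. Qed.

Definition gform x V W : R := dot (twistv (val x) (emb x V)) (twistv (val x) (emb x W)).

Definition gsphere : metric S := fun x V W => gform x V W.
Definition gproj : metric P := fun z V W => gform (repr (z : projective R n)) V W.

Lemma emb_coord_vector x u V :
  emb (sphere_param x u) (@coord_vector R n S x u V) = chart_frame (sgp x) (piv x) u V.
Proof.
rewrite -derive_param; apply: (@embed_vector_curve R n _ (sphere_param x) u V).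
rewrite (_ : (fun q => _) = chart_point (sgp x) (piv x)); last first.
  by apply/funext => u'; rewrite sphere_paramE.
exact: differentiable_chart_point.
Qed.

Lemma pivotN v : pivot (- v) = pivot v.
Proof.
rewrite /pivot; congr (odflt _ _); apply: eq_pick => k.
by rewrite /= mxE oppr_eq0.
Qed.

Lemma param_antipode x u : sphere_param (antipode x) u = antipode (sphere_param x u).
Proof.
apply: val_inj; rewrite /= pivotN /sphere_scale mxE sgrN mulNr scaleNr.
by [].
Qed.

Lemma coord_antipode x y : sphere_coord (antipode x) y = sphere_coord x y.
Proof. by rewrite /sphere_coord /= pivotN. Qed.

Lemma coord_antipode2 x y : sphere_coord x (antipode y) = sphere_coord x y.
Proof. by rewrite /sphere_coord /= affineN. Qed.

Lemma emb_antipode x V : emb (antipode x) V = - emb x V.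
Proof.
rewrite /emb coord_antipode coord_antipode2.
rewrite (_ : (fun u => val (sphere_param (antipode x) u)) = - (fun u => val (sphere_param x u))).
  rewrite deriveN //; apply: diff_derivable.
  rewrite (_ : (fun u => _) = chart_point (sgp x) (piv x)); last first.
    by apply/funext => u'; rewrite sphere_paramE.
  exact: differentiable_chart_point.
by apply/funext => u; rewrite param_antipode.
Qed.

Lemma twistvN (y w : 'rV[R]_N) : twistv (- y) (- w) = - twistv y w.
Proof.
rewrite /twistv opprD; congr (_ + _); rewrite -sumrN; apply: eq_bigr => k _.
have eE : ell k (- y) = - ell k y.
  by rewrite -scaleN1r hf_homog -signr_odd /= expr1 scaleN1r.
by rewrite eE dotNl dotNr opprK mulNmx scalerN.
Qed.

Lemma gform_antipode x V W : gform (antipode x) V W = gform x V W.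
Proof.
have H (y A B A' B' : 'rV[R]_N) : A' = - A -> B' = - B ->
    dot (twistv (- y) A') (twistv (- y) B') = dot (twistv y A) (twistv y B).
  by move=> -> ->; rewrite !twistvN dotNl dotNr opprK.
exact: (H (val x) _ _ _ _ (emb_antipode x V) (emb_antipode x W)).
Qed.

Lemma gform_chart x u V W :
  gform (sphere_param x u) (@coord_vector R n S x u V) (@coord_vector R n S x u W) =
  (dot (homog (piv x) u) (homog (piv x) u))^-1 *
    dot (twist_tangent ell (homog (piv x) u) (hlift (piv x) V)) (twist_tangent ell (homog (piv x) u) (hlift (piv x) W)).
Proof.
have H (y A B : 'rV[R]_N) s k : s ^+ 2 = 1 -> y = chart_point s k u ->
    A = chart_frame s k u V -> B = chart_frame s k u W ->
    dot (twistv y A) (twistv y B) = (dot (homog k u) (homog k u))^-1 *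
      dot (twist_tangent ell (homog k u) (hlift k V)) (twist_tangent ell (homog k u) (hlift k W)).
  move=> s2 -> -> ->; rewrite !twistv_chart // dotZl dotZr mulrA -expr2.
  by rewrite exprMn s2 mul1r inv_norm2.
exact: (H _ _ _ _ _ (sg_sq x) (sphere_paramE x u) (emb_coord_vector x u V) (emb_coord_vector x u W)).
Qed.

Lemma gram_gsphere (x : S) u : gram gsphere x u = chart_gram ell (piv (x : sphere R n)) (homog (piv (x : sphere R n)) u).
Proof.
by apply/matrixP => i j; rewrite !mxE /gsphere gform_chart !hlift_delta.
Qed.

(** A chart of the projective space is a chart of the sphere followed by the
    projection, but the chosen representative of its value may be the antipode.
    Quantities that do not distinguish antipodal points can be computed on the
    sphere. *)
Lemma repr_chart T (Phi : sphere R n -> ('rV[R]_n -> 'rV[R]_n) -> T) (z : P) u :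
  (forall x c, Phi (antipode x) c = Phi x c) ->
  Phi (repr (param z u : projective R n)) (coord_vector z u) =
  Phi (sphere_param (repr (z : projective R n)) u)
      (@coord_vector R n S (repr (z : projective R n)) u).
Proof.
move=> PhiN; set x := repr (z : projective R n).
have e (y : sphere R n) : y = sphere_param x u \/ y = antipode (sphere_param x u) ->
    Phi y (fun V => 'D_V (fun q => sphere_coord y (sphere_param x q)) u) =
    Phi (sphere_param x u) (fun V => 'D_V (fun q => sphere_coord (sphere_param x u) (sphere_param x q)) u).
  set y0 := sphere_param x u.
  have ec : (fun q => sphere_coord (antipode y0) (sphere_param x q)) =
            (fun q => sphere_coord y0 (sphere_param x q)).
    by apply/funext => q; exact: coord_antipode.
  have ed := congr1 (fun f V => 'D_V f u) ec.
  move=> [->|->]; first by [].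
  exact: (etrans (PhiN _ _) (congr1 (Phi y0) ed)).
apply: etrans (e _ (@repr_proj R n (sphere_param x u))); congr Phi.
apply/funext => V; congr ('D_V _ u); apply/funext => q.
exact: projective_coordE.
Qed.

Lemma gproj_chart (z : P) u V W :
  gproj (param z u) (coord_vector z u V) (coord_vector z u W) =
  gform (sphere_param (repr (z : projective R n)) u)
   (@coord_vector R n S (repr (z : projective R n)) u V)
   (@coord_vector R n S (repr (z : projective R n)) u W).
Proof.
apply: (@repr_chart _ (fun x c => gform x (c V) (c W))) => x c.
exact: gform_antipode.
Qed.

Lemma gram_gproj (z : P) u : gram gproj z u =
  chart_gram ell (piv (repr (z : projective R n))) (homog (piv (repr (z : projective R n))) u).
Proof.
by apply/matrixP => i j; rewrite mxE gproj_chart gform_chart !hlift_delta mxE.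
Qed.

Lemma twist_tangent_inj k u V : twist_tangent ell (homog k u) (hlift k V) = 0 -> V = 0.
Proof.
set h := homog k u; set w := hlift k V => e.
have h0 : h != 0 by exact: homog_neq0.
have l0 l : dot (ell l h) w = 0.
  have := congr1 (dot (ell l h)) e; rewrite dot0r /twist_tangent dotDr dotBr !dotZr hf_radial.
  rewrite mulr0 subr0 dot_sumr big1 ?mulr0 ?addr0 // => l' _.
  by rewrite dotZr hf_horiz mulr0.
move: e; rewrite /twist_tangent big1 => [|l _]; last by rewrite l0 scale0r.
rewrite scaler0 addr0 => /eqP; rewrite subr_eq0 => /eqP e.
have t0 : dot h w / dot h h = 0.
  have := congr1 (fun r : 'rV[R]_N => r 0 k) e.
  by rewrite hlift_pivot mxE homog_pivot mulr1 => <-.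
move: e; rewrite t0 scale0r => e; apply/rowP => i.
by rewrite -(hlift_lift k) -/w e !mxE.
Qed.

Lemma gform_linear x W : linear ((gform x)^~ W : 'rV[R]_n -> R^o).
Proof. by move=> a V V'; rewrite /gform emb_lin twistv_lin dotDl dotZl. Qed.

Lemma gform_sym x V W : gform x V W = gform x W V.
Proof. exact: dotC. Qed.

Lemma gform_gt0 x V : V != 0 -> 0 < gform x V V.
Proof.
move=> V0; rewrite /gform; apply: dot_gt0; apply: contraNN V0.
have i0 : inv_norm (homog (piv x) (sphere_coord x x)) != 0.
  by rewrite gt_eqF // inv_norm_gt0 // homog_neq0.
have H (y A : 'rV[R]_N) s k u : s ^+ 2 = 1 -> inv_norm (homog k u) != 0 -> y = chart_point s k u ->
    A = chart_frame s k u V -> twistv y A == 0 -> V == 0.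
  move=> s2 h0 -> ->; rewrite twistv_chart // scaler_eq0 mulf_eq0 (negbTE h0) orbF.
  have -> : (s == 0) = false by apply: contra_eqF s2 => /eqP->; rewrite expr0n eq_sym oner_eq0.
  by move=> /eqP /twist_tangent_inj ->.
apply: (H _ _ _ _ _ (sg_sq x) i0 _ (embE x V)).
by rewrite -sphere_paramE sphere_param_center.
Qed.

Lemma gsphere_riemannian : riemannian gsphere.
Proof.
split.
- exact: (fun x W => gform_linear x W).
- exact: (fun x V W => gform_sym x V W).
- exact: (fun x V H => @gform_gt0 x V H).
- move=> x i j; apply: (eq_smooth (@openT _) (f := fun u => chart_gram ell (piv (x : sphere R n)) (homog (piv (x : sphere R n)) u) i j)).
    by move=> u _; rewrite gram_gsphere.
  exact: smooth_chart_gram.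
Qed.

Lemma gproj_riemannian : riemannian gproj.
Proof.
split.
- exact: (fun z W => gform_linear (repr (z : projective R n)) W).
- exact: (fun z V W => gform_sym (repr (z : projective R n)) V W).
- exact: (fun z V H => @gform_gt0 (repr (z : projective R n)) V H).
- move=> z i j; apply: (eq_smooth (@openT _) (f := fun u =>
     chart_gram ell (piv (repr (z : projective R n))) (homog (piv (repr (z : projective R n))) u) i j)).
    by move=> u _; rewrite gram_gproj.
  exact: smooth_chart_gram.
Qed.

Lemma north_subproof : sqnorm (e_ ord0) == 1.
Proof.
rewrite sqnormE dot_delta mxE !eqxx //.
Qed.

(** The radial projection; its value at the origin is arbitrary. *)
Definition cone v : sphere R n :=
  insubd (exist (fun y : 'rV[R]_n.+1 => sqnorm y == 1) (e_ ord0) north_subproof : sphere R n) (inv_norm v *: v).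

Lemma val_cone v : v != 0 -> val (cone v) = inv_norm v *: v.
Proof.
move=> v0; rewrite /cone insubdK // unfold_in /= sqnormZ inv_norm2 sqnormE mulVf //.
by rewrite dot_eq0.
Qed.

Definition lift_fun (f : P -> R) v : R := f (proj (cone v) : P).

Lemma sphere_neq0 x : val x != 0.
Proof. by rewrite -dot_eq0 -sqnormE sphereP oner_eq0. Qed.

Lemma cone_val x : cone (val x) = x.
Proof.
apply: val_inj; rewrite val_cone ?sphere_neq0 //.
by rewrite /inv_norm -sqnormE sphereP sqrtr1 invr1 scale1r.
Qed.

Lemma lift_fun_val f x : lift_fun f (val x) = f (proj x).
Proof. by rewrite /lift_fun cone_val. Qed.

Lemma cone_scale t v : t != 0 -> v != 0 ->
  cone (t *: v) = cone v \/ cone (t *: v) = antipode (cone v).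
Proof.
move=> t0 v0; have tv0 : t *: v != 0 by exact: scale_neq0.
have e : inv_norm (t *: v) * t = Num.sg t * inv_norm v.
  rewrite /inv_norm dotZl dotZr mulrA -expr2 sqrtrM ?sqr_ge0 // sqrtr_sqr invfM.
  rewrite mulrAC; congr (_ * _); rewrite {2}[t]numEsg mulrCA mulVf ?mulr1 // normr_eq0 //.
have [t_gt|t_lt|t00] := ltrgt0P t; last by rewrite t00 eqxx in t0.
- left; apply: val_inj; rewrite !val_cone // scalerA e gtr0_sg // mul1r //.
- right; apply: val_inj; rewrite [RHS]/= !val_cone // scalerA e ltr0_sg // mulN1r scaleNr //.
Qed.

Lemma lift_degree0 f : degree0 (lift_fun f).
Proof.
move=> t v t0 v0; rewrite /lift_fun.
suff -> : proj (cone (t *: v)) = proj (cone v) by [].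
by apply/projP; exact: cone_scale.
Qed.

Lemma lift_param f (z : P) u : f (param z u) = lift_fun f (homog (piv (repr (z : projective R n))) u).
Proof.
rewrite /param /= /projective_param; set x := repr _.
rewrite -lift_fun_val sphere_paramE /chart_point lift_degree0 //.
  rewrite mulf_neq0 // ?sgr_eq0 ?pivotP // gt_eqF // inv_norm_gt0 // homog_neq0 //.
exact: homog_neq0.
Qed.

Lemma affine_cover v : v != 0 -> exists z : P, v 0 (piv (repr (z : projective R n))) != 0.
Proof.
move=> v0; exists (proj (cone v)).
have H (y : 'rV[R]_N) : y 0 (pivot y) != 0 -> y = inv_norm v *: v \/ y = - (inv_norm v *: v) ->
    v 0 (pivot y) != 0.
  move=> + e; apply: contraNneq => v1; apply/eqP.
  case: e => /(congr1 (fun r : 'rV[R]_N => r 0 (pivot y))); rewrite !mxE v1 mulr0 => -> //.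
  by rewrite oppr0.
apply: H; first exact: pivotP.
have [->|->] : repr (proj (cone v)) = cone v \/ repr (proj (cone v)) = antipode (cone v) by exact: repr_proj.
  by left; exact: val_cone.
by right; rewrite -(val_cone v0).
Qed.

(** Where the k-th coordinate does not vanish, [lift_fun f] is [f] in an affine
    chart composed with the affine coordinates, because it has degree 0. *)
Lemma smooth_lift f : msmooth_fun f -> smooth U0 (lift_fun f).
Proof.
move=> sf r; apply: Ck_local => v v0.
have [z zk] := affine_cover v0; set k := pivot _ in zk.
have oV : open [set w : 'rV[R]_N | w 0 k != 0].
  apply: (@open_comp _ _ (fun w : 'rV[R]_N => w 0 k) [set t | t != 0]); last exact: open_neq.
  by move=> w _; exact: coord_continuous.
exists [set w : 'rV[R]_N | w 0 k != 0]; split=> //.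
apply: (@eq_Ck _ _ _ _ (fun w => (f \o param z) (affine k w))) => //.
  move=> w wk; rewrite [LHS]/= lift_param -/k homog_affine // lift_degree0 ?invr_eq0 //.
  by apply: contraNneq wk => ->; rewrite mxE.
apply: (@Ck_comp _ _ _ _ _ setT (affine k)) => //; [exact: openT| |exact: sf].
move=> i; apply: (@eq_Ck _ _ _ _ (fun w => w 0 (lift k i) * (w 0 k)^-1)) => // [w _|].
  by rewrite mxE.
apply: CkM => //; first exact: Ck_coord.
apply: CkV => //; exact: Ck_coord.
Qed.

Definition descend_fun F : P -> R := fun z => F (val (repr (z : projective R n))).

Lemma descend_param F (z : P) u : degree0 F ->
  descend_fun F (param z u) = F (homog (piv (repr (z : projective R n))) u).
Proof.
move=> hF; rewrite /descend_fun /param /= /projective_param; set x := repr (z : projective R n).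
have h0 := homog_neq0 (piv x) u.
have c0 : sgp x * inv_norm (homog (piv x) u) != 0.
  by rewrite mulf_neq0 // ?sgr_eq0 ?pivotP // gt_eqF // inv_norm_gt0.
have [->|->] : repr (proj (sphere_param x u)) = sphere_param x u \/
    repr (proj (sphere_param x u)) = antipode (sphere_param x u) by exact: repr_proj.
  by rewrite sphere_paramE hF.
have -> : val (antipode (sphere_param x u)) = (-1) *: val (sphere_param x u) by rewrite scaleN1r.
by rewrite sphere_paramE scalerA hF // mulN1r oppr_eq0.
Qed.

Lemma descend_smooth F : smooth U0 F -> degree0 F -> msmooth_fun (descend_fun F).
Proof.
move=> sF hF z; apply: (eq_smooth (@openT _) (f := fun u => F (homog (piv (repr (z : projective R n))) u))).
  by move=> u _; rewrite [RHS]/= descend_param.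
exact: smooth_homog_comp.
Qed.

(** The volume density of the chart is |h|^-N by [sqrt_det_chart_gram] and the
    gradient is the flux by [chart_gram_flux]; [divergence_chart] then identifies
    the chart divergence with the Euclidean one. *)
Lemma laplace_gproj f F (z : P) : smooth U0 F -> degree0 F ->
  (forall u, f (param z u) = F (homog (piv (repr (z : projective R n))) u)) ->
  laplace gproj f z = Lop ell F (val (repr (z : projective R n))).
Proof.
move=> sF hF fF; set x := repr (z : projective R n) in fF *; set k := piv x in fF *.
pose X := flux ell F.
have hX t v : t != 0 -> v != 0 -> X (t *: v) = t *: X v by exact: flux_scale.
have sX i : smooth U0 (fun v => X v 0 i) by exact: smooth_flux.
have g0 u : dot (homog k u) (grad F (homog k u)) = 0.
  by apply: euler0 => //; exact: homog_neq0.
have fluxE i u : Num.sqrt (\det (gram gproj z u)) *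
    (\sum_j invmx (gram gproj z u) i j * 'D_(delta_mx 0 j) (f \o param z) u) =
    inv_norm (homog k u) ^+ N * (X (homog k u) 0 (lift k i) - u 0 i * X (homog k u) 0 k).
  rewrite gram_gproj -/x -/k sqrt_det_chart_gram; congr (_ * _).
  have /(congr1 (mulmx (invmx (chart_gram ell k (homog k u))))) := chart_gram_flux ell (g0 u).
  rewrite mulKmx ?chart_gram_unit // => /colP/(_ i); rewrite mxE => ->.
  rewrite mxE; apply: eq_bigr => j _; congr (_ * _).
  rewrite [RHS]mxE -dot_delta dotC -(derive_grad _ sF (homog_neq0 k u)) -hlift_delta -derive_homog.
  by congr ('D_(delta_mx 0 j) _ u); apply/funext => u'; exact: fF.
rewrite /laplace.
under eq_bigr do under eq_fun do rewrite fluxE.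
set u0 := coord z z.
rewrite (@divergence_chart R n X k u0 sX hX); last first.
  by rewrite /X dot_flux.
rewrite gram_gproj -/x -/k sqrt_det_chart_gram.
have h0 := homog_neq0 k u0.
have i0 : inv_norm (homog k u0) ^+ N != 0 by rewrite expf_neq0 // gt_eqF // inv_norm_gt0.
rewrite mulNr mulrA mulVf // mul1r.
have -> : homog k u0 = (val x 0 k)^-1 *: val x.
  by rewrite -homog_affine //; exact: pivotP.
rewrite -[LHS]/(Lop ell F _) Lop_scale //; first by rewrite invr_eq0; exact: pivotP.
exact: sphere_neq0.
Qed.

Lemma eigenfunction_lift lam f : eigenfunction gproj lam f -> eigen ell lam (lift_fun f).
Proof.
move=> [sf ef]; have sF := smooth_lift sf; split=> //; first exact: lift_degree0.
move=> v v0; pose z : P := proj (cone v).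
have hF := @lift_degree0 f.
have := ef z; rewrite (laplace_gproj sF hF (lift_param f z)).
have [t t0 ->] : exists2 t, t != 0 & val (repr (z : projective R n)) = t *: v.
  have i0 : inv_norm v != 0 by rewrite gt_eqF // inv_norm_gt0.
  have [->|->] : repr (proj (cone v)) = cone v \/ repr (proj (cone v)) = antipode (cone v) by exact: repr_proj.
    by exists (inv_norm v) => //; exact: val_cone.
  by exists (- inv_norm v); rewrite ?oppr_eq0 //= val_cone // scaleNr.
by rewrite (Lop_scale ell sF hF t0 v0).
Qed.

(** A homogeneous function takes equal values at antipodal points, so its value at
    the representative of a line is well defined. *)
Lemma eigenfunction_descend lam F : eigen ell lam F -> eigenfunction gproj lam (descend_fun F).
Proof.
move=> [sF hF eF]; split; first exact: descend_smooth.
move=> z; rewrite (laplace_gproj sF hF (fun u => descend_param z u hF)).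
by rewrite eF //; exact: sphere_neq0.
Qed.

End Metrics.

(** * The projection as a Riemannian covering *)

Section Covering.
Variables (R : realType) (n : nat).
Local Notation N := n.+1.
Local Notation S := (sphere_manifold R n).
Local Notation P := (projective_manifold R n).
Implicit Types (x y : sphere R n) (u V : 'rV[R]_n).

Definition quot : S -> P := @proj R n.
Definition anti : S -> S := @antipode R n.

Lemma coord_quot x u : projective_coord (proj x) (proj (sphere_param x u)) = u.
Proof.
rewrite projective_coordE.
have [->|->] : repr (proj x) = x \/ repr (proj x) = antipode x by exact: repr_proj.
  exact: sphere_paramK.
by rewrite coord_antipode sphere_paramK.
Qed.

(** The charts of the projective space are those of the sphere followed by the
    projection, so in preferred charts the projection is the identity. *)
Lemma mdiff_quot (x : S) V : mdiff quot x V = V.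
Proof.
rewrite /mdiff (_ : _ \o param x = id); first exact: derive_id.
by apply/funext => u; exact: coord_quot.
Qed.

Lemma mdiff_anti (x : S) V : mdiff anti x V = V.
Proof.
rewrite /mdiff (_ : _ \o param x = id); first exact: derive_id.
apply/funext => u /=; rewrite /anti coord_antipode coord_antipode2.
exact: sphere_paramK.
Qed.

Lemma proj_param x u : proj (sphere_param x u) = projective_param (proj x) u.
Proof.
rewrite /projective_param.
have [->|->] : repr (proj x) = x \/ repr (proj x) = antipode x by exact: repr_proj.
  by [].
by rewrite param_antipode; apply/projP; right; rewrite antipodeK.
Qed.

Lemma msmooth_quot : msmooth_on setT quot.
Proof.
move=> x y D.
have eD : D = projective_param (proj x) @^-1` range (projective_param y).
  by rewrite /D; apply/seteqP; split => u /=; rewrite /quot proj_param; [case|split].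
split; first by rewrite eD; exact: projective_domain_open.
move=> i; rewrite eD.
apply: (eq_smooth (@projective_domain_open R n (proj x) y)
  (f := fun u => projective_coord y (projective_param (proj x) u) 0 i)).
  by move=> u _; rewrite /= /quot proj_param.
exact: projective_transition_smooth.
Qed.

Lemma openI_preimage p q (O : set 'rV[R]_p) (t : 'rV[R]_p -> 'rV[R]_q) (W : set 'rV[R]_q) :
  open O -> open W -> (forall v : 'rV[R]_p, O v -> {for v, continuous t}) -> open (O `&` t @^-1` W).
Proof.
move=> oO oW ct; rewrite openE => u [Ou Wu]; apply: filterI; first exact: open_nbhs_nbhs.
by apply: (ct u Ou); exact: open_nbhs_nbhs.
Qed.

Lemma msmooth_section (y : P) x : proj x = y ->
  msmooth_on (range (projective_param y) : set P)
    (fun z : P => sphere_param x (projective_coord y z) : S).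
Proof.
move=> xy z b D.
set O := projective_param z @^-1` range (projective_param y).
pose t u := projective_coord y (projective_param z u).
set W := sphere_param x @^-1` range (sphere_param b).
have oO : open O by exact: projective_domain_open.
have oW : open W by exact: sphere_domain_open.
have st i : smooth O (fun u => t u 0 i) by exact: projective_transition_smooth.
have eD : D = O `&` t @^-1` W by [].
have ct u : O u -> {for u, continuous t}.
  move=> Ou; apply: (@cvg_rV _ _ (nbhs u)) => i; exact: (smooth_continuous (st i) Ou).
have oD : open D by rewrite eD; exact: openI_preimage.
split=> // i.
apply: (@smooth_comp _ _ _ D W t (fun u => sphere_coord b (sphere_param x u) 0 i)) => //.
- by move=> u; rewrite eD => -[].
- by move=> l; apply: (sub_smooth _ (st l)); rewrite eD => u [].
- exact: sphere_transition_smooth.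
Qed.

Lemma diffeo_sheet (y : P) x : proj x = y ->
  diffeo_on (range (sphere_param x) : set S) (range (projective_param y) : set P) quot.
Proof.
move=> xy.
have qp u : quot (sphere_param x u) = projective_param y u by rewrite /quot proj_param xy.
exists (fun z : P => sphere_param x (projective_coord y z) : S); split.
- move=> a b D.
  have [oD sD] := msmooth_quot a b.
  have oU : open (sphere_param a @^-1` range (sphere_param x)) by exact: sphere_domain_open.
  have eD : D = (sphere_param a @^-1` range (sphere_param x)) `&`
     (param (a : S) @^-1` (setT `&` quot @^-1` range (param (b : P)))).
    by apply/seteqP; split=> u /=; [move=> [h1 h2]; split=> //; split|move=> [h1 [_ h2]]; split].
  split; first by rewrite eD; exact: openI.
  by move=> i; apply: sub_smooth (sD i); rewrite eD => u [].
- exact: msmooth_section.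
- move=> _ [u _ <-]; rewrite qp; split; first by exists u.
  by rewrite projective_paramK.
- move=> _ [u _ <-]; rewrite projective_paramK; split; first by exists u.
  exact: qp.
Qed.

Lemma antipode_neq x : antipode x <> x.
Proof.
move=> /(congr1 val) /= e; have := sphere_neq0 x.
have : val x + val x = 0 by apply/eqP; rewrite addr_eq0; apply/eqP; exact: (esym e).
have -> : val x + val x = (2 : R) *: val x by rewrite scaler_nat mulr2n.
by move/eqP; rewrite scaler_eq0 pnatr_eq0 /= => ->.
Qed.

(** The domain of an affine chart is evenly covered: its preimage consists of two
    opposite open hemispheres. *)
Lemma quot_covering : smooth_covering quot.
Proof.
split; first exact: msmooth_quot.
split=> [z|y]; first by exists (repr (z : projective R n)); exact: proj_repr.
set x := repr (y : projective R n).
have xy : proj x = y by exact: proj_repr.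
have axy : proj (antipode x) = y by rewrite -xy; apply/projP; right.
exists (range (param y)).
exists [set U | U = range (sphere_param x) \/ U = range (sphere_param (antipode x))].
split.
- by move=> z; exact: overlap_open.
- by exists (coord y y) => //; exact: param_center.
- have dis : ~ (range (sphere_param x) `&` range (sphere_param (antipode x)) !=set0).
    move=> [p [[u _ up] [u' _ up']]].
    have := sphere_paramK x u; rewrite up -up' param_antipode coord_antipode2 sphere_paramK => e.
    by apply: (@antipode_neq (sphere_param x u)); rewrite {2}up -up' param_antipode e.
  by move=> U U' /= [->|->] [->|->] //= h; case: dis => //; rewrite setIC.
- apply/seteqP; split => p /=.
    move=> [u _ up].
    have : proj p = proj (sphere_param x u) by rewrite proj_param xy; exact/esym.
    move=> /projP[->|->]; first by exists (range (sphere_param x)); [left|exists u].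
    exists (range (sphere_param (antipode x))); first by right.
    by exists u => //; rewrite param_antipode.
  move=> [U [->|->] [u _ <-]]; exists u => //; apply/esym.
  by rewrite /quot proj_param axy.
- move=> U [->|->]; split; try by move=> z; exact: overlap_open.
    exact: diffeo_sheet.
  exact: diffeo_sheet.
Qed.

Lemma quot_riemannian_covering (tf : torus_frame R N) (ell : hfield tf) :
  riemannian_covering (gsphere ell) (gproj ell) quot.
Proof.
split.
- exact: gsphere_riemannian.
- exact: gproj_riemannian.
- exact: quot_covering.
move=> x V W; rewrite (mdiff_quot x V) (mdiff_quot x W) /gproj /gsphere.
have [->|->] : repr (proj x) = x \/ repr (proj x) = antipode x by exact: repr_proj.
  by [].
exact: gform_antipode.
Qed.

End Covering.

(** * The cubic fields of skew endomorphisms *)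

Section QuadraticField.
Variables (R : realType) (N : nat) (tf : torus_frame R N).
Local Notation K := (tK tf).
Local Notation P0 := (tP tf ord0).
Local Notation K0 := (tK tf ord0).
Variable J : 'I_2 -> 'M[R]_N.
Hypothesis J_tr : forall k, (J k)^T = - J k.
Hypothesis J_K : forall k l, J k *m K l = K l *m J k.
Hypothesis J_P0 : forall k, J k *m P0 = J k.

(** With p = v P_0 and ip = v K_0 this represents the form
    X |-> |p|^2 <v B, X> - <v B, ip> <ip, X>. *)
Definition cubic (B : 'M[R]_N) (v : 'rV[R]_N) : 'rV[R]_N :=
  dot (v *m P0) v *: (v *m B) - dot (v *m B) (v *m K0) *: (v *m K0).

Lemma skew_dot (B : 'M[R]_N) (v : 'rV[R]_N) : B^T = - B -> dot (v *m B) v = 0.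
Proof.
move=> tB; have : dot (v *m B) v = - dot (v *m B) v.
  by rewrite {1}dot_mulmx tB mulmxN dotNr dotC.
by move=> e; lra.
Qed.

Lemma dot_K0 (v : 'rV[R]_N) : dot (v *m K0) (v *m K0) = dot (v *m P0) v.
Proof. by rewrite dot_mulmx tK_tr mulmxN -mulmxA tKK mulmxN opprK dotC. Qed.

Lemma J_P k l : J k *m tP tf l = tP tf l *m J k.
Proof. by rewrite -[tP tf l]opprK -tKK mulmxN mulNmx mulmxA J_K -mulmxA J_K mulmxA. Qed.

Lemma J_rot k l a : J k *m rot tf l a = rot tf l a *m J k.
Proof.
rewrite /rot !mulmxDl !mulmxDr mul1mx mulmx1 -!scalemxAl -!scalemxAr.
by rewrite J_P J_K.
Qed.

Lemma cubic_commute (B B' O : 'M[R]_N) (v : 'rV[R]_N) : orthogonal_mx O ->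
  O *m K0 = K0 *m O -> B' = O *m B *m O^T ->
  cubic B' v = cubic B (v *m O) *m O^T.
Proof.
move=> oO KO ->; have OO : O *m O^T = 1%:M by exact: oO.
have PO : O *m P0 = P0 *m O.
  by rewrite -[P0]opprK -tKK mulNmx mulmxN mulmxA KO -mulmxA KO mulmxA.
have e1 : v *m O *m K0 *m O^T = v *m K0.
  by rewrite -[v *m O *m K0]mulmxA KO mulmxA -mulmxA OO mulmx1.
rewrite /cubic mulmxBl -!scalemxAl e1 !mulmxA; congr (_ *: _ - _ *: _).
  by rewrite -[v *m O *m P0]mulmxA PO mulmxA (dot_mulmx (v *m P0)) -mulmxA OO mulmx1.
by rewrite [LHS]dot_mulmx trmxK -[v *m K0 *m O]mulmxA -KO mulmxA.
Qed.

Lemma cubic_smooth B i : smooth (@punctured R N) (fun v => cubic B v 0 i).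
Proof.
have o := @punctured_open R N.
have sm := @smooth_vmul R N.
have sd (A B' : 'M[R]_N) : smooth (@punctured R N) (fun v => dot (v *m A) (v *m B')).
  by apply: smooth_dot => l; exact: sm.
apply: (eq_smooth o (f := fun v => dot (v *m P0) (v *m 1%:M) * (v *m B) 0 i
    - dot (v *m B) (v *m K0) * (v *m K0) 0 i)) => [v _|].
  by rewrite mulmx1 !mxE.
by apply: smoothB => //; apply: smoothM.
Qed.

Fact cubic_homog k c v : cubic (J k) (c *: v) = c ^+ 3 *: cubic (J k) v.
Proof.
rewrite /cubic -!scalemxAl !dotZl !dotZr scalerBr !scalerA; congr (_ *: _ - _ *: _); ring.
Qed.

Fact cubic_radial k v : dot (cubic (J k) v) v = 0.
Proof.
by rewrite /cubic dotBl !dotZl (skew_dot v (J_tr k)) (skew_dot v (tK_tr tf ord0)) !mulr0 subrr.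
Qed.

Fact cubic_horiz k l v : dot (cubic (J k) v) (v *m K l) = 0.
Proof.
rewrite /cubic dotBl !dotZl.
have [->|l0] := eqVneq l ord0; first by rewrite dot_K0 mulrC subrr.
have Kl0 : K l *m K0 = 0 by exact: tK_mixed.
have P0l : P0 *m K l = 0 by apply: tPK_mixed; rewrite eq_sym.
have -> : dot (v *m K0) (v *m K l) = 0.
  by rewrite [LHS]dot_mulmx tK_tr mulmxN -mulmxA Kl0 mulmx0 oppr0 dot0r.
have -> : dot (v *m J k) (v *m K l) = 0.
  by rewrite [LHS]dot_mulmx J_tr mulmxN -mulmxA -J_K -[J k]J_P0 -mulmxA P0l !mulmx0 oppr0 dot0r.
by rewrite !mulr0 subrr.
Qed.

Fact cubic_rot k l a v : cubic (J k) (v *m rot tf l a) = cubic (J k) v *m rot tf l a.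
Proof.
have o : orthogonal_mx (rot tf l a) by exact: rot_orthogonal.
have ot : (rot tf l a)^T *m rot tf l a = 1%:M.
  by rewrite rot_tr -rotD addNr rot0.
have h : J k = rot tf l a *m J k *m (rot tf l a)^T.
  by rewrite -J_rot -mulmxA o mulmx1.
rewrite [in RHS](cubic_commute v o _ h); last exact: rot_tK.
by rewrite -mulmxA ot mulmx1.
Qed.

Definition cubic_field : hfield tf :=
  HField (fun k => cubic_smooth (J k)) cubic_homog cubic_radial cubic_horiz cubic_rot.

Lemma weighted_cubic (mu : 'I_2 -> R) v :
  weighted cubic_field mu v = cubic (\sum_k mu k *: J k) v.
Proof.
rewrite /weighted /cubic /= mulmx_sumr dot_suml scaler_sumr scaler_suml -sumrB.
apply: eq_bigr => k _; rewrite -scalemxAr dotZl scalerBr !scalerA.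
by rewrite [mu k * _ in LHS]mulrC.
Qed.

End QuadraticField.

(** * Complex matrices as real matrices *)

Section ComplexParts.
Variable R : realType.
Implicit Types x y : R[i].
Local Notation Re := complex.Re.
Local Notation Im := complex.Im.

Lemma ReD x y : Re (x + y) = Re x + Re y. Proof. by case: x; case: y. Qed.
Lemma ImD x y : Im (x + y) = Im x + Im y. Proof. by case: x; case: y. Qed.
Lemma ReM x y : Re (x * y) = Re x * Re y - Im x * Im y. Proof. by case: x; case: y. Qed.
Lemma ImM x y : Im (x * y) = Re x * Im y + Im x * Re y. Proof. by case: x; case: y. Qed.

Lemma Re_sum (I : Type) (r : seq I) (F : I -> R[i]) :
  Re (\sum_(i <- r) F i) = \sum_(i <- r) Re (F i).
Proof. by elim/big_rec2: _ => [//|i x y _ <-]; rewrite ReD. Qed.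

Lemma Im_sum (I : Type) (r : seq I) (F : I -> R[i]) :
  Im (\sum_(i <- r) F i) = \sum_(i <- r) Im (F i).
Proof. by elim/big_rec2: _ => [//|i x y _ <-]; rewrite ImD. Qed.

Lemma complex_eq x y : Re x = Re y -> Im x = Im y -> x = y.
Proof. by case: x => a b; case: y => c d /= -> ->. Qed.

End ComplexParts.

Section RealForm.
Variables (R : realType) (m : nat).
Local Notation Re := (@complex.Re R).
Local Notation Im := (@complex.Im R).
Local Notation C := R[i].
Local Notation M := m.+1.
Local Notation A_ := 'M[C]_M.
Implicit Types (x y v w : ambient R m) (A B : 'M[R[i]]_(m.+1)) (a : R) (c d : R[i]) (X Y : 'M[R[i]]_m).

(** The matrix of the real-linear map z |-> A z on rows of real and imaginary
    parts, acting from the right; products are therefore reversed in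
    [realmxM]. *)
Definition realmx A : 'M[R]_(m.+1 + m.+1) :=
  block_mx (map_mx Re A)^T (map_mx Im A)^T (- (map_mx Im A)^T) (map_mx Re A)^T.

Lemma zcoord_inj x y : (forall i, zcoord x i = zcoord y i) -> x = y.
Proof.
move=> e; apply/rowP => i; case: (split_ordP i) => l ->.
  by have := congr1 Re (e l).
by have := congr1 Im (e l).
Qed.

Lemma zcoordD x y i : zcoord (x + y) i = zcoord x i + zcoord y i.
Proof. by apply: complex_eq; rewrite ?ReD ?ImD /= mxE. Qed.

Lemma zcoordZ a x i : zcoord (a *: x) i = real_complex R a * zcoord x i.
Proof. by apply: complex_eq; rewrite ?ReM ?ImM /= !mxE ?mul0r ?subr0 ?addr0. Qed.

Lemma zcoord_realmx w A i : zcoord (w *m realmx A) i = \sum_l A i l * zcoord w l.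
Proof.
have ew : w = row_mx (lsubmx w) (rsubmx w) by rewrite hsubmxK.
rewrite {1}ew /realmx mul_row_block /zcoord row_mxEl row_mxEr.
apply: complex_eq.
  rewrite /= Re_sum !mxE -big_split; apply: eq_bigr => l _.
  by rewrite ReM !mxE /= mulrN; congr (_ - _); exact: mulrC.
rewrite /= Im_sum !mxE -big_split; apply: eq_bigr => l _.
rewrite ImM !mxE /= addrC; congr (_ + _); exact: mulrC.
Qed.

Lemma mx_eq_action p q (D E : 'M[R]_(p, q)) : (forall w : 'rV[R]_p, w *m D = w *m E) -> D = E.
Proof. by move=> h; apply/row_matrixP => i; rewrite !rowE h. Qed.

Lemma realmxM A B : realmx (A *m B) = realmx B *m realmx A.
Proof.
apply: mx_eq_action => w; apply: zcoord_inj => i.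
rewrite mulmxA !zcoord_realmx.
under [RHS]eq_bigr do rewrite zcoord_realmx mulr_sumr.
rewrite exchange_big /=; apply: eq_bigr => l _; rewrite mxE mulr_suml.
by apply: eq_bigr => k _; rewrite mulrA.
Qed.

Lemma realmxD A B : realmx (A + B) = realmx A + realmx B.
Proof.
apply: mx_eq_action => w; apply: zcoord_inj => i.
rewrite mulmxDr zcoordD !zcoord_realmx -big_split; apply: eq_bigr => l _.
by rewrite mxE mulrDl.
Qed.

Lemma realmxZ a A : realmx (real_complex R a *: A) = a *: realmx A.
Proof.
apply: mx_eq_action => w; apply: zcoord_inj => i.
rewrite -scalemxAr zcoordZ !zcoord_realmx mulr_sumr; apply: eq_bigr => l _.
by rewrite mxE mulrA.
Qed.

Lemma realmx1 : realmx 1%:M = 1%:M.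
Proof.
apply: mx_eq_action => w; apply: zcoord_inj => i.
rewrite mulmx1 zcoord_realmx (bigD1 i) //= mxE eqxx mul1r big1 ?addr0 // => l /negbTE li.
by rewrite mxE eq_sym li mul0r.
Qed.

Lemma realmx0 : realmx 0 = 0.
Proof.
have : realmx 0 + realmx 0 = realmx 0 + 0 by rewrite -realmxD !addr0.
by move/addrI.
Qed.

Lemma realmxN A : realmx (- A) = - realmx A.
Proof. by apply/eqP; rewrite -addr_eq0 -realmxD addNr realmx0. Qed.

Lemma realmx_adj A : realmx (adjmx A) = (realmx A)^T.
Proof.
rewrite /realmx tr_block_mx linearN /= !trmxK; congr block_mx; apply/matrixP => i l;
  rewrite !mxE; by case: (A _ _) => a b //=; rewrite ?opprK.
Qed.

(** The map X (+) c of C^m (+) C. *)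
Definition ext X c : 'M[C]_(m.+1) :=
  \matrix_(i, l) match unlift ord_max i, unlift ord_max l with
    | Some a, Some b => X a b
    | None, None => c
    | _, _ => 0
    end.

Lemma unlift_wide (i : 'I_m) : unlift ord_max (widen_ord (leqnSn m) i) = Some i.
Proof.
have -> : widen_ord (leqnSn m) i = lift ord_max i by apply: val_inj; exact/esym/lift_max.
exact: liftK.
Qed.

Lemma ord_wideP (P : 'I_m.+1 -> Prop) :
  (forall i, P (widen_ord (leqnSn m) i)) -> P ord_max -> forall i, P i.
Proof.
move=> Pw Pm i; case: (unliftP ord_max i) => [l ->|-> //].
have -> : lift ord_max l = widen_ord (leqnSn m) l by apply: val_inj; exact: lift_max.
exact: Pw.
Qed.

Lemma ext_ww X c i l : ext X c (widen_ord (leqnSn m) i) (widen_ord (leqnSn m) l) = X i l.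
Proof. by rewrite mxE !unlift_wide. Qed.
Lemma ext_wm X c i : ext X c (widen_ord (leqnSn m) i) ord_max = 0.
Proof. by rewrite mxE unlift_wide unlift_none. Qed.
Lemma ext_mw X c l : ext X c ord_max (widen_ord (leqnSn m) l) = 0.
Proof. by rewrite mxE unlift_wide unlift_none. Qed.
Lemma ext_mm X c : ext X c ord_max ord_max = c.
Proof. by rewrite mxE unlift_none. Qed.

Definition extE := (ext_ww, ext_wm, ext_mw, ext_mm).

Lemma eq_ext A B :
  (forall i l, A (widen_ord (leqnSn m) i) (widen_ord (leqnSn m) l) =
               B (widen_ord (leqnSn m) i) (widen_ord (leqnSn m) l)) ->
  (forall i, A (widen_ord (leqnSn m) i) ord_max = B (widen_ord (leqnSn m) i) ord_max) ->
  (forall l, A ord_max (widen_ord (leqnSn m) l) = B ord_max (widen_ord (leqnSn m) l)) ->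
  A ord_max ord_max = B ord_max ord_max -> A = B.
Proof.
move=> h1 h2 h3 h4; apply/matrixP => i l; move: i; apply: ord_wideP => [i|]; move: l;
  by apply: ord_wideP => [l|].
Qed.

Lemma extM X Y c d : ext X c *m ext Y d = ext (X *m Y) (c * d).
Proof.
apply: eq_ext => [i l|i|l|]; rewrite mxE big_ord_recr /= ?extE.
- by rewrite mulr0 addr0 mxE; apply: eq_bigr => q _; rewrite !extE.
- by rewrite mul0r addr0 big1 // => q _; rewrite !extE mulr0.
- by rewrite mulr0 addr0 big1 // => q _; rewrite !extE mul0r.
- by rewrite big1 ?add0r // => q _; rewrite !extE mul0r.
Qed.

Lemma extD X Y c d : ext X c + ext Y d = ext (X + Y) (c + d).
Proof. by apply: eq_ext => [i l|i|l|]; rewrite !mxE ?extE ?unlift_wide ?unlift_none ?mxE ?addr0. Qed.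

Lemma extZ X c d : d *: ext X c = ext (d *: X) (d * c).
Proof. by apply: eq_ext => [i l|i|l|]; rewrite !mxE ?extE ?unlift_wide ?unlift_none ?mxE ?mulr0. Qed.

Lemma extN X c : - ext X c = ext (- X) (- c).
Proof. by apply: eq_ext => [i l|i|l|]; rewrite !mxE ?extE ?unlift_wide ?unlift_none ?mxE ?oppr0. Qed.

Lemma ext_adj X c : adjmx (ext X c) = ext (adjmx X) (c^*)%C.
Proof.
by apply: eq_ext => [i l|i|l|]; rewrite !mxE ?extE ?unlift_wide ?unlift_none ?mxE ?conjc0.
Qed.

Lemma ext1 : ext 1%:M 1 = 1%:M.
Proof.
have wm i : (widen_ord (leqnSn m) i == ord_max) = false.
  by apply/negbTE; rewrite -val_eqE /= ltn_eqF.
apply: eq_ext => [i l|i|l|]; rewrite ?extE mxE ?eqxx ?wm // ?[ord_max == _]eq_sym ?wm //.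
by rewrite mxE.
Qed.

Lemma ext0 : ext 0 0 = 0.
Proof. by apply: eq_ext => [i l|i|l|]; rewrite ?extE ?mxE. Qed.

Lemma pcoord_ext x X c : pcoord (x *m realmx (ext X c)) = X *m pcoord x.
Proof.
apply/colP => i; rewrite mxE zcoord_realmx big_ord_recr /= ext_wm mul0r addr0 mxE.
by apply: eq_bigr => l _; rewrite ext_ww mxE.
Qed.

Lemma zcoord_ext_max x X c : zcoord (x *m realmx (ext X c)) ord_max = c * zcoord x ord_max.
Proof.
rewrite zcoord_realmx big_ord_recr /= ext_mm big1 ?add0r // => l _.
by rewrite ext_mw mul0r.
Qed.

Lemma dot_zcoord x y : dot x y = \sum_i Re (zcoord x i * (zcoord y i)^*%C).
Proof.
rewrite /dot (@big_split_ord _ _ _ m.+1 m.+1) /= -big_split /=; apply: eq_bigr => i _.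
by rewrite ?ReM /= mulrN opprK.
Qed.

Lemma herm_dot x y : herm (pcoord x) (pcoord y) = dot (x *m realmx (ext 1%:M 0)) y.
Proof.
rewrite dot_zcoord big_ord_recr zcoord_ext_max mul0r mul0r; apply: etrans (esym (addr0 _)).
apply: eq_bigr => i _.
have /colP/(_ i) := pcoord_ext x 1%:M 0; rewrite mul1mx => e.
rewrite mxE in e; by rewrite e !mxE.
Qed.

End RealForm.

(** * The torus action in matrix form *)

Section Frame.
Variables (R : realType) (m : nat).
Local Notation C := R[i].
Local Notation im := ('i%C : C).
Implicit Types (x v w : ambient R m) (c d : C) (k l : 'I_2) (X : 'M[C]_m).

(** Multiplication by [c] on the k-th summand of C^m (+) C and 0 on the other. *)
Definition circle k c : 'M[C]_m.+1 := ext (c * (k == ord0)%:R)%:M (c * (k != ord0)%:R).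

Lemma circleM k l c d : circle k c *m circle l d = if k == l then circle k (c * d) else 0.
Proof.
rewrite /circle extM -scalar_mxM -(mulrACA c d) -(mulrACA c d).
have [->|kl] := eqVneq k l; first by congr (ext (_)%:M _); case: (l == ord0); rewrite !(mulr1, mulr0).
have -> : (k == ord0) = (l != ord0).
  by case: k l kl => [[|[|k]] hk] [[|[|l]] hl]; rewrite -!val_eqE.
by case: (l == ord0); rewrite !(mulr0, mul0r) raddf0 ext0.
Qed.

Lemma circle_adj k c : adjmx (circle k c) = circle k (c^*)%C.
Proof.
have cM (b : bool) : (c * b%:R)^*%C = c^*%C * b%:R.
  by case: b; rewrite ?mulr1 ?mulr0 ?conjc0.
rewrite ext_adj /circle; congr ext; last exact: cM.
apply/matrixP => i l; rewrite !mxE [l == i]eq_sym; case: (i == l); rewrite ?mulr1n ?mulr0n ?conjc0 //; exact: cM.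
Qed.

Lemma circleN k c : - circle k c = circle k (- c).
Proof. by rewrite extN /circle !mulNr raddfN. Qed.

Let P k := realmx (circle k 1).
Let K k := realmx (circle k im).

Lemma im2 : im * im = -1. Proof. by rewrite -expr2 sqr_i. Qed.

Fact P_tr k : (P k)^T = P k. Proof. by rewrite /P -realmx_adj circle_adj conjc1. Qed.
Fact K_tr k : (K k)^T = - K k.
Proof.
rewrite /K -realmx_adj circle_adj -realmxN circleN; congr (realmx (circle k _)).
by apply: complex_eq; rewrite /= ?oppr0.
Qed.
Fact PP k l : P k *m P l = if k == l then P k else 0.
Proof.
rewrite /P -realmxM circleM eq_sym; case: eqP => [->|_]; last exact: realmx0.
by rewrite mulr1.
Qed.
Fact KK k : K k *m K k = - P k.
Proof. by rewrite /K -realmxM circleM eqxx im2 -circleN realmxN. Qed.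
Fact KP k : K k *m P k = K k.
Proof. by rewrite /K /P -realmxM circleM eqxx mul1r. Qed.

Definition frame : torus_frame R (m.+1 + m.+1) := TorusFrame P_tr K_tr PP KK KP.

Lemma frame_P0 : tP frame ord0 = realmx (ext 1%:M 0).
Proof. by rewrite /= /P /circle eqxx mulr1 mulr0. Qed.

Lemma frame_K0 : tK frame ord0 = realmx (ext (im%:M) 0).
Proof. by rewrite /= /K /circle eqxx mulr1 mulr0. Qed.

Definition planar X := realmx (ext X 0).

Lemma planar_P0 X : planar X *m tP frame ord0 = planar X.
Proof. by rewrite frame_P0 -realmxM extM mul1mx mul0r. Qed.

Lemma ext_circle X c l d : ext X c *m circle l d = circle l d *m ext X c.
Proof.
rewrite /circle !extM; congr ext; last exact: mulrC.
by rewrite -scalar_mxC.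
Qed.

Lemma ext_K X c l : realmx (ext X c) *m tK frame l = tK frame l *m realmx (ext X c).
Proof. by rewrite -!realmxM ext_circle. Qed.

Lemma planar_tr X : adjmx X = - X -> (planar X)^T = - planar X.
Proof.
by move=> sX; rewrite -realmx_adj ext_adj sX conjc0 -realmxN extN oppr0.
Qed.

Lemma zcoord_circle x k c i :
  zcoord (x *m realmx (circle k c)) i = (c * ((i < m)%N == (k == ord0))%:R) * zcoord x i.
Proof.
move: i; apply: ord_wideP => [i|].
  have /colP/(_ i) := pcoord_ext x (c * (k == ord0)%:R)%:M (c * (k != ord0)%:R).
  rewrite mul_scalar_mx !mxE => ->; have -> : (widen_ord (leqnSn m) i < m)%N by exact: (ltn_ord i).
  by case: (k == ord0).
rewrite zcoord_ext_max /= ltnn.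
by case: (k == ord0).
Qed.

Lemma zcoord_rot x k (a : R) i :
  zcoord (x *m rot frame k a) i =
  (if (i < m)%N == (k == ord0) then expi a else 1) * zcoord x i.
Proof.
rewrite /rot !mulmxDr mulmx1 -!scalemxAr !zcoordD !zcoordZ !zcoord_circle.
case: (_ == _); last by rewrite !mulr0 !mul0r !mulr0 !addr0 mul1r.
rewrite !mulr1 mul1r !mulrA -[X in X + _ + _]mul1r -!mulrDl; congr (_ * _).
by apply: complex_eq; rewrite !(ReD, ImD, ReM, ImM) /=; ring.
Qed.

Lemma rotateE (Z : 'rV[R]_2) x :
  rotate Z x = x *m rot frame ord0 (Z 0 0) *m rot frame ord_max (Z 0 1).
Proof.
apply: zcoord_inj => i; rewrite !zcoord_rot /rotate.
have -> : zcoord (of_zcoord (fun i0 : 'I_m.+1 =>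
   expi (if (i0 < m)%N then Z 0 0 else Z 0 1) * zcoord x i0)) i =
   expi (if (i < m)%N then Z 0 0 else Z 0 1) * zcoord x i.
  by apply: complex_eq; rewrite /of_zcoord /zcoord /= ?row_mxEl ?row_mxEr mxE.
by rewrite eqxx; case: (i < m)%N; rewrite /= ?mul1r.
Qed.

End Frame.

(** * Orbit velocities and the 1-form in charts *)

Section OrbitVelocity.
Variables (R : realType) (N : nat) (tf : torus_frame R N).

Lemma rot_pair (v : 'rV[R]_N) (k l : 'I_2) a b : k != l ->
  v *m rot tf k a *m rot tf l b =
  v + (cos a - 1) *: (v *m tP tf k) + sin a *: (v *m tK tf k)
    + (cos b - 1) *: (v *m tP tf l) + sin b *: (v *m tK tf l).
Proof.
move=> kl.
have PP : v *m tP tf k *m tP tf l = 0 by rewrite -mulmxA tPP (negbTE kl) mulmx0.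
have PK : v *m tP tf k *m tK tf l = 0 by rewrite -mulmxA tPK_mixed // mulmx0.
have KP : v *m tK tf k *m tP tf l = 0 by rewrite -mulmxA tKP_mixed // mulmx0.
have KK : v *m tK tf k *m tK tf l = 0 by rewrite -mulmxA tK_mixed // mulmx0.
rewrite /rot !(mulmxDr, mulmxDl, mulmx1, mul1mx) -!(scalemxAl, scalemxAr) -?scalemxAl ?mulmxA.
rewrite PP PK KP KK !scaler0 !addr0.
by rewrite -!addrA.
Qed.

Lemma is_derive_orbit (v : 'rV[R]_N) (k l : 'I_2) (a b : R) : k != l ->
  is_derive (0 : R) (1 : R) (fun t : R => v *m rot tf k (t * a) *m rot tf l (t * b))
    (a *: (v *m tK tf k) + b *: (v *m tK tf l)).
Proof.
move=> kl.
have dm (c : R) : is_derive (0 : R) (1 : R) (fun t : R => t * c) c.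
  have := is_deriveM (is_derive_id (0 : R) (1 : R)) (is_derive_cst c (0 : R) (1 : R)).
  move=> h; apply: is_derive_eq h _.
  by rewrite scaler0 add0r /GRing.scale /= mulr1.
have dc (c : R) : is_derive (0 : R) (1 : R) (fun t : R => cos (t * c) - 1) 0.
  have h1 : is_derive (0 * c : R) (1 : R) cos (- sin (0 * c)) by exact: is_derive_cos.
  have h2 := @is_derive1_comp R cos (fun t => t * c) 0 _ _ h1 (dm c).
  have h3 := is_deriveB h2 (is_derive_cst (1 : R) (0 : R) (1 : R)).
  by apply: is_derive_eq h3 _; rewrite !(mul0r, sin0, oppr0, mulr0, scaler0, scale0r, addr0).
have ds (c : R) : is_derive (0 : R) (1 : R) (fun t : R => sin (t * c)) c.
  have h1 : is_derive (0 * c : R) (1 : R) sin (cos (0 * c)) by exact: is_derive_sin.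
  have h2 := @is_derive1_comp R sin (fun t => t * c) 0 _ _ h1 (dm c).
  by apply: is_derive_eq h2 _; rewrite mul0r cos0 ?mulr1 ?mul1r ?scale1r.
have -> : (fun t : R => v *m rot tf k (t * a) *m rot tf l (t * b)) =
   cst v + (fun t : R => (cos (t * a) - 1) *: (v *m tP tf k))
     + (fun t : R => sin (t * a) *: (v *m tK tf k))
     + (fun t : R => (cos (t * b) - 1) *: (v *m tP tf l))
     + (fun t : R => sin (t * b) *: (v *m tK tf l)).
  by apply/funext => t; rewrite rot_pair.
have h := is_deriveD (is_deriveD (is_deriveD (is_deriveD (is_derive_cst v (0 : R) (1 : R))
  (is_derive_scale (v *m tP tf k) (dc a))) (is_derive_scale (v *m tK tf k) (ds a)))
  (is_derive_scale (v *m tP tf l) (dc b))) (is_derive_scale (v *m tK tf l) (ds b)).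
by apply: is_derive_eq h _; rewrite !scale0r add0r addr0 add0r.
Qed.

End OrbitVelocity.

Section OneForm.
Variables (R : realType) (n : nat) (tf : torus_frame R n.+1) (ell : hfield tf).
Local Notation S := (sphere_manifold R n).
Local Notation P := (projective_manifold R n).
Local Notation piv x := (pivot (val x)).

Definition lform (x : sphere R n) (V : 'rV[R]_n) : 'rV[R]_2 :=
  \row_k dot (ell k (val x)) (emb x V).

Lemma lformE x V k : lform x V 0 k = dot (ell k (val x)) (emb x V).
Proof. exact: mxE. Qed.

Lemma lform_linear x : linear (lform x).
Proof.
move=> a V W; apply/rowP => k.
have G (A B : 'rV[R]_2) : (a *: A + B) 0 k = a * A 0 k + B 0 k by rewrite !mxE.
have H (y A B D : 'rV[R]_n.+1) : D = a *: A + B -> dot y D = a * dot y A + dot y B.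
  by move=> ->; rewrite dotDr dotZr.
apply: etrans (lformE _ _ _) _; apply: etrans (H _ _ _ _ (emb_lin x a V W)) _.
apply: etrans _ (esym (G (lform x V) (lform x W))).
exact: (esym (congr2 (fun s t : R => a * s + t) (lformE x V k) (lformE x W k))).
Qed.

Lemma lform_antipode x V : lform (antipode x) V = lform x V.
Proof.
have H (y A A' : 'rV[R]_n.+1) k : A' = - A -> dot (ell k (- y)) A' = dot (ell k y) A.
  have -> : ell k (- y) = - ell k y.
    by rewrite -scaleN1r hf_homog -signr_odd /= expr1 scaleN1r.
  by move=> ->; rewrite dotNl dotNr opprK.
apply/rowP => k; apply: etrans (lformE _ _ _) _; apply: etrans _ (esym (lformE _ _ _)).
exact: (H (val x) _ _ k (emb_antipode x V)).
Qed.

Lemma lform_chart x u V k :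
  lform (sphere_param x u) (@coord_vector R n S x u V) 0 k =
  (dot (homog (piv x) u) (homog (piv x) u))^-1 ^+ 2 *
    dot (ell k (homog (piv x) u)) (hlift (piv x) V).
Proof.
have H (y A : 'rV[R]_n.+1) s q : s ^+ 2 = 1 -> y = chart_point s q u ->
    A = chart_frame s q u V -> dot (ell k y) A =
      (dot (homog q u) (homog q u))^-1 ^+ 2 * dot (ell k (homog q u)) (hlift q V).
  by move=> s2 -> ->; exact: dot_hf_chart.
apply: etrans (lformE _ _ _) _.
exact: (H _ _ _ _ (sg_sq x) (sphere_paramE x u) (emb_coord_vector x u V)).
Qed.

Definition lform_proj (z : P) V : 'rV[R]_2 := lform (repr (z : projective R n)) V.

Lemma lform_proj_chart (z : P) u V :
  lform_proj (param z u) (coord_vector z u V) =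
  lform (sphere_param (repr (z : projective R n)) u)
   (@coord_vector R n S (repr (z : projective R n)) u V).
Proof.
apply: (@repr_chart R n _ (fun x c => lform x (c V))) => x c.
exact: lform_antipode.
Qed.

Lemma one_form_lform_proj : one_form (lform_proj : form P 2).
Proof.
split=> [z|z i k]; first exact: (lform_linear (repr (z : projective R n))).
set q := piv (repr (z : projective R n)).
pose F (v : 'rV[R]_n.+1) := (dot v v)^-1 ^+ 2 * dot (ell k v) (hlift q (delta_mx 0 i)).
have o := @punctured_open R n.+1.
have sF : smooth (@punctured R n.+1) F.
  apply: smoothM => //; first by apply: smoothX => //; exact: smooth_r2V.
  apply: smooth_dot => l; [exact: hf_smooth|exact: smooth_cst].
apply: (eq_smooth (@openT _) (f := fun u => F (homog q u))) => [u _|].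
  by rewrite lform_proj_chart lform_chart.
exact: smooth_homog_comp.
Qed.

End OneForm.

(** * Identification of the given forms and metrics *)

Section Identification.
Variables (R : realType) (m : nat).
Local Notation n := (m + m.+1)%N.
Local Notation fr := (frame R m : torus_frame R n.+1).
Implicit Types (x : Sph R m) (z : Proj R m) (V W : 'rV[R]_(m + m.+1)) (Z : 'rV[R]_2).

Lemma torus_sphere0 x : torus_sphere 0 x = x.
Proof.
apply: val_inj; rewrite /= rotateE !mxE !rot0 !mulmx1 //.
Qed.

Lemma ord2_sum (T : nmodType) (F : 'I_2 -> T) : \sum_k F k = F ord0 + F ord_max.
Proof. by rewrite big_ord_recr big_ord_recr big_ord0 /= add0r; congr (F _ + F _); exact: val_inj. Qed.

(** By [embed_vector_curve] the chart velocity of an orbit is the ambient one. *)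
Lemma emb_fundamental Z x :
  emb (x : sphere R n) (fundamental (@torus_sphere R m) Z x) =
  \sum_k Z 0 k *: (embed x *m tK fr k).
Proof.
pose c (t : R) : sphere R n := torus_sphere (t *: Z) x.
have c0 : c 0 = x by rewrite /c scale0r torus_sphere0.
have hd : is_derive (0 : R) (1 : R) (fun t : R => val (c t)) (\sum_k Z 0 k *: (embed x *m tK fr k)).
  rewrite ord2_sum.
  have -> : (fun t : R => val (c t)) = (fun t : R => (embed x : 'rV[R]_n.+1) *m rot fr ord0 (t * Z 0 0) *m rot fr ord_max (t * Z 0 1)).
    by apply/funext => t; rewrite /c /= rotateE !mxE.
  have -> : ord_max = 1 :> 'I_2 by exact: val_inj.
  exact: is_derive_orbit.
have dc : differentiable (fun t : R => val (c t)) 0 by apply/derivable1_diffP; case: hd.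
have := @embed_vector_curve R n _ c 0 1 dc.
rewrite c0; move: hd => [_ ->] <-.
rewrite /fundamental /velocity derive1E.
by rewrite -[torus_sphere _ x]/(c 0) c0.
Qed.

Lemma fundamental_proj Z z :
  fundamental (@torus_proj R m) Z z = fundamental (@torus_sphere R m) Z (rep z).
Proof.
rewrite /fundamental /velocity scale0r /torus_proj torus_sphere0.
have -> : quotient_map (rep z) = z by exact: (proj_repr (z : projective R n)).
congr (derive1 _ 0); apply/funext => t /=.
exact: (projective_coordE (z : projective R n)).
Qed.

Lemma lift_vectorE z V : lift_vector z V = V.
Proof.
rewrite /lift_vector; case: xgetP => [W _ /= <-|/(_ V)]; first by rewrite (mdiff_quot (rep z) W).
by case; exact: (mdiff_quot (rep z) V).
Qed.

Variable j : zmap R m.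
Hypothesis j_su : forall Z, su (j Z).

Definition jmx (k : 'I_2) : 'M[R]_(m.+1 + m.+1) := planar (j (basis R k)).

Fact jmx_tr k : (jmx k)^T = - jmx k.
Proof. by apply: planar_tr; case: (j_su (basis R k)). Qed.
Fact jmx_K k l : jmx k *m tK fr l = tK fr l *m jmx k.
Proof. exact: ext_K. Qed.
Fact jmx_P0 k : jmx k *m tP fr ord0 = jmx k.
Proof. exact: planar_P0. Qed.

Definition jfield : hfield fr := cubic_field jmx_tr jmx_K jmx_P0.

(** Restricted to the coordinates of p, the Hermitian real scalar product is the
    Euclidean one after projection by P_0, which fixes the field. *)
Lemma lambda_ambE k (x v : ambient R m) : lambda_amb j k x v = dot (jfield k x) v.
Proof.
have ip : ('i%C : R[i]) *: pcoord x = pcoord (x *m tK fr ord0).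
  by rewrite frame_K0 pcoord_ext mul_scalar_mx.
have jp : j (basis R k) *m pcoord x = pcoord (x *m jmx k) by rewrite pcoord_ext.
rewrite /lambda_amb ip jp !herm_dot -frame_P0 -[jfield k x]/(cubic fr (jmx k) x) /cubic.
have KP : x *m tK fr ord0 *m tP fr ord0 = x *m tK fr ord0 by rewrite -mulmxA tKP.
have JP : x *m jmx k *m tP fr ord0 = x *m jmx k by rewrite -mulmxA jmx_P0.
rewrite JP dotBl !dotZl; congr (_ - _).
by rewrite (dot_mulmx v) tP_tr KP mulrC [dot v _]dotC.
Qed.

Lemma lambda_sphereE x V : lambda_sphere j x V = lform jfield (x : sphere R n) V.
Proof. by apply/rowP => k; apply: etrans (mxE _ _ _ _) _; apply: etrans _ (esym (lformE _ _ _ _)); exact: lambda_ambE. Qed.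

Lemma lambda_projE z V : lambda_proj j z V = lform_proj jfield z V.
Proof.
rewrite /lambda_proj /descend lift_vectorE; exact: lambda_sphereE.
Qed.

Lemma twist_embE x V :
  embed_vector x (V + fundamental (@torus_sphere R m) (lambda_sphere j x V) x) =
  twistv jfield (val (x : sphere R n)) (emb (x : sphere R n) V).
Proof.
have H (A B D : 'rV[R]_n.+1) (Z : 'rV[R]_2) (y : 'rV[R]_n.+1) : D = 1 *: A + B ->
    B = \sum_k Z 0 k *: (y *m tK fr k) -> (forall k, Z 0 k = dot (jfield k y) A) ->
    D = twistv jfield y A.
  move=> -> -> hZ; rewrite scale1r /twistv; congr (_ + _).
  by apply: eq_bigr => k _; rewrite hZ.
set Z := lambda_sphere j x V; set W := fundamental _ Z x.
apply: (H _ (emb (x : sphere R n) W) _ Z).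
- by rewrite -[V + W]/(V + W) -{1}[V]scale1r; exact: emb_lin.
- exact: emb_fundamental.
- move=> k; rewrite /Z lambda_sphereE; exact: lformE.
Qed.

Lemma metric_sphereE : metric_sphere j = gsphere jfield.
Proof.
apply/funext => x; apply/funext => V; apply/funext => W.
rewrite /metric_sphere /twist /round_sphere.
have H (A B A' B' : 'rV[R]_n.+1) : A = A' -> B = B' -> dotr (A : ambient R m) B = dot A' B' by move=> -> ->.
exact: (H _ _ _ _ (twist_embE x V) (twist_embE x W)).
Qed.

Lemma metric_projE : metric_proj j = gproj jfield.
Proof.
apply/funext => z; apply/funext => V; apply/funext => W.
have E U : lift_vector z (U + fundamental (@torus_proj R m) (lambda_proj j z U) z) =
    U + fundamental (@torus_sphere R m) (lambda_sphere j (rep z) U) (rep z).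
  apply: etrans (lift_vectorE _ _) _.
  apply: (congr1 (fun Y => U + Y)); apply: etrans (fundamental_proj _ _) _.
  apply: (congr1 (fun Z => fundamental (@torus_sphere R m) Z (rep z))).
  exact: (congr1 (lambda_sphere j (rep z)) (lift_vectorE z U)).
have H (A B A' B' : 'rV[R]_n.+1) : A = A' -> B = B' -> dotr (A : ambient R m) B = dot A' B' by move=> -> ->.
have F U := etrans (congr1 (embed_vector (rep z)) (E U)) (twist_embE (rep z) U).
exact: (H _ _ _ _ (F V) (F W)).
Qed.

End Identification.

(** * Isospectrality *)

Section Intertwiner.
Variables (R : realType) (m : nat).
Local Notation n := (m + m.+1)%N.
Local Notation fr := (frame R m : torus_frame R n.+1).
Local Notation C := R[i].
Implicit Types (A X : 'M[C]_m) (mu : 'I_2 -> R).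

Lemma adjmxK q : involutive (@adjmx R q).
Proof. by move=> A; apply/matrixP => i l; rewrite !mxE conjcK. Qed.

Lemma adjmx_unitary A : A *m adjmx A = 1%:M -> invmx A = adjmx A.
Proof.
move=> h; have [uA _] := mulmx1_unit h.
by rewrite -[LHS]mulmx1 -h mulKmx.
Qed.

(** On rows this is (p, q) |-> (A^* p, q); composing a function with it undoes the
    conjugation by [A], see [planar_conj]. *)
Definition lift_unitary A : 'M[R]_(m.+1 + m.+1) := realmx (ext (adjmx A) 1).

Lemma lift_unitary_tr A : (lift_unitary A)^T = realmx (ext A 1).
Proof. by rewrite -realmx_adj ext_adj adjmxK conjc1. Qed.

Lemma lift_unitary_orthogonal A : A *m adjmx A = 1%:M -> orthogonal_mx (lift_unitary A).
Proof.
move=> h; rewrite /orthogonal_mx lift_unitary_tr -realmxM extM h mul1r ext1.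
exact: realmx1.
Qed.

Lemma planar_conj A X : planar (A *m X *m adjmx A) =
  lift_unitary A *m planar X *m (lift_unitary A)^T.
Proof. by rewrite lift_unitary_tr -!realmxM !extM mulmxA mulr1 mul1r. Qed.

Definition covector mu : 'rV[R]_2 := \row_k mu k.

Lemma covectorN mu : covector (fun k => - mu k) = - covector mu.
Proof. by apply/rowP => k; rewrite !mxE. Qed.

Lemma planar_sum (j : zmap R m) mu : \sum_k mu k *: jmx j k = planar (j (covector mu)).
Proof.
have pZ (a : R) X : planar (real_complex R a *: X) = a *: planar X.
  by rewrite -realmxZ extZ mulr0.
have pD X Y : planar (X + Y) = planar X + planar Y by rewrite -realmxD extD addr0.
have e : covector mu = mu ord0 *: basis R ord0 + (mu ord_max *: basis R ord_max + 0).
  by rewrite addr0; apply/rowP => k; rewrite !mxE; case: k => [[|[|k]] hk] //=;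
    rewrite ?mulr1 ?mulr0 ?addr0 ?add0r; congr mu; exact: val_inj.
by rewrite ord2_sum e !linearP linear0 addr0 pD !pZ.
Qed.

Variables j j' : zmap R m.
Hypothesis j_su : forall Z, su (j Z).
Hypothesis j'_su : forall Z, su (j' Z).
Hypothesis jj' : isospectral_maps j j'.

(** A choice among all conjugating matrices, made through the set of them: the
    sets for [Z] and [- Z] agree, and so do the choices. *)
Definition conjugator (Z : 'rV[R]_2) : 'M[C]_m :=
  xget 1%:M [set A | SU A /\ j' Z = A *m j Z *m invmx A].

Lemma conjugatorP Z : SU (conjugator Z) /\ j' Z = conjugator Z *m j Z *m adjmx (conjugator Z).
Proof.
rewrite /conjugator; case: xgetP => [A _ [sA ->]|h].
  by rewrite (adjmx_unitary sA.1).
by have [A hA] := jj' Z; case: (h A).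
Qed.

Lemma conjugatorN Z : conjugator (- Z) = conjugator Z.
Proof.
have eN (k : zmap R m) : k (- Z) = - k Z by exact: linearN.
have eA A : A *m - j Z *m invmx A = - (A *m j Z *m invmx A) by rewrite mulmxN mulNmx.
rewrite /conjugator !eN; congr xget; apply/funext => A.
rewrite /mkset eA; apply/propext; split=> -[sA h]; split=> //; first exact: oppr_inj h.
by rewrite h.
Qed.

Lemma transplant_fields lam q (F : 'I_q -> 'rV[R]_n.+1 -> R) :
  (forall i, eigen (jfield j_su) lam (F i)) -> free_on (@punctured R n.+1) F ->
  exists G : 'I_q -> 'rV[R]_n.+1 -> R,
   (forall i, eigen (jfield j'_su) lam (G i)) /\ free_on (@punctured R n.+1) G.
Proof.
apply: (@transplant R n.+1 fr (jfield j_su) (jfield j'_su)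
  (fun mu => lift_unitary (conjugator (covector mu)))).
- by move=> mu; apply: lift_unitary_orthogonal; case: (conjugatorP (covector mu)) => -[].
- by move=> mu k; exact: ext_K.
- by move=> mu; rewrite covectorN conjugatorN.
- move=> mu w; rewrite !weighted_cubic !planar_sum.
  have [[uA _] ->] := conjugatorP (covector mu).
  apply: cubic_commute; [exact: lift_unitary_orthogonal|exact: ext_K|exact: planar_conj].
Qed.

End Intertwiner.

Section Multiplicity.
Variables (R : realType) (n : nat) (tf : torus_frame R n.+1).
Local Notation P := (projective_manifold R n).
Implicit Types ell : hfield tf.

Lemma free_lift q (f : 'I_q -> P -> R) : fun_free f ->
  free_on (@punctured R n.+1) (fun i => lift_fun (f i)).
Proof.
move=> ff c h; apply: ff => z; rewrite -(proj_repr (z : projective R n)).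
rewrite -[RHS](h _ (sphere_neq0 (repr (z : projective R n)))).
by apply: eq_bigr => i _; rewrite lift_fun_val.
Qed.

Lemma free_descend ell lam q (F : 'I_q -> 'rV[R]_n.+1 -> R) :
  (forall i, eigen ell lam (F i)) -> free_on (@punctured R n.+1) F ->
  fun_free (fun i => descend_fun (F i)).
Proof.
move=> eF fF c h; apply: fF => v v0.
rewrite -[RHS](h (proj (cone v) : P)); apply: eq_bigr => i _; congr (_ * _).
have [_ hF _] := eF i; rewrite /descend_fun.
have i0 : inv_norm v != 0 by rewrite gt_eqF // inv_norm_gt0.
have [->|->] : repr (proj (cone v)) = cone v \/ repr (proj (cone v)) = antipode (cone v) by exact: repr_proj.
  by rewrite val_cone // hF.
have -> : val (antipode (cone v)) = (- inv_norm v) *: v by rewrite /= val_cone // scaleNr.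
by rewrite hF // oppr_eq0.
Qed.

Lemma le_multiplicity ell ell' lam :
  (forall q (F : 'I_q -> 'rV[R]_n.+1 -> R), (forall i, eigen ell lam (F i)) ->
     free_on (@punctured R n.+1) F -> exists G : 'I_q -> 'rV[R]_n.+1 -> R,
     (forall i, eigen ell' lam (G i)) /\ free_on (@punctured R n.+1) G) ->
  (multiplicity (gproj ell) lam <= multiplicity (gproj ell') lam)%E.
Proof.
move=> tr; apply: le_ereal_sup => _ [q [f [ff ef]] <-].
have [G [eG fG]] := tr q (fun i => lift_fun (f i)) (fun i => eigenfunction_lift (ef i)) (free_lift ff).
exists q => //; exists (fun i => descend_fun (G i)); split; first exact: free_descend eG fG.
by move=> i; exact: eigenfunction_descend.
Qed.

End Multiplicity.

Theorem proposition6p3 (R : realType) (m : nat) (I : Type) (j : I -> zmap R m) :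
  (3 <= m)%N ->
  (forall t Z, su (j t Z)) ->
  (forall s t, isospectral_maps (j s) (j t)) ->
  (forall s t, s <> t -> ~ equivalent_maps (j s) (j t)) ->
  (forall t, generic_map (j t)) ->
  (forall t,
    [/\ (forall (x : Sph R m) (v : ambient R m), dotr (embed x) v = 0 ->
          forall k, lambda_amb (j t) k (embed x) v =
                    lambda_amb (j t) k (- embed x) (- v)),
        (forall (x : Sph R m) V,
          lambda_sphere (j t) (antipodal_map x) (mdiff (@antipodal_map R m) x V) =
          lambda_sphere (j t) x V),
        one_form (lambda_proj (j t)),
        (forall (x : Sph R m) V,
          lambda_proj (j t) (quotient_map x) (mdiff (@quotient_map R m) x V) =
          lambda_sphere (j t) x V) &
        riemannian_covering (metric_sphere (j t)) (metric_proj (j t))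
          (@quotient_map R m)]) /\
  (forall s t, isospectral (metric_proj (j s)) (metric_proj (j t))).
Proof.
move=> _ jsu jiso _ _; split=> [t|s t lam].
- set ell := jfield (jsu t).
  have lE x V : lambda_sphere (j t) x V = lform ell x V by exact: lambda_sphereE.
  have lA (x : Sph R m) V : lambda_sphere (j t) (antipodal_map x) V = lambda_sphere (j t) x V.
    apply: etrans (lE _ _) _; apply: etrans (lform_antipode ell x V) (esym (lE _ _)).
  split.
  + move=> x v _ k; rewrite !(lambda_ambE (jsu t)).
    have -> : jfield (jsu t) k (- embed x) = - jfield (jsu t) k (embed x).
      by rewrite -scaleN1r hf_homog -signr_odd /= expr1 scaleN1r.
    by rewrite dotNl dotNr opprK.
  + move=> x V; apply: etrans (lA _ _) _.
    exact: (congr1 (lambda_sphere (j t) x) (mdiff_anti x V)).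
  + have -> : lambda_proj (j t) = lform_proj ell; last exact: one_form_lform_proj.
    by apply/funext => z; apply/funext => V; exact: lambda_projE.
  + move=> x V; rewrite (_ : mdiff _ _ _ = V); last exact: (mdiff_quot x V).
    rewrite /lambda_proj /descend lift_vectorE.
    have lR y : y = x \/ y = antipodal_map x -> lambda_sphere (j t) y V = lambda_sphere (j t) x V.
      by move=> [->|->] //; exact: lA.
    exact: (lR _ (@repr_proj R (m + m.+1) x)).
  + rewrite (metric_sphereE (jsu t)) (metric_projE (jsu t)).
    exact: quot_riemannian_covering.
- rewrite (metric_projE (jsu s)) (metric_projE (jsu t)); apply/eqP; rewrite eq_le.
  apply/andP; split; apply: le_multiplicity => q F eF fF.
    exact: (transplant_fields (jsu t) (jiso s t) eF fF).
  exact: (transplant_fields (jsu s) (jiso t s) eF fF).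
Qed.
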